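(* Let $\mathfrak g$ be a complex simple Lie algebra. For any nilradical $\mathfrak n$ of a standard parabolic subalgebra of $\mathfrak g$, the Lie algebra $\mathfrak f_{\mathfrak n}=\tilde{\mathfrak n}\oplus\mathfrak t_{\mathfrak n}$ is Frobenius, i.e., $\operatorname{ind}\mathfrak f_{\mathfrak n}=0$.
   Context: **Setup.** $\mathfrak g$ is a complex simple Lie algebra, $\mathfrak b$ a fixed Borel subalgebra, $\mathfrak t\subset\mathfrak b$ a Cartan subalgebra, $\Delta$ the root system, $\Delta^+$ the positive roots corresponding to $\mathfrak b$, $\Pi$ the simple roots, $\theta$ the highest root, $(\ ,\,)$ the Weyl-invariant form, $\mathfrak g_\gamma$ the root spaces. For $\gamma\in\Delta^+$ and $\alpha\in\Pi$, $[\gamma:\alpha]$ is the coefficient of $\alpha$ in $\gamma$. For a finite-dimensional Lie algebra $\mathfrak q$, $\operatorname{ind}\mathfrak q=\min_{\xi\in\mathfrak q^*}\dim\mathfrak q^\xi$ (stabilisers for the coadjoint representation). For $T\subset\Pi$, $\mathfrak n_T$ is the sum of the $\mathfrak g_\gamma$ over the set $\Delta(\mathfrak n_T)$ of $\gamma\in\Delta^+$ with $[\gamma:\alpha]>0$ for some $\alpha\in T$; it is the nilradical of the standard parabolic subalgebra $\mathfrak p_T\supset\mathfrak b$ whose standard Levi subalgebra has simple roots $\Pi\setminus T$. **Kostant cascade.** $\mathcal K=\{\beta_1,\dots,\beta_m\}\subset\Delta^+$ is built recursively: $\beta_1=\theta$ with $\Delta\langle1\rangle=\Delta$. Given $\beta_i$,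 the highest root of an irreducible subsystem $\Delta\langle i\rangle$ with basis $\Pi\langle i\rangle\subset\Pi$, decompose $\{\gamma\in\Delta\langle i\rangle\mid(\gamma,\beta_i)=0\}$ into irreducible root systems (with bases the connected components of $\{\alpha\in\Pi\langle i\rangle\mid(\alpha,\beta_i)=0\}$); their highest roots are the descendants of $\beta_i$ and also belong to $\mathcal K$; continue until nothing is left. Put $\mathcal H_{\beta_i}=\{\gamma\in\Delta\langle i\rangle\cap\Delta^+\mid(\gamma,\beta_i)>0\}$ and $\Phi(\beta_i)=\Pi\cap\mathcal H_{\beta_i}$. **Optimisation and $\mathfrak f_{\mathfrak n}$.** For $\mathfrak n=\mathfrak n_T$ put $\mathcal K(\mathfrak n)=\mathcal K\cap\Delta(\mathfrak n)$ and $\tilde T=\bigcup_{\beta\in\mathcal K(\mathfrak n)}\Phi(\beta)$. The optimisation of $\mathfrak n$ is $\tilde{\mathfrak n}:=\mathfrak n_{\tilde T}$. Further, $\mathfrak t_{\mathfrak n}=\bigoplus_{\beta\in\mathcal K(\mathfrak n)}[\mathfrak g_\beta,\mathfrak g_{-\beta}]\subset\mathfrak t$ and $\mathfrak f_{\mathfrak n}=\tilde{\mathfrak n}\oplus\mathfrak t_{\mathfrak n}\subset\mathfrak b$, a solvable Lie algebra. *)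

(* Defs.v *)
From HB Require Import structures.
From mathcomp Require Import all_boot all_order all_algebra.
From mathcomp Require Export complex.
From mathcomp Require Export boolp classical_sets functions fsbigop reals.

Set Implicit Arguments.
Unset Strict Implicit.
Unset Printing Implicit Defensive.

Import Order.TTheory GRing.Theory Num.Theory.
Local Open Scope classical_set_scope.
Local Open Scope ring_scope.

HB.mixin Record Vector_isLie (F : fieldType) L of Vector F L := {
  lie : L -> L -> L;
  lie_linearl : forall y, linear (lie^~ y);
  lie_linearr : forall x, linear (lie x);
  liexx : forall x, lie x x = 0;
  lie_jacobi : forall x y z,
    lie x (lie y z) + lie y (lie z x) + lie z (lie x y) = 0
}.

#[short(type="lieAlgType")]
HB.structure Definition LieAlg (F : fieldType) :=
  {L of Vector F L & Vector_isLie F L}.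

Section Subspaces.
Context {F : fieldType} {L : lieAlgType F}.
Implicit Types U V I : {vspace L}.

HB.instance Definition _ (x : L) :=
  GRing.isLinear.Build F L L _ (lie x) (lie_linearr x).

Definition ad (x : L) : 'End(L) := linfun (lie x).

Definition lie_vs U V : {vspace L} :=
  <<[seq lie u v | u <- vbasis U, v <- vbasis V]>>%VS.

Definition lie_subalg U : bool := (lie_vs U U <= U)%VS.

Definition lie_ideal I : bool := (lie_vs fullv I <= I)%VS.

Definition lie_solvable U : Prop :=
  exists n, iter n (fun V => lie_vs V V) U = 0%VS.

Definition lie_nilpotent U : Prop := exists n, iter n (lie_vs U) U = 0%VS.

Definition cartan U : Prop :=
  [/\ lie_subalg U, lie_nilpotent U &
      forall x : L, (forall u, u \in U -> lie x u \in U) -> x \in U].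

Definition borel U : Prop :=
  [/\ lie_subalg U, lie_solvable U &
      forall V, lie_subalg V -> lie_solvable V -> (U <= V)%VS -> V = U].

Lemma lie_suml (I : Type) (r : seq I) (f : I -> L) (y : L) :
  lie (\sum_(i <- r) f i) y = \sum_(i <- r) lie (f i) y.
Proof.
elim/big_rec2: _ => [|i a b _ <-]; last first.
  by have /= := lie_linearl y 1 (f i) b; rewrite !scale1r.
by have /= := lie_linearl y (-1) 0 0; rewrite scaler0 addr0 scaleN1r addNr.
Qed.

Lemma lieZl (a : F) (x y : L) : lie (a *: x) y = a *: lie x y.
Proof.
have l0 : lie 0 y = 0.
  by have /= := lie_linearl y (-1) 0 0; rewrite scaler0 addr0 scaleN1r addNr.
by have /= := lie_linearl y a x 0; rewrite l0 !addr0.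
Qed.

Lemma memv_lie U V (u v : L) : u \in U -> v \in V -> lie u v \in lie_vs U V.
Proof.
move=> /coord_vbasis -> /coord_vbasis ->.
rewrite lie_suml; apply: memv_suml => i _.
rewrite lieZl; apply: memvZ; rewrite linear_sum; apply: memv_suml => j _.
rewrite linearZ; apply/memvZ/memv_span/allpairsP.
by exists ((vbasis U)`_i, (vbasis V)`_j); rewrite !mem_nth ?size_tuple.
Qed.

End Subspaces.

Definition lie_simple (F : fieldType) (L : lieAlgType F) : Prop :=
  lie_vs (fullv : {vspace L}) fullv <> 0%VS /\
  forall I : {vspace L}, lie_ideal I -> I = 0%VS \/ I = fullv.

Section SubLie.
Context {F : fieldType} {L : lieAlgType F}.

Definition lie_sub (U : {vspace L}) (hU : lie_subalg U) : Type := subvs_of U.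

Context (U : {vspace L}) (hU : lie_subalg U).

HB.instance Definition _ := Vector.copy (lie_sub hU) (subvs_of U).

Lemma sub_lie_closed (x y : subvs_of U) : lie (vsval x) (vsval y) \in U.
Proof. exact: (subvP hU) (memv_lie (subvsP x) (subvsP y)). Qed.

Definition sub_lie (x y : lie_sub hU) : lie_sub hU :=
  Subvs (sub_lie_closed x y).

Lemma sub_lie_linearl y : linear (sub_lie^~ y).
Proof. by move=> a u v; apply/val_inj/lie_linearl. Qed.

Lemma sub_lie_linearr x : linear (sub_lie x).
Proof. by move=> a u v; apply/val_inj/lie_linearr. Qed.

Lemma sub_liexx x : sub_lie x x = 0.
Proof. exact/val_inj/liexx. Qed.

Lemma sub_lie_jacobi x y z :
  sub_lie x (sub_lie y z) + sub_lie y (sub_lie z x) + sub_lie z (sub_lie x y)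
  = 0.
Proof. exact/val_inj/lie_jacobi. Qed.

HB.instance Definition _ := Vector_isLie.Build F (lie_sub hU)
  sub_lie_linearl sub_lie_linearr sub_liexx sub_lie_jacobi.

End SubLie.

Section Index.
Context {F : fieldType} (q : lieAlgType F).

Definition coad (x : q) (xi : 'Hom(q, F^o)) : 'Hom(q, F^o) :=
  linfun (fun y => - xi (lie x y)).

Definition lie_stab (xi : 'Hom(q, F^o)) : {vspace q} :=
  lker (linfun (fun x => coad x xi)).

Lemma mem_lie_stab (xi : 'Hom(q, F^o)) (x : q) :
  reflect (forall y, xi (lie x y) = 0) (x \in lie_stab xi).
Proof.
have lin z : linear (fun y => - xi (lie z y)).
  by move=> a u v /=; rewrite lie_linearr linearD linearZ opprD scalerN.
pose f z := GRing.isLinear.Build _ _ _ _ _ (lin z).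
pose c z : {linear q -> F^o} := HB.pack (fun y => - xi (lie z y)) (f z).
have cE z y : coad z xi y = - xi (lie z y) by rewrite (lfunE (c z)).
have clin : linear (fun z => coad z xi).
  move=> a u v; apply/lfunP => y.
  by rewrite !lfunE /= !lfunE /= !cE lie_linearl linearD linearZ opprD scalerN.
pose g := GRing.isLinear.Build _ _ _ _ _ clin.
pose d : {linear q -> 'Hom(q, F^o)} := HB.pack (fun z => coad z xi) g.
rewrite memv_ker (lfunE d) /=; apply: (iffP eqP) => [/lfunP e y|e].
  by move: (e y); rewrite cE lfunE /= => /eqP; rewrite oppr_eq0 => /eqP.
by apply/lfunP => y; rewrite cE e oppr0 lfunE.
Qed.

Lemma lie_index_subproof : exists n, `[< exists xi, \dim (lie_stab xi) = n >].
Proof. by exists (\dim (lie_stab 0)); apply/asboolP; exists 0. Qed.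

Definition lie_index : nat := ex_minn lie_index_subproof.

Definition frobenius : Prop := lie_index = 0%N.

End Index.

Section Roots.
Context {F : numClosedFieldType} {g : lieAlgType F}.
(* [t] is meant to be a Cartan subalgebra and [b] a Borel subalgebra
   containing it. [linfun f] agrees with [f] only when [f] is linear, which is
   the case of all the functions to which it is applied here. *)
Context (t b : {vspace g}).

Local Notation tdual := 'Hom(subvs_of t, F^o).

Implicit Types (l m : tdual) (D E A B T : set tdual).

Definition root_space l : {vspace g} :=
  lker (linfun (fun x : g => linfun (fun h : subvs_of t =>
    lie (vsval h) x - (l h : F) *: x))).

Definition lie_root : set tdual := [set l | l != 0 /\ root_space l != 0%VS].

Definition pos_root : set tdual := [set l | lie_root l /\ (root_space l <= b)%VS].

Definition simple_root : set tdual :=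
  [set l | pos_root l /\
    ~ exists l1 l2, [/\ pos_root l1, pos_root l2 & l = l1 + l2]].

Definition killing (x y : g) : F :=
  let e := vbasis (fullv : {vspace g}) in \tr (passmx.mxof e e (ad x \o ad y)%VF).

(* The form on the dual of [t] is the one transported from the restriction to
   [t] of the Killing form, through the isomorphism [killing_lfun]. *)
Definition killing_lfun : 'Hom(subvs_of t, tdual) :=
  linfun (fun h : subvs_of t => linfun (fun h' : subvs_of t =>
    killing (vsval h) (vsval h') : F^o) : tdual).

Definition form l m : F := l ((killing_lfun^-1)%VF m).

(* The function [c] is determined by [l] on [simple_root] only. *)
Definition root_coef l : tdual -> nat :=
  xget (fun=> 0%N) [set c : tdual -> nat |
    l = \sum_(a \in simple_root) a *+ c a].

(* [highest D l] : [l] is the highest root of the root subsystem [D], with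
   respect to the basis [simple_root `&` D] of [D]. *)
Definition highest D l : Prop :=
  D l /\ forall m, D m -> exists c : tdual -> nat,
    l - m = \sum_(a \in simple_root `&` D) a *+ c a.

Definition orthogonal_sets A B : Prop :=
  forall l m, A l -> B m -> form l m = 0.

Definition irreducible_set D : Prop :=
  D !=set0 /\
  forall A B, D = A `|` B -> orthogonal_sets A B -> A = set0 \/ B = set0.

Definition irreducible_component E D : Prop :=
  [/\ D `<=` E, irreducible_set D & orthogonal_sets D (E `\` D)].

(* [cascade_at D l] : [l] is an element of the Kostant cascade, and [D] is the
   irreducible subsystem of which it is the highest root. *)
Inductive cascade_at : set tdual -> tdual -> Prop :=
| cascade_top th : highest lie_root th -> cascade_at lie_root th
| cascade_descendant D l D' l' :
    cascade_at D l ->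
    irreducible_component [set m | D m /\ form m l = 0] D' ->
    highest D' l' ->
    cascade_at D' l'.

Definition cascade : set tdual := [set l | exists D, cascade_at D l].

Definition heisenberg_set l : set tdual :=
  [set m | exists D, [/\ cascade_at D l, D m, pos_root m & 0 < form m l]].

Definition cascade_simple l : set tdual := simple_root `&` heisenberg_set l.

Definition nil_roots T : set tdual :=
  [set l | pos_root l /\ exists2 a, T a & (0 < root_coef l a)%N].

Definition nilradical T : {vspace g} :=
  \big[addv/0%VS]_(l \in nil_roots T) root_space l.

Definition nil_cascade T : set tdual := cascade `&` nil_roots T.

Definition optimal_set T : set tdual :=
  \bigcup_(l in nil_cascade T) cascade_simple l.

Definition nil_torus T : {vspace g} :=
  \big[addv/0%VS]_(l \in nil_cascade T)
     lie_vs (root_space l) (root_space (- l)).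

Definition frobenius_envelope T : {vspace g} :=
  (nilradical (optimal_set T) + nil_torus T)%VS.

End Roots.

Arguments simple_root {F g} t b _.

(* Main.v *)
Require Import Defs.
From HB Require Import structures.
From mathcomp Require Import all_boot all_order all_algebra.
From mathcomp Require Import complex boolp classical_sets reals ring.
Import Defs.

Set Implicit Arguments.
Unset Strict Implicit.
Unset Printing Implicit Defensive.

Import Order.TTheory GRing.Theory Num.Theory.
Local Open Scope classical_set_scope.
Local Open Scope ring_scope.

(** The algebra is shown to be Frobenius by exhibiting one functional with trivial
    stabilizer. Let [K] be the set of cascade roots lying in the nilradical, and
    let [z] be the sum of nonzero root vectors for the [- l] with [l] in [K]. For
    the functional [killing _ z], the skew form [killing (lie x y) z] pairs two
    root spaces only when the sum of their roots is in [K], and pairs the torus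
    with the root spaces of [K] only. It is nondegenerate on the Frobenius
    envelope ([nondegenerate_functional]) for the following reasons.

    - Every positive root lies in exactly one Heisenberg set ([cascade_cover],
      [heisenberg_unique]).
    - Two positive roots whose sum is a cascade root [m] lie in the Heisenberg set
      of [m] ([cascade_sum_heisenberg]); conversely, [l |-> m - l] is an involution
      of this Heisenberg set without [m] ([heisenberg_partner]).
    - The roots of the optimal nilradical are exactly those of the Heisenberg sets
      of the elements of [K] ([heisenberg_optimal], [optimal_heisenberg]).
    - Distinct cascade roots are orthogonal ([cascade_orthogonal]), so that the
      torus, spanned by the dual vectors of the elements of [K], is paired
      perfectly with the root spaces of [K].

    Hence in a basis of root vectors the form is monomial apart from its block on
    the torus and the root spaces of [K], which is invertible.

    The combinatorics of the cascade rests on [cascade_trichotomy]: the irreducible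
    subsystems met in the recursive construction are nested or disjoint. All
    subsystems carry a basis made of simple roots, and the recursion is possible
    because irreducible subsystems have a highest root ([highest_exists]).

    The root theory is derived from the definition of a Cartan subalgebra as a
    self-normalizing nilpotent subalgebra [t]. The algebra is a sum of generalized
    weight spaces of [t] ([weight_decomposition]), and [t] is the one of weight
    zero by Engel's argument ([gen_weight0]). From there on, everything comes
    from one principle: on a subspace stable by [x] and [y], the trace of
    [ad (lie x y)] is zero. For a sum of weight spaces along a string this gives
    the rationality of weights ([string_ratio]), hence Cartan's criterion
    ([killing_neq0]) and a nondegenerate Killing form; then one-dimensional root
    spaces ([weight_multiples]), the length of root strings ([string_trace]) and
    reflections ([root_reflection]). A maximal solvable subalgebra containing [t]
    defines positive roots: were neither [l] nor [- l] positive, a larger solvable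
    subalgebra could be built ([pos_root_total]). *)

(** * Generalities *)

Lemma linfunE_linear (F : fieldType) (U W : vectType F) (f : U -> W)
    (lf : linear f) u : linfun f u = f u.
Proof.
pose f' : {linear U -> W} := HB.pack f (GRing.isLinear.Build _ _ _ _ f lf).
exact: (lfunE f').
Qed.

Lemma mulrz_inj (F : numFieldType) (V : lmodType F) (v : V) : v != 0 -> injective (intmul v).
Proof.
move=> v0 a b /eqP; rewrite -!scaler_int -subr_eq0 -scalerBl scaler_eq0 (negPf v0) orbF.
by rewrite subr_eq0 eqr_int => /eqP.
Qed.

Lemma big_seq_memv {F : fieldType} {V : vectType F} {I : eqType} (s : seq I)
    (U : I -> {vspace V}) (v : V) : uniq s -> v \in (\sum_(i <- s) U i)%VS ->
  exists f : I -> V, (forall i, f i \in U i) /\ v = \sum_(i <- s) f i.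
Proof.
elim: s v => [|i s IH] v /=.
  rewrite big_nil memv0 => _ /eqP->; exists (fun=> 0); rewrite big_nil.
  by split=> // i; exact: mem0v.
move=> /andP[sni us]; rewrite big_cons => /memv_addP[u uU [_ /(IH _ us)[f [fU ->]] ->]].
exists (fun j => if j == i then u else f j); split=> [j|].
  by have [->|_] := eqVneq j i.
rewrite big_cons eqxx; congr (_ + _); apply: eq_big_seq => j js.
by have [ji|//] := eqVneq j i; rewrite ji in js; rewrite js in sni.
Qed.

Section Cones.
Context {F : numFieldType} {V : lmodType F}.
Implicit Types (S : set V) (x y : V) (s : seq V).

Definition cone S x := exists2 s, {in s, forall m, S m} & x = \sum_(m <- s) m.

Lemma cone0 S : cone S 0.
Proof. by exists [::]; rewrite ?big_nil // => m; rewrite in_nil. Qed.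

Lemma cone_mem S x : S x -> cone S x.
Proof. by move=> Sx; exists [:: x]; rewrite ?big_seq1 // => m; rewrite inE => /eqP->. Qed.

Lemma coneD S x y : cone S x -> cone S y -> cone S (x + y).
Proof.
move=> [s sS ->] [r rS ->]; exists (s ++ r); rewrite ?big_cat // => m.
by rewrite mem_cat => /orP[/sS|/rS].
Qed.

Lemma coneMn S x n : cone S x -> cone S (x *+ n).
Proof.
by move=> Sx; elim: n => [|n IH]; rewrite ?mulr0n ?mulrS; [exact: cone0|exact: coneD].
Qed.

Lemma cone_trans S S' x : (forall y, S y -> cone S' y) -> cone S x -> cone S' x.
Proof.
move=> SS' [s sS ->]; rewrite big_seq; elim/big_rec: _ => [|y z /sS/SS' Sy]; first exact: cone0.
exact: coneD.
Qed.

End Cones.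

(** * Traces and generalized eigenvectors *)

Section VspaceOfPred.
Context {F : fieldType} {V : vectType F}.
Implicit Types (U W : {vspace V}) (P : V -> Prop).

(** A subspace of maximal dimension among those contained in [P] is all of [P].
    This provides subspaces defined by infinitely many, undecidable conditions.
    *)
Lemma vspace_of_pred P : P 0 -> (forall a u v, P u -> P v -> P (a *: u + v)) ->
  exists U, forall v, v \in U <-> P v.
Proof.
move=> P0 Plin.
pose Q n := `[< exists2 U, \dim U = n & forall v, v \in U -> P v >].
have Q0 : exists n, Q n.
  exists 0%N; apply/asboolP; exists 0%VS; first by rewrite dimv0.
  by move=> v; rewrite memv0 => /eqP->.
have Qb n : Q n -> (n <= \dim {:V})%N by move=> /asboolP[U <- _]; exact/dimvS/subvf.
case: (ex_maxnP Q0 Qb) => n /asboolP[U dimU PU] maxn.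
exists U => v; split=> [/PU//|Pv]; apply: contraT => vU.
have : Q (\dim (<[v]> + U)%VS).
  apply/asboolP; exists (<[v]> + U)%VS => // _ /memv_addP[_ /vlineP[a ->]] [u uU ->].
  exact/Plin/PU.
move/maxn; rewrite -dimU => le; have : U == (<[v]> + U)%VS.
  by rewrite eqEdim addvSr.
move=> /eqP e; case/negP: vU; rewrite e; apply: subvP (addvSl _ _) _ (memv_line _).
Qed.

End VspaceOfPred.

Section Trace.
Context {F : fieldType}.
Implicit Types (V W : vectType F).

Definition lftr V (f : 'End(V)) : F :=
  \tr (passmx.mxof (vbasis {:V}) (vbasis {:V}) f).

Lemma lftrP V a (f h : 'End(V)) : lftr (a *: f + h) = a * lftr f + lftr h.
Proof. by rewrite /lftr passmx.mxof_linear mxtraceD mxtraceZ. Qed.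

Lemma lftrD V (f h : 'End(V)) : lftr (f + h) = lftr f + lftr h.
Proof. by rewrite -[f]scale1r lftrP mul1r scale1r. Qed.

Lemma lftr0 V : lftr (0 : 'End(V)) = 0.
Proof. by have := lftrP (-1) (0 : 'End(V)) 0; rewrite scaler0 addr0 mulN1r addNr. Qed.

Lemma lftrZ V a (f : 'End(V)) : lftr (a *: f) = a * lftr f.
Proof. by rewrite -[_ *: _]addr0 lftrP lftr0 addr0. Qed.

Lemma lftrB V (f h : 'End(V)) : lftr (f - h) = lftr f - lftr h.
Proof. by rewrite addrC -scaleN1r lftrP mulN1r addrC. Qed.

Lemma lftr_comp V W (f : 'Hom(V, W)) (h : 'Hom(W, V)) :
  lftr (h \o f)%VF = lftr (f \o h)%VF.
Proof.
by rewrite /lftr !(@passmx.mxof_comp _ _ _ _ _ _ _ (vbasisP _)) mxtrace_mulC.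
Qed.

Lemma lftr1 V : lftr (\1%VF : 'End(V)) = (\dim {:V})%:R.
Proof. by rewrite /lftr passmx.mxof1 ?mxtrace1 // (basis_free (vbasisP _)). Qed.

End Trace.

Section RestrictedTrace.
Context {F : fieldType} {V : vectType F}.
Implicit Types (U W : {vspace V}) (A B Q : 'End(V)).

(** The projection factors as a map onto [W] followed by the inclusion, and
    exchanging the two factors gives the identity of [W]. *)
Lemma lftr_projv W : lftr (projv W) = (\dim W)%:R.
Proof.
pose i : 'Hom(subvs_of W, V) := linfun vsval.
pose p : 'Hom(V, subvs_of W) := linfun (vsproj W).
have -> : projv W = (i \o p)%VF.
  by apply/lfunP => v; rewrite comp_lfunE !lfunE /= [vsproj W]unlock.
have /esym : (p \o i)%VF = \1%VF.
  by apply/lfunP => v; rewrite comp_lfunE !lfunE /= vsvalK.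
by rewrite lftr_comp => <-; rewrite lftr1 dimvf.
Qed.

(** The trace on [W] of an operator that preserves [W], without building its
    restriction; by [trv_proj] every projection onto [W] gives the same value.
    *)
Definition trv W A : F := lftr (A \o projv W)%VF.

Lemma trv_proj W A Q : {in W, forall v, Q v = v} -> (forall v, Q v \in W) ->
  {in W, forall v, A v \in W} -> lftr (A \o Q)%VF = trv W A.
Proof.
move=> Qid Qim AW; have -> : (A \o Q = projv W \o (A \o Q))%VF.
  by apply/lfunP => v; rewrite !comp_lfunE projv_id // AW.
rewrite -lftr_comp; congr lftr; apply/lfunP => v; rewrite !comp_lfunE Qid //.
exact: memv_proj.
Qed.

Lemma trvD W A B : trv W (A + B) = trv W A + trv W B.
Proof. by rewrite /trv comp_lfunDl lftrD. Qed.

Lemma trvZ W a A : trv W (a *: A) = a * trv W A.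
Proof. by rewrite /trv -comp_lfunZl lftrZ. Qed.

Lemma trv1 W : trv W \1%VF = (\dim W)%:R.
Proof. by rewrite /trv comp_lfun1l lftr_projv. Qed.

Lemma trv_commutator W A B :
  {in W, forall v, A v \in W} -> {in W, forall v, B v \in W} ->
  trv W ((A \o B) - (B \o A))%VF = 0.
Proof.
move=> AW BW; rewrite /trv; set P := projv W.
have -> : (((A \o B) - (B \o A)) \o P = ((A \o P) \o (B \o P)) - ((B \o P) \o (A \o P)))%VF.
  apply/lfunP => v; rewrite !(comp_lfunE, add_lfunE, opp_lfunE).
  by rewrite !(projv_id (AW _ _), projv_id (BW _ _)) ?memv_proj.
by rewrite lftrB lftr_comp subrr.
Qed.

Lemma trv_add U W A : (U :&: W = 0)%VS ->
  {in U, forall v, A v \in U} -> {in W, forall v, A v \in W} ->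
  trv (U + W) A = trv U A + trv W A.
Proof.
move=> UW AU AW.
pose pU := (daddv_pi U W \o projv (U + W))%VF.
pose pW := (daddv_pi W U \o projv (U + W))%VF.
rewrite -(trv_proj (W := U) (Q := pU)) //; last 2 first.
- move=> u uU; rewrite comp_lfunE (projv_id (subvP (addvSl U W) _ uU)).
  exact: daddv_pi_id.
- by move=> v; rewrite comp_lfunE memv_pi.
rewrite -(trv_proj (W := W) (Q := pW)) //; last 2 first.
- move=> u uU; rewrite comp_lfunE (projv_id (subvP (addvSr U W) _ uU)).
  by apply: daddv_pi_id; rewrite 1?capvC.
- by move=> v; rewrite comp_lfunE memv_pi.
rewrite -lftrD -comp_lfunDr; congr lftr; congr (A \o _)%VF.
apply/lfunP => v; rewrite add_lfunE !comp_lfunE daddv_pi_add //.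
exact: memv_proj.
Qed.

(** The projection onto the image can be inserted in front of [A], and then
    moved behind it inside the trace. *)
Lemma trv_img W A : {in W, forall v, A v \in W} -> trv W A = trv (A @: W)%VS A.
Proof.
move=> AW; have sub : (A @: W <= W)%VS by apply/subvP => _ /memv_imgP[v /AW ? ->].
have -> : trv W A = lftr (projv (A @: W) \o (A \o projv W))%VF.
  by congr lftr; apply/lfunP => v; rewrite !comp_lfunE (projv_id (memv_img A (memv_proj W v))).
rewrite lftr_comp; congr lftr; apply/lfunP => v; rewrite !comp_lfunE.
by rewrite (projv_id (subvP sub _ (memv_proj (A @: W) v))).
Qed.

Lemma iter_lfunD A k u v : iter k A (u + v) = iter k A u + iter k A v.
Proof. by elim: k => //= k ->; rewrite linearD. Qed.

Lemma iter_lfunZ A k a v : iter k A (a *: v) = a *: iter k A v.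
Proof. by elim: k => //= k ->; rewrite linearZ. Qed.

Lemma iter_lfun0 A k : iter k A 0 = 0.
Proof. by elim: k => //= k ->; rewrite linear0. Qed.

(** Nilpotency is recorded vector by vector, without a uniform exponent, so
    that generalized eigenspaces need no bound on multiplicities. *)
Definition nil_at A v := exists k, iter k A v = 0.

Lemma iter_nil_le A k m v : (k <= m)%N -> iter k A v = 0 -> iter m A v = 0.
Proof. by move=> /subnK <- e; rewrite iterD e iter_lfun0. Qed.

Lemma nil_at_lin A a u v : nil_at A u -> nil_at A v -> nil_at A (a *: u + v).
Proof.
move=> [k ku] [m mv]; exists (maxn k m).
by rewrite iter_lfunD iter_lfunZ (iter_nil_le (leq_maxl _ _) ku)
  (iter_nil_le (leq_maxr _ _) mv) scaler0 addr0.
Qed.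

Lemma nil_at0 A : nil_at A 0. Proof. by exists 0%N. Qed.

Lemma iter_commute A B k v : (forall u, A (B u) = B (A u)) ->
  iter k A (B v) = B (iter k A v).
Proof. by move=> c; elim: k => //= k ->. Qed.

Lemma nil_at_preimg A v : nil_at A (A v) -> nil_at A v.
Proof. by move=> [k kv]; exists k.+1; rewrite iterSr. Qed.

Lemma nil_at_uniform A W : {in W, forall v, nil_at A v} ->
  exists k, {in W, forall v, iter k A v = 0}.
Proof.
move=> nilW; have : exists k, {in (vbasis W : seq V), forall v, iter k A v = 0}.
  have : {subset (vbasis W : seq V) <= W} by move=> v; exact: vbasis_mem.
  elim: (vbasis W : seq V) => [|x s IH] sub; first by exists 0%N => v; rewrite in_nil.
  have [|k ks] := IH; first by move=> v vs; apply: sub; rewrite inE vs orbT.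
  have [m mx] := nilW x (sub x (mem_head _ _)).
  exists (maxn k m) => v; rewrite inE => /predU1P[->|/ks kv].
    exact: iter_nil_le (leq_maxr _ _) mx.
  exact: iter_nil_le (leq_maxl _ _) kv.
move=> [k kW]; exists k => v /coord_vbasis ->.
elim/big_rec: _ => [|i x _ IH]; first exact: iter_lfun0.
by rewrite iter_lfunD iter_lfunZ IH kW ?scaler0 ?addr0 // mem_nth // size_tuple.
Qed.

Lemma trv_nil W A : {in W, forall v, A v \in W} -> {in W, forall v, nil_at A v} ->
  trv W A = 0.
Proof.
move=> AW /nil_at_uniform[k]; elim: k W AW => [|k IH] W AW kW; last first.
  rewrite trv_img //; apply: IH => [_ /memv_imgP[v vW ->]|_ /memv_imgP[v vW ->]].
    by rewrite memv_img ?AW.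
  by rewrite -iterSr kW.
rewrite /trv (_ : (_ \o _)%VF = 0) ?lftr0 //; apply/lfunP => v.
by rewrite comp_lfunE zero_lfunE [projv _ v](kW _ (memv_proj _ _)) linear0.
Qed.

Definition shift A a : 'End(V) := A - a *: \1%VF.

Lemma shiftE A a v : shift A a v = A v - a *: v.
Proof. by rewrite add_lfunE opp_lfunE scale_lfunE id_lfunE. Qed.

Lemma trv_eigen W A a : {in W, forall v, A v \in W} ->
  {in W, forall v, nil_at (shift A a) v} -> trv W A = a * (\dim W)%:R.
Proof.
move=> AW nilW; have -> : A = shift A a + a *: \1%VF by rewrite subrK.
rewrite trvD trvZ trv1 trv_nil ?add0r // => v vW.
by rewrite shiftE memvB ?memvZ ?AW.
Qed.

Lemma shift_commute A B a b u : (forall u, A (B u) = B (A u)) ->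
  shift A a (shift B b u) = shift B b (shift A a u).
Proof.
move=> c; rewrite !shiftE (linearB A) (linearB B) (linearZ_LR A) (linearZ_LR B) /= c.
rewrite !scalerBr !opprB !scalerA [b * a]mulrC !addrA.
by rewrite addrAC [RHS]addrAC; congr (_ + _); rewrite addrAC.
Qed.

(** On generalized eigenvectors for [b], the operator [A - a] is [b - a] plus a
    nilpotent operator, hence invertible when [a != b]. Injectivity modulo a
    stable subspace comes first, surjectivity next. *)
Lemma nil_shift_mem W A a b v : {in W, forall v, A v \in W} -> a != b ->
  nil_at (shift A b) v -> shift A a v \in W -> v \in W.
Proof.
move=> AW ab [k]; elim: k v => [|k IH] v /=; first by move=> -> _; rewrite mem0v.
rewrite -iterS iterSr => kv avW; have bvW : shift A b v \in W.
  by apply: IH => //; rewrite shift_commute // shiftE memvB ?memvZ ?AW.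
have -> : v = (b - a)^-1 *: (shift A a v - shift A b v); last by rewrite memvZ ?memvB.
by rewrite !shiftE opprB [X in _ *: X]addrC subrKA -scalerBl scalerA mulVf ?scale1r // subr_eq0 eq_sym.
Qed.

Lemma nil_shift_preimg W A a b v : {in W, forall v, A v \in W} -> a != b ->
  v \in W -> nil_at (shift A b) v ->
  exists w, [/\ w \in W, nil_at (shift A b) w & shift A a w = v].
Proof.
move=> AW ab vW [k]; elim: k v vW => [|k IH] v vW /=.
  by move=> v0; exists 0; rewrite mem0v linear0 v0; split=> //; exact: nil_at0.
rewrite -iterS iterSr => kv; have [|w [wW nw ew]] := IH (shift A b v) _ kv.
  by rewrite shiftE memvB ?memvZ ?AW.
exists ((b - a)^-1 *: (v - w)); split.
- by rewrite memvZ ?memvB.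
- rewrite -[_ *: _]addr0; apply: nil_at_lin (nil_at0 _).
  rewrite addrC -scaleN1r; apply: nil_at_lin => //.
  by exists k.+1; rewrite iterSr.
- rewrite linearZ linearB /= ew !shiftE opprB [X in _ *: X]addrC subrKA -scalerBl scalerA.
  by rewrite mulVf ?scale1r // subr_eq0 eq_sym.
Qed.

End RestrictedTrace.

Section GeneralizedEigenvectors.
Context {F : numClosedFieldType} {V : vectType F}.
Implicit Types (W : {vspace V}) (A : 'End(V)).

Lemma stable_eigenvector W A : {in W, forall v, A v \in W} -> W != 0%VS ->
  exists a v, [/\ v \in W, v != 0 & A v = a *: v].
Proof.
move=> AW W0; pose e := vbasis {:subvs_of W}.
pose B : 'End(subvs_of W) := (linfun (vsproj W) \o A \o linfun vsval)%VF.
have d0 : (0 < \dim {:subvs_of W})%N by rewrite dimvf lt0n dimv_eq0.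
have [a /eigenvalueP[r er r0]] := spectral.eigenvalue_closed (passmx.mxof e e B) d0.
exists a, (vsval (passmx.vecof e r)); split; first exact: subvsP.
  rewrite -[0]/(vsval (0 : subvs_of W)) (inj_eq (@subvs_inj _ _ _)).
  by rewrite passmx.vecof_eq0 // vbasisP.
have := congr1 vsval (passmx.hom_vecof e (vbasisP _) B r).
rewrite er (_ : passmx.vecof e (a *: r) = a *: passmx.vecof e r); last first.
  by rewrite /passmx.vecof scaler_sumr; apply: eq_bigr => i _; rewrite mxE scalerA.
by rewrite !comp_lfunE !lfunE /= vsprojK ?AW ?subvsP.
Qed.

Inductive gen_sum W A : V -> Prop :=
| gen_sum0 : gen_sum W A 0
| gen_sumD a u v : u \in W -> nil_at (shift A a) u -> gen_sum W A v -> gen_sum W A (u + v).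

(** Summands for eigenvalues other than [a] lift along [A - a]; those for [a]
    are collected in [u0]. *)
Lemma gen_sum_preimg W A a u : {in W, forall v, A v \in W} -> gen_sum W A u ->
  exists u0 w, [/\ u0 \in W, nil_at (shift A a) u0, w \in W, gen_sum W A w &
     u = u0 + shift A a w].
Proof.
move=> AW; elim=> [|b {}u v uW nu _ [u0 [w [u0W nu0 wW gw ->]]]].
  by exists 0, 0; rewrite linear0 addr0 mem0v; split=> //; [exact: nil_at0|exact: gen_sum0].
have [ab|ab] := eqVneq a b.
  exists (u + u0), w; split; rewrite ?memvD ?addrA //.
  by rewrite -[u]scale1r; apply: nil_at_lin; rewrite ?ab // -ab.
have [w' [w'W nw' ew']] := nil_shift_preimg AW ab uW nu.
exists u0, (w' + w); split; rewrite ?memvD //; first exact: gen_sumD nw' gw.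
by rewrite linearD /= ew' addrCA.
Qed.

(** Over a closed field, a space stable by [A] is spanned by the generalized
    eigenvectors of [A] that it contains: an eigenvalue [a] makes [A - a] shrink
    the space, and generalized eigenvectors lift along [A - a]. *)
Lemma stable_gen_sum W A : {in W, forall v, A v \in W} ->
  {in W, forall v, gen_sum W A v}.
Proof.
have [n] := ubnP (\dim W); elim: n W => // n IH W; rewrite ltnS => dW AW v vW.
have [W0|W0] := eqVneq W 0%VS.
  by move: vW; rewrite W0 memv0 => /eqP->; exact: gen_sum0.
have [a [x [xW x0 Ax]]] := stable_eigenvector AW W0.
set X := (shift A a @: W)%VS.
have aW : {in W, forall v, shift A a v \in W}.
  by move=> u uW; rewrite shiftE memvB ?memvZ ?AW.
have XW : (X <= W)%VS by apply/subvP => _ /memv_imgP[u uW ->]; exact: aW.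
have AX : {in X, forall v, A v \in X}.
  move=> _ /memv_imgP[u uW ->].
  have -> : A (shift A a u) = shift A a (A u) by rewrite !shiftE linearB linearZ.
  by rewrite memv_img ?AW.
have dX : (\dim X < n)%N.
  apply: leq_trans dW; rewrite -(limg_ker_dim (shift A a) W) -/X -[ltnLHS]add0n ltn_add2r.
  rewrite lt0n dimv_eq0; apply: contraNneq x0 => k0; rewrite -memv0 -k0.
  by rewrite memv_cap xW memv_ker shiftE Ax subrr eqxx.
have mono u : gen_sum X A u -> gen_sum W A u.
  elim=> [|b {}u w uX nu _ gw]; first exact: gen_sum0.
  exact: gen_sumD (subvP XW _ uX) nu gw.
have vX : shift A a v \in X by exact: memv_img.
have [u0 [w [u0W nu0 wW gw e]]] := gen_sum_preimg a AW (mono _ (IH X dX AX _ vX)).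
rewrite -(subrK w v); apply: gen_sumD gw; first by rewrite memvB.
by apply: (@nil_at_preimg _ _ (shift A a)); rewrite linearB /= e addrK.
Qed.

End GeneralizedEigenvectors.

(** * Generalized weight spaces *)

Section LieBasics.
Context {F : fieldType} {g : lieAlgType F}.
Implicit Types (x y z : g) (U V W : {vspace g}).

Lemma lieDr x y z : lie x (y + z) = lie x y + lie x z.
Proof. exact: linearD. Qed.

Lemma lieZr a x y : lie x (a *: y) = a *: lie x y.
Proof. exact: linearZ. Qed.

Lemma lieDl x y z : lie (x + y) z = lie x z + lie y z.
Proof. by have := lie_linearl z 1 x y; rewrite !scale1r. Qed.

Lemma lie0l y : lie 0 y = 0.
Proof. by have := lieZl 0 0 y; rewrite !scale0r. Qed.

Lemma lie0r y : lie y 0 = 0. Proof. exact: linear0. Qed.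

Lemma lieNl x y : lie (- x) y = - lie x y.
Proof. by rewrite -scaleN1r lieZl scaleN1r. Qed.

Lemma lieNr x y : lie x (- y) = - lie x y. Proof. exact: linearN. Qed.

Lemma lieC x y : lie x y = - lie y x.
Proof.
apply/eqP; rewrite -addr_eq0; have := liexx (x + y).
by rewrite lieDl !lieDr !liexx add0r addr0 => ->.
Qed.

Lemma lie_derivation x y z : lie x (lie y z) = lie (lie x y) z + lie y (lie x z).
Proof.
have := lie_jacobi x y z; rewrite (lieC z x) lieNr (lieC z (lie x y)).
by move/eqP; rewrite subr_eq0 => /eqP <-; rewrite subrK.
Qed.

Lemma adE x y : ad x y = lie x y. Proof. exact: lfunE. Qed.

Lemma ad_lie x y : ad (lie x y) = ((ad x \o ad y) - (ad y \o ad x))%VF.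
Proof.
apply/lfunP => z; rewrite add_lfunE opp_lfunE !comp_lfunE !adE.
by rewrite (lie_derivation x) addrK.
Qed.

Lemma adD x y : ad (x + y) = ad x + ad y.
Proof. by apply/lfunP => z; rewrite add_lfunE !adE lieDl. Qed.

Lemma adZ a x : ad (a *: x) = a *: ad x.
Proof. by apply/lfunP => z; rewrite scale_lfunE !adE lieZl. Qed.

Lemma shift_ad_commute x y a b z : shift (ad x) a (shift (ad y) b z) =
  shift (ad y) b (shift (ad x) a z) - lie (lie y x) z.
Proof.
rewrite !shiftE !adE !lieDr !lieNr !lieZr (lie_derivation x y) (lieC x y) lieNl.
rewrite !scalerBr !opprB !scalerA [b * a]mulrC [- _ + _]addrC !addrA.
by rewrite [LHS](ACl (1*5*4*3*2)).
Qed.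

Lemma lie_vs_subP U V W :
  (forall u v, u \in U -> v \in V -> lie u v \in W) -> (lie_vs U V <= W)%VS.
Proof.
move=> UVW; apply/span_subvP => _ /allpairsP[[u v] /= [uU vV ->]].
by apply: UVW; exact: vbasis_mem.
Qed.

Lemma lie_vsS U U' V V' : (U <= U')%VS -> (V <= V')%VS -> (lie_vs U V <= lie_vs U' V')%VS.
Proof.
by move=> /subvP UU /subvP VV; apply: lie_vs_subP => u v uU vV; rewrite memv_lie ?UU ?VV.
Qed.

Lemma lie_subalgP U :
  reflect (forall u v, u \in U -> v \in U -> lie u v \in U) (lie_subalg U).
Proof.
apply: (iffP idP) => [/subvP UU u v uU vU|UU]; last exact: lie_vs_subP.
by apply: UU; exact: memv_lie.
Qed.

(** The Leibniz rule makes generalized eigenvectors of a derivation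
    multiplicative. *)
Lemma nil_shift_lie h a b x y :
  nil_at (shift (ad h) a) x -> nil_at (shift (ad h) b) y ->
  nil_at (shift (ad h) (a + b)) (lie x y).
Proof.
move=> [k kx] [m my]; exists (k + m)%N; move: kx my.
have [n] := ubnP (k + m)%N; elim: n k m x y => // n IH k m x y.
case: k => [|k] in IH *; first by move=> _ x0 _; rewrite (x0 : x = 0) lie0l iter_lfun0.
case: m => [|m] in IH *; first by move=> _ _ y0; rewrite (y0 : y = 0) lie0r iter_lfun0.
rewrite ltnS addSn => lt kx my; rewrite iterSr.
have -> : shift (ad h) (a + b) (lie x y) =
    lie (shift (ad h) a x) y + lie x (shift (ad h) b y).
  rewrite !shiftE !adE lie_derivation lieDl lieNl lieDr lieNr lieZl lieZr.
  by rewrite scalerDl opprD addrACA.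
rewrite iter_lfunD (IH k m.+1) -?iterSr // add0r.
by rewrite addnS -addSn (IH k.+1 m) -?iterSr // addSnnS.
Qed.

End LieBasics.

Section Weights.
Context {F : numClosedFieldType} {g : lieAlgType F}.
Context {t : {vspace g}}.
Local Notation tdual := 'Hom(subvs_of t, F^o).
Implicit Types (l m : tdual) (f : subvs_of t -> F) (V W : {vspace g}) (h : subvs_of t).

Lemma gen_weight_ex f : exists W, forall v,
  v \in W <-> forall h, nil_at (shift (ad (vsval h)) (f h)) v.
Proof.
apply: vspace_of_pred => [h|a u v nu nv h]; first exact: nil_at0.
exact: nil_at_lin.
Qed.

(** Generalized weights are needed until the Killing form is known to be
    nondegenerate, because only then does [t] turn out to act diagonalizably.
    *)
Definition gen_weight f : {vspace g} := sval (cid (gen_weight_ex f)).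

Lemma gen_weightP f v :
  v \in gen_weight f <-> forall h, nil_at (shift (ad (vsval h)) (f h)) v.
Proof. by rewrite /gen_weight; case: cid => W /= /(_ v). Qed.

Definition stable W := forall h v, v \in W -> lie (vsval h) v \in W.

Lemma stable_shift W h a v : stable W -> v \in W -> shift (ad (vsval h)) a v \in W.
Proof. by move=> sW vW; rewrite shiftE adE memvB ?memvZ ?sW. Qed.

Lemma stable_iter W h a v k :
  stable W -> v \in W -> iter k (shift (ad (vsval h)) a) v \in W.
Proof. by move=> sW vW; elim: k => //= k; exact: stable_shift. Qed.

Lemma stable_gen_sum_weight W : stable W -> forall h, {in W, forall v, ad (vsval h) v \in W}.
Proof. by move=> sW h v vW; rewrite adE sW. Qed.

Context (t_subalg : lie_subalg t) (t_nil : lie_nilpotent t).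

Lemma cartan_ad_nil h x : x \in t -> nil_at (ad (vsval h)) x.
Proof.
move=> xt; have [n n0] := t_nil; exists n; apply/eqP; rewrite -memv0 -n0.
elim: n {n0} => [|n IH] //=; rewrite adE; exact: memv_lie (subvsP h) IH.
Qed.

Lemma nil_shift_stable h a v x : x \in t ->
  nil_at (shift (ad (vsval h)) a) v -> nil_at (shift (ad (vsval h)) a) (lie x v).
Proof.
move=> xt nv; rewrite -[a]add0r; apply: nil_shift_lie nv.
by rewrite /shift scale0r subr0; exact: cartan_ad_nil.
Qed.

Lemma stable_gen_weight f : stable (gen_weight f).
Proof.
move=> h v /gen_weightP vl; apply/gen_weightP => h'.
exact: nil_shift_stable (subvsP h) (vl h').
Qed.

(** A power of [ad h - l0 h] kills one component and acts invertibly on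
    another, which allows an induction on the number of weights. With [W = 0]
    this is the independence of the generalized weight spaces; in general it
    says that [W] is graded. *)
Lemma gen_weight_component W (s : seq tdual) (v : tdual -> g) :
  stable W -> uniq s -> (forall l, l \in s -> v l \in gen_weight l) ->
  \sum_(l <- s) v l \in W -> forall l, l \in s -> v l \in W.
Proof.
move=> sW; elim: s v => // l0 s IH v /= /andP[l0s us] vs vW.
have key l : l \in s -> v l \in W.
  move=> ls; have /eqP ne : l != l0 by apply: contraNneq l0s => <-.
  have [h lh] : exists h, l h != l0 h.
    apply: contrapT => nex; apply: ne; apply/lfunP => h; apply: contrapT => /eqP lh.
    by apply: nex; exists h.
  have vl : l \in l0 :: s by rewrite inE ls orbT.
  pose D := shift (ad (vsval h)) (l0 h).
  have [k kv] : nil_at D (v l0) by move/gen_weightP: (vs l0 (mem_head _ _)); exact.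
  have kW : iter k D (v l) \in W.
    apply: (IH (fun m => iter k D (v m))) ls => // [m ms|].
      rewrite /D; apply: stable_iter; first exact: stable_gen_weight.
      by apply: vs; rewrite inE ms orbT.
    have := stable_iter h (l0 h) k sW vW; rewrite big_cons iter_lfunD kv add0r.
    congr (_ \in W); elim: (s) => [|m s' IHs]; first by rewrite !big_nil iter_lfun0.
    by rewrite !big_cons iter_lfunD IHs.
  move: kW; have : v l \in gen_weight l by exact: vs.
  elim: k {kv} (v l) => //= k IHk u ul; rewrite -iterS iterSr => /IHk.
  move=> /(_ (stable_shift _ _ (@stable_gen_weight _) ul)) uW.
  apply: (nil_shift_mem (stable_gen_sum_weight sW h) _ _ uW); first by rewrite eq_sym; exact: lh.
  by move/gen_weightP: ul; exact.
move=> l; rewrite inE => /predU1P[->|/key//].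
have sum_s : \sum_(j <- s) v j \in W by rewrite big_seq memv_suml // => j; exact: key.
by rewrite -(addrK (\sum_(j <- s) v j) (v l0)) memvB //; rewrite big_cons in vW.
Qed.

Lemma gen_weightD l m x y : x \in gen_weight l -> y \in gen_weight m ->
  lie x y \in gen_weight (l + m).
Proof.
move=> /gen_weightP xl /gen_weightP ym; apply/gen_weightP => h.
by rewrite add_lfunE; exact: nil_shift_lie.
Qed.

(** On a nonzero [t]-stable space where each [h] in [t] has a single eigenvalue,
    that eigenvalue is [trv W (ad h) / \dim W], hence linear in [h]. *)
Lemma primary_weight W : stable W ->
  (forall h, exists a, {in W, forall v, nil_at (shift (ad (vsval h)) a) v}) ->
  exists l : tdual, (W <= gen_weight l)%VS.
Proof.
move=> sW prim; have [->|W0] := eqVneq W 0%VS; first by exists 0; exact: sub0v.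
pose c h : F^o := trv W (ad (vsval h)) / (\dim W)%:R.
have flin : linear c.
  move=> a h h'; rewrite /c (_ : vsval (_ + _) = a *: vsval h + vsval h') //.
  by rewrite adD adZ trvD trvZ mulrDl -mulrA.
pose L : {linear subvs_of t -> F^o} := HB.pack c (GRing.isLinear.Build _ _ _ _ c flin).
exists (linfun L); apply/subvP => v vW; apply/gen_weightP => h.
have [a aW] := prim h; rewrite lfunE /= /c (trv_eigen _ aW) ?mulfK.
- exact: aW.
- by rewrite pnatr_eq0 dimv_eq0.
- exact: stable_gen_sum_weight.
Qed.

(** If some [h] has two eigenvalues on [W], its generalized eigenspaces in [W]
    are smaller, and stable because [t] is nilpotent; otherwise
    [primary_weight] applies. *)
Lemma weight_decomposition W : stable W ->
  exists s : seq tdual, (W <= \sum_(l <- s) gen_weight l)%VS.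
Proof.
have [n] := ubnP (\dim W); elim: n W => // n IH W; rewrite ltnS => dW sW.
have [prim|] := EM (forall h, exists a,
    {in W, forall v, nil_at (shift (ad (vsval h)) a) v}).
  by have [l Wl] := primary_weight sW prim; exists [:: l]; rewrite big_seq1.
move/existsNP => [h /forallNP nprim].
pose P (s : seq tdual) v := v \in (\sum_(l <- s) gen_weight l)%VS.
have cat s s' v : P s v -> P (s ++ s') v /\ P (s' ++ s) v.
  rewrite /P !big_cat /= => vs; rewrite -[v]addr0; split; last rewrite addrC.
    by apply: memv_add; rewrite ?mem0v.
  by apply: memv_add; rewrite ?mem0v.
suff ex : forall v, v \in W -> exists s, P s v.
  have {}ex : exists s, {in (vbasis W : seq g), forall v, P s v}.
    have : {subset (vbasis W : seq g) <= W} by move=> v; exact: vbasis_mem.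
    elim: (vbasis W : seq g) => [|x r IHr] sub; first by exists [::] => v; rewrite in_nil.
    have [|s rs] := IHr; first by move=> v vr; apply: sub; rewrite inE vr orbT.
    have [s' xs'] := ex x (sub x (mem_head _ _)).
    exists (s ++ s') => v; rewrite inE => /predU1P[->|/rs vs]; first by case: (cat s' s x).
    by case: (cat s s' v).
  have [s Ws] := ex; exists s; rewrite -(span_basis (vbasisP W)).
  exact/span_subvP.
move=> v /(stable_gen_sum (stable_gen_sum_weight sW h)).
elim=> [|a {}v w vW nv _ [s' ws']]; first by exists [::]; exact: mem0v.
have [W' W'P] : exists W', forall v, v \in W' <->
    v \in W /\ nil_at (shift (ad (vsval h)) a) v.
  apply: vspace_of_pred => [|b x y [xW nx] [yW ny]]; first by split; [exact: mem0v|exact: nil_at0].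
  by split; [rewrite memvD ?memvZ|exact: nil_at_lin].
have [||s W's] := IH W'.
- apply: leq_trans dW; rewrite ltnNge; apply/negP => le; apply: (nprim a) => x xW.
  have sub : (W' <= W)%VS by apply/subvP => y /W'P[].
  have /eqP e : W' == W by rewrite eqEdim sub.
  by move: xW; rewrite -e => /W'P[].
- move=> h' x /W'P[xW nx]; apply/W'P; split; first exact: sW.
  exact: nil_shift_stable (subvsP h') nx.
exists (s ++ s'); rewrite /P big_cat /=; apply: memv_add => //.
by apply: (subvP W's); apply/W'P.
Qed.

End Weights.

Arguments stable_gen_weight {F g t} t_nil f.
Arguments stable {F g} t W.

(** * Engel's theorem *)

Section Engel.
Context {F : numClosedFieldType} {g : lieAlgType F}.
Context {t : {vspace g}}.
Local Notation tdual := 'Hom(subvs_of t, F^o).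
Implicit Types (l m : tdual) (V W : {vspace g}) (h : subvs_of t).
Context (t_subalg : lie_subalg t) (t_nil : lie_nilpotent t).

Lemma trv_gen_weight l h :
  trv (gen_weight l) (ad (vsval h)) = l h * (\dim (gen_weight l))%:R.
Proof.
apply: trv_eigen => v; last by move=> /gen_weightP.
exact: stable_gen_sum_weight (stable_gen_weight t_nil l) h v.
Qed.

(** Up to the dimension of the weight space, [l k] is the trace of a
    commutator. *)
Lemma weight_lie l h h1 (k : subvs_of t) : gen_weight l != 0%VS ->
  vsval k = lie (vsval h) (vsval h1) -> l k = 0.
Proof.
move=> l0 ek; have := trv_gen_weight l k; rewrite ek ad_lie trv_commutator.
- move/esym/eqP; rewrite mulf_eq0 pnatr_eq0 dimv_eq0 (negPf l0) orbF => /eqP->.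
  by [].
- exact: stable_gen_sum_weight (stable_gen_weight t_nil l) h.
- exact: stable_gen_sum_weight (stable_gen_weight t_nil l) h1.
Qed.

(** The last term of the descending central series of [t] that is not contained
    in [s] provides [x]. *)
Lemma stable_ideal_step (s : {vspace g}) : ~~ (t <= s)%VS ->
  exists x, [/\ x \in t, x \notin s & forall h, lie (vsval h) x \in s].
Proof.
move=> ts; have ex : exists n, (iter n (lie_vs t) t <= s)%VS.
  by have [n n0] := t_nil; exists n; rewrite n0 sub0v.
case: (ex_minnP ex) => -[|n] nS min; first by rewrite nS in ts.
have : ~~ (iter n (lie_vs t) t <= s)%VS by apply/negP => /min; rewrite ltnn.
move=> /subvPn[x xn xs]; exists x; split=> // [|h].
  suff /subvP : (iter n (lie_vs t) t <= t)%VS by apply.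
  elim: n {nS min xn} => //= n IH; apply: lie_vs_subP => u v ut vn.
  by move/lie_subalgP: t_subalg; apply=> //; exact: (subvP IH).
by apply: (subvP nS); exact: memv_lie (subvsP h) xn.
Qed.

(** Engel's argument. Among the ideals of [t] whose shifted action sends some
    vector outside [W] into [W], one of maximal dimension must be [t]:
    otherwise one more element of [t], acting nilpotently on such vectors,
    could be added to it. *)
Lemma engel l W : stable t W -> ~~ (gen_weight l <= W)%VS ->
  exists v, [/\ v \in gen_weight l, v \notin W &
    forall h, shift (ad (vsval h)) (l h) v \in W].
Proof.
move=> sW lW; have l0 : gen_weight l != 0%VS by apply: contraNneq lW => ->; exact: sub0v.
pose fixes (s : {vspace g}) v := [/\ v \in gen_weight l, v \notin W &
  forall h, vsval h \in s -> shift (ad (vsval h)) (l h) v \in W].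
pose Q n := `[< exists s, [/\ \dim s = n, (s <= t)%VS,
  forall h x, x \in s -> lie (vsval h) x \in s & exists v, fixes s v] >].
have Q0 : exists n, Q n.
  exists 0%N; apply/asboolP; exists 0%VS; split; rewrite ?dimv0 ?sub0v //.
    by move=> h x; rewrite !memv0 => /eqP->; rewrite lie0r.
  have [v vl vW] := subvPn lW; exists v; split=> // h; rewrite memv0 => /eqP h0.
  suff -> : h = 0 by rewrite shiftE adE lie0l linear0 scale0r subr0 mem0v.
  exact: val_inj.
have Qb n : Q n -> (n <= \dim t)%N by move=> /asboolP[s [<- st _ _]]; exact: dimvS.
case: (ex_maxnP Q0 Qb) => n /asboolP[s [ds st si [v [vl vW vs]]]] maxn.
have [ts|ts] := boolP (t <= s)%VS.
  by exists v; split=> // h; apply: vs; exact: (subvP ts) (subvsP h).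
have [x [xt xs xi]] := stable_ideal_step ts.
pose hx : subvs_of t := Subvs xt; pose D := shift (ad x) (l hx).
have Dst u : u \in W -> D u \in W by move=> uW; exact: (stable_shift hx).
have nD : exists k, iter k D v \in W.
  have [k kv] : nil_at D v by move/gen_weightP: vl => /(_ hx).
  by exists k; rewrite kv mem0v.
case: (ex_minnP nD) => -[|k] kW min; first by rewrite kW in vW.
have fixes_k : fixes s (iter k D v).
  split=> [||h hs].
  - by apply: (stable_iter hx) => //; exact: stable_gen_weight.
  - by apply/negP => /min; rewrite ltnn.
  elim: k {kW min} (h) hs => [|k IH] {}h hs /=; first exact: vs.
  have xhs : lie x (vsval h) \in s by exact: (si hx).
  pose hk : subvs_of t := Subvs (subvP st _ xhs).
  set u := iter k D v; have IHu k' : vsval k' \in s -> shift (ad (vsval k')) (l k') u \in W.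
    by move=> k's; apply: IH.
  have -> : shift (ad (vsval h)) (l h) (D u) =
      D (shift (ad (vsval h)) (l h) u) - shift (ad (vsval hk)) (l hk) u.
    rewrite shift_ad_commute -[lie x _]/(vsval hk); congr (_ - _).
    by rewrite shiftE adE (@weight_lie l hx h hk) // scale0r subr0.
  by rewrite memvB // ?IHu ?Dst ?IHu.
suff /maxn : Q (\dim (<[x]> + s)%VS).
  rewrite -ds => le; have : s == (<[x]> + s)%VS by rewrite eqEdim addvSr.
  move=> /eqP e; case/negP: xs; rewrite e; exact: subvP (addvSl <[x]> s) x (memv_line x).
apply/asboolP; exists (<[x]> + s)%VS; split=> //.
- by rewrite subv_add st andbT -memvE.
- move=> h _ /memv_addP[_ /vlineP[a ->] [y ys ->]]; rewrite lieDr lieZr.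
  by apply: (subvP (addvSr <[x]> s)); rewrite memvD ?memvZ ?xi ?si.
exists (iter k D v); have [wl wW ws] := fixes_k; split=> // h.
move=> /memv_addP[_ /vlineP[a ->] [y ys ey]].
have -> : h = a *: hx + Subvs (subvP st _ ys) by apply: val_inj.
set hy := Subvs _.
have -> : shift (ad (vsval (a *: hx + hy))) (l (a *: hx + hy)) (iter k D v) =
  a *: D (iter k D v) + shift (ad (vsval hy)) (l hy) (iter k D v).
  rewrite (_ : l (_ + _) = a * l hx + l hy); last by rewrite linearD linearZ.
  by rewrite !shiftE !adE lieDl lieZl scalerDl scalerBr scalerA opprD addrACA.
by rewrite memvD ?memvZ ?ws.
Qed.

End Engel.

(** * The Killing form and root spaces *)

Section Killing.
Context {F : numClosedFieldType} {g : lieAlgType F}.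
Implicit Types (x y z : g).

Lemma killingE x y : killing x y = lftr (ad x \o ad y)%VF.
Proof. by []. Qed.

Lemma killingC x y : killing x y = killing y x.
Proof. by rewrite !killingE lftr_comp. Qed.

Lemma killingDl x y z : killing (x + y) z = killing x z + killing y z.
Proof. by rewrite !killingE adD comp_lfunDl lftrD. Qed.

Lemma killingZl a x z : killing (a *: x) z = a * killing x z.
Proof. by rewrite !killingE adZ -comp_lfunZl lftrZ. Qed.

Lemma killingDr x y z : killing x (y + z) = killing x y + killing x z.
Proof. by rewrite !(killingC x) killingDl. Qed.

Lemma killingZr a x z : killing x (a *: z) = a * killing x z.
Proof. by rewrite !(killingC x) killingZl. Qed.

Lemma killing0l y : killing 0 y = 0.
Proof. by have := killingZl 0 0 y; rewrite scale0r mul0r. Qed.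

Lemma killing0r y : killing y 0 = 0.
Proof. by rewrite killingC killing0l. Qed.

Lemma killingNl x y : killing (- x) y = - killing x y.
Proof. by rewrite -scaleN1r killingZl mulN1r. Qed.

Lemma killing_suml (I : Type) (r : seq I) (f : I -> g) y :
  killing (\sum_(i <- r) f i) y = \sum_(i <- r) killing (f i) y.
Proof.
by elim: r => [|i r IH]; rewrite ?big_nil ?killing0l // !big_cons killingDl IH.
Qed.

Lemma killing_lie x y z : killing (lie x y) z = killing x (lie y z).
Proof.
rewrite !killingE !ad_lie comp_lfunDl comp_lfunDr comp_lfunNl comp_lfunNr !lftrB.
by rewrite -!comp_lfunA; congr (_ - _); rewrite [LHS]lftr_comp -comp_lfunA.
Qed.

End Killing.

Section RootSpaces.
Context {F : numClosedFieldType} {g : lieAlgType F} (t : {vspace g}).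
Local Notation tdual := 'Hom(subvs_of t, F^o).
Implicit Types (l m : tdual) (h k : subvs_of t) (x y : g).

Lemma killing_lfunE h k : killing_lfun t h k = killing (vsval h) (vsval k).
Proof.
have lin h1 : linear (fun k1 => killing (vsval h1) (vsval k1) : F^o).
  by move=> a u v /=; rewrite killingDr killingZr.
rewrite /killing_lfun linfunE_linear ?(linfunE_linear (lin _)) // => a u v.
apply/lfunP => k1; rewrite add_lfunE scale_lfunE !(linfunE_linear (lin _)) /=.
by rewrite killingDl killingZl.
Qed.

Lemma root_spaceP l x :
  x \in root_space l <-> forall h, lie (vsval h) x = (l h : F) *: x.
Proof.
have lin y : linear (fun h => lie (vsval h) y - (l h : F) *: y).
  move=> a u v; rewrite /= lieDl lieZl linearP /= scalerDl -scalerA opprD addrACA.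
  by rewrite -scalerBr.
have lin2 : linear (fun y : g => linfun (fun h => lie (vsval h) y - (l h : F) *: y)).
  move=> a u v; apply/lfunP => h; rewrite add_lfunE scale_lfunE !(linfunE_linear (lin _)).
  by rewrite lieDr lieZr !scalerDr !scalerN !scalerA [l h * a]mulrC opprD addrACA.
rewrite memv_ker (linfunE_linear lin2); split=> [/eqP/lfunP e h|e].
  by have := e h; rewrite (linfunE_linear (lin x)) zero_lfunE => /eqP; rewrite subr_eq0 => /eqP.
by apply/eqP/lfunP => h; rewrite (linfunE_linear (lin x)) zero_lfunE e subrr.
Qed.

End RootSpaces.

Section SimpleLieAlgebra.
Context {F : numClosedFieldType} {g : lieAlgType F} {t : {vspace g}}.
Context (g_simple : lie_simple g) (t_cartan : cartan t).
Local Notation tdual := 'Hom(subvs_of t, F^o).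
Local Notation rootset := (@lie_root F g t).

Let t_subalg : lie_subalg t. Proof. by have [] := t_cartan. Qed.
Let t_nil : lie_nilpotent t. Proof. by have [] := t_cartan. Qed.

(** * The weight decomposition *)

Section CartanDecomposition.
Implicit Types (l m : tdual) (V W : {vspace g}) (h : subvs_of t).

(** If [t] were smaller, Engel's argument would give a vector outside [t] that
    normalizes [t]. *)
Lemma gen_weight0 : gen_weight (0%R : tdual) = t.
Proof.
have s0 h : shift (ad (vsval h)) ((0 : tdual) h) = ad (vsval h).
  by rewrite /shift zero_lfunE scale0r subr0.
have t0 : (t <= gen_weight (0%R : tdual))%VS.
  by apply/subvP => x xt; apply/gen_weightP => h; rewrite s0; exact: cartan_ad_nil.
apply/eqP; rewrite eqEsubv t0 andbT; apply: contraT => nt.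
have st : stable t t by move=> h v vt; move/lie_subalgP: t_subalg; apply=> //; exact: subvsP.
have [v [_ vt hv]] := engel t_subalg t_nil st nt.
have [_ _ norm] := t_cartan; case/negP: vt; apply: norm => u ut; rewrite lieC memvN.
by have := hv (Subvs ut); rewrite s0 adE.
Qed.

Lemma gen_weight_cap l (s : seq tdual) : uniq (l :: s) ->
  (gen_weight l :&: \sum_(m <- s) gen_weight m = 0)%VS.
Proof.
move=> /= /andP[ls us]; apply/eqP; rewrite -subv0; apply/subvP => v.
rewrite memv_cap => /andP[vl /(big_seq_memv us)[f [fs ev]]].
pose u m := if m == l then - v else f m.
have := @gen_weight_component _ _ _ t_nil 0%VS (l :: s) u.
rewrite /stable /= ls us => /(_ _ isT) H.
have := H _ _ _ l (mem_head _ _); rewrite /u eqxx memvN; apply.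
- by move=> h w; rewrite !memv0 => /eqP->; rewrite lie0r.
- by move=> m _; case: eqP => [->|_]; rewrite ?memvN.
rewrite big_cons eqxx memv0 addrC subr_eq0 ev; apply/eqP; apply: eq_big_seq => m ms.
by have [ml|//] := eqVneq m l; rewrite ml (negPf ls) in ms.
Qed.

Lemma weights_ex : exists s : seq tdual,
  [/\ uniq s, forall l, (l \in s) = (gen_weight l != 0%VS)
   & (\sum_(l <- s) gen_weight l = fullv)%VS].
Proof.
have [|s sP] := @weight_decomposition _ _ t t_nil fullv; first by move=> h v _; exact: memvf.
pose s' := [seq l : tdual <- undup s | gen_weight l != 0%VS].
have sum' : (\sum_(l <- s') gen_weight l = fullv)%VS.
  apply/eqP; rewrite eqEsubv subvf /=; apply: subv_trans sP _.
  rewrite big_seq; elim/big_rec: _ => [|l W ls IH]; first exact: sub0v.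
  rewrite subv_add IH andbT; have [->|l0] := eqVneq (gen_weight l) 0%VS; first exact: sub0v.
  have ls' : l \in s' by rewrite mem_filter l0 mem_undup.
  by rewrite (big_rem l ls') /= addvSl.
have us' : uniq s' by rewrite filter_uniq ?undup_uniq.
exists s'; split=> // l; apply/idP/idP => [|l0]; first by rewrite mem_filter => /andP[].
apply: contraT => ls'; have := @gen_weight_cap l s' _; rewrite /= ls' us' sum' capvf.
by move=> /(_ isT)/eqP; rewrite (negPf l0).
Qed.

Definition weights : seq tdual := sval (cid weights_ex).

Lemma weights_uniq : uniq weights.
Proof. by rewrite /weights; case: cid => s /= []. Qed.

Lemma mem_weights l : (l \in weights) = (gen_weight l != 0%VS).
Proof. by rewrite /weights; case: cid => s /= []. Qed.

Lemma gen_weight_sum : (\sum_(l <- weights) gen_weight l = fullv)%VS.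
Proof. by rewrite /weights; case: cid => s /= []. Qed.

Lemma gen_weight_decomp (v : g) : exists f : tdual -> g,
  (forall l, f l \in gen_weight l) /\ v = \sum_(l <- weights) f l.
Proof. by apply: big_seq_memv weights_uniq _; rewrite gen_weight_sum memvf. Qed.

Lemma notin_weights l v : l \notin weights -> v \in gen_weight l -> v = 0.
Proof. by rewrite mem_weights negbK => /eqP->; rewrite memv0 => /eqP. Qed.

Lemma trv_sum_gen_weight (s : seq tdual) (A : 'End(g)) : uniq s ->
  (forall l, {in gen_weight l, forall v, A v \in gen_weight l}) ->
  trv (\sum_(l <- s) gen_weight l)%VS A = \sum_(l <- s) trv (gen_weight l) A.
Proof.
move=> us Al; elim: s us => [|l s IH] us.
  by rewrite !big_nil trv_nil // => v; rewrite memv0 => /eqP->;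
    rewrite ?linear0 ?mem0v //; exact: nil_at0.
rewrite !big_cons trv_add ?IH //; first by case/andP: us.
  exact: gen_weight_cap.
move=> v; have {}us : uniq s by case/andP: us.
move=> /(big_seq_memv us)[f [fs ->]]; rewrite linear_sum big_seq.
rewrite memv_suml // => m ms; rewrite (big_rem m ms) /=.
by apply: (subvP (addvSl _ _)); exact: Al.
Qed.

Lemma sum_gen_weightS (s : seq tdual) l : l \in s ->
  (gen_weight l <= \sum_(m <- s) gen_weight m)%VS.
Proof. by move=> ls; rewrite (big_rem l ls) /= addvSl. Qed.

End CartanDecomposition.

(** * Traces along strings of weights *)

Section CartanCriterion.
Implicit Types (l m : tdual) (V W : {vspace g}) (h k : subvs_of t).

Lemma ad_gen_weight h l : {in gen_weight l, forall v, ad (vsval h) v \in gen_weight l}.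
Proof. exact: stable_gen_sum_weight (stable_gen_weight t_nil l) h. Qed.

Lemma ad_sum_gen_weight (s : seq tdual) l x : uniq s -> x \in gen_weight l ->
  (forall m v, m \in s -> v \in gen_weight m -> l + m \in s \/ lie x v = 0) ->
  {in (\sum_(m <- s) gen_weight m)%VS, forall v, ad x v \in (\sum_(m <- s) gen_weight m)%VS}.
Proof.
move=> us xl sl v /(big_seq_memv us)[f [fs ->]]; rewrite linear_sum big_seq.
rewrite memv_suml // => m ms; rewrite /= adE; have xm := gen_weightD xl (fs m).
have [lm|->] := sl m (f m) ms (fs m); last exact: mem0v.
exact: (subvP (sum_gen_weightS lm)).
Qed.

Lemma trv_ad_sum (s : seq tdual) h : uniq s ->
  trv (\sum_(m <- s) gen_weight m)%VS (ad (vsval h)) =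
  \sum_(m <- s) m h * (\dim (gen_weight m))%:R.
Proof.
move=> us; rewrite trv_sum_gen_weight //; last exact: ad_gen_weight.
by apply: eq_bigr => m _; rewrite trv_gen_weight.
Qed.

(** On a sum of weight spaces stable under [ad x] and [ad y], the trace of
    [ad (lie x y)] is that of a commutator. *)
Lemma trv_string (s : seq tdual) l x y k : uniq s ->
  (forall m v, m \in s -> v \in gen_weight m -> l + m \in s \/ lie x v = 0) ->
  (forall m v, m \in s -> v \in gen_weight m -> m - l \in s \/ lie y v = 0) ->
  x \in gen_weight l -> y \in gen_weight (- l) -> vsval k = lie x y ->
  \sum_(m <- s) m k * (\dim (gen_weight m))%:R = 0.
Proof.
move=> us sl sNl xl yl ek; rewrite -trv_ad_sum // ek ad_lie trv_commutator //.
  exact: ad_sum_gen_weight xl sl.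
by apply: ad_sum_gen_weight yl _ => // m; rewrite [- l + m]addrC; exact: sNl.
Qed.

Lemma lie_notin_weights l m x v : l + m \notin weights ->
  x \in gen_weight l -> v \in gen_weight m -> lie x v = 0.
Proof. by move=> lm xl vm; exact: notin_weights lm (gen_weightD xl vm). Qed.

(** The trace over all weights [m + n l] with [n] an integer vanishes, which
    expresses [m k] as a rational multiple of [l k]. *)
Lemma string_ratio l x y k : x \in gen_weight l -> y \in gen_weight (- l) ->
  vsval k = lie x y ->
  exists r : tdual -> F, forall m, m \in weights -> r m \is Num.real /\ m k = r m * l k.
Proof.
move=> xl yl ek; suff H m : m \in weights -> exists r, r \is Num.real /\ m k = r * l k.
  have {}H m : exists r, m \in weights -> r \is Num.real /\ m k = r * l k.
    by have [/H[r rP]|] := boolP (m \in weights); [exists r|exists 0].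
  by exists (fun m => sval (cid (H m))) => m; case: cid => r /=; exact.
move=> mw; pose N nu := xget (0 : int) [set n | nu = m + l *~ n].
pose s := [seq nu : tdual <- weights | `[< exists n : int, nu = m + l *~ n >]].
have us : uniq s by rewrite filter_uniq ?weights_uniq.
have sP nu : (nu \in s) = (nu \in weights) && `[< exists n : int, nu = m + l *~ n >].
  by rewrite mem_filter andbC.
have sN nu : nu \in s -> nu = m + l *~ N nu.
  rewrite sP => /andP[_ /asboolP[n en]]; rewrite {1}/N.
  by have := @xgetPex _ (0 : int) [set n | nu = m + l *~ n] (ex_intro _ n en).
have := trv_string us _ _ xl yl ek.
have -> : \sum_(nu <- s) nu k * (\dim (gen_weight nu))%:R =
    m k * (\sum_(nu <- s) \dim (gen_weight nu))%:R +
    l k * \sum_(nu <- s) (N nu)%:~R * (\dim (gen_weight nu))%:R.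
  rewrite natr_sum !mulr_sumr -big_split /=; apply: eq_big_seq => nu /sN {1}->.
  by rewrite add_lfunE mulrA -mulrDl; congr ((_ + _) * _); rewrite -scaler_int scale_lfunE mulrC.
set d := (\sum_(nu <- s) \dim _)%N; set c := \sum_(nu <- s) _.
have d0 : (d%:R : F) != 0.
  have ms : m \in s by rewrite sP mw; apply/asboolP; exists 0; rewrite mulr0z addr0.
  rewrite pnatr_eq0 /d (big_rem m ms) /= addn_eq0 negb_and dimv_eq0.
  by rewrite -mem_weights mw.
move=> H; exists (- c / d%:R); split.
  rewrite rpredM ?rpredN ?rpredV ?realn //; apply: rpred_sum => nu _.
  by rewrite rpredM ?realz ?realn.
apply: (mulIf d0); rewrite mulrAC divfK // mulNr mulrC [c * _]mulrC; apply/eqP.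
rewrite -addr_eq0 [d%:R * _]mulrC H // => nu v; rewrite !sP => /andP[_ /asboolP[n en]] vnu.
  have [lw|lw] := boolP (l + nu \in weights); last by right; exact: lie_notin_weights lw xl vnu.
  by left; apply/asboolP; exists (n + 1); rewrite en mulrzDr mulr1z addrCA [l + _]addrC.
have [lw|lw] := boolP (nu - l \in weights).
  by left; apply/asboolP; exists (n - 1); rewrite en mulrzBr mulr1z addrA.
by right; apply: (lie_notin_weights _ yl vnu); rewrite addrC.
Qed.

Lemma nil_at_comp (A B : 'End(g)) v : (forall u, A (B u) = B (A u)) ->
  nil_at A v -> nil_at (A \o B)%VF v.
Proof.
move=> c [n nv]; exists n; suff -> : iter n (A \o B)%VF v = iter n B (iter n A v).
  by rewrite nv iter_lfun0.
by elim: n {nv} => //= n ->; rewrite comp_lfunE c iter_commute.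
Qed.

Lemma trv_square l h :
  trv (gen_weight l) (ad (vsval h) \o ad (vsval h))%VF =
  l h ^+ 2 * (\dim (gen_weight l))%:R.
Proof.
set C := ad (vsval h); have CW : {in gen_weight l, forall v, C v \in gen_weight l}.
  exact: ad_gen_weight.
apply: trv_eigen => v vl; first by rewrite comp_lfunE !CW.
have -> : shift (C \o C)%VF (l h ^+ 2) = (shift C (l h) \o shift C (- l h))%VF.
  apply/lfunP => u; rewrite comp_lfunE !shiftE comp_lfunE (linearB C) (linearZ_LR C) /=.
  by rewrite !scaleNr !opprK scalerDr scalerA -expr2 opprD addrA addrK.
by apply: nil_at_comp => [u|]; [exact: shift_commute|move/gen_weightP: vl => /(_ h)].
Qed.

(** Polarization of [trv_square]: the two operators need not commute, but their
    commutator has trace zero. *)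
Lemma trv_ad_comp l h k :
  trv (gen_weight l) (ad (vsval h) \o ad (vsval k))%VF =
  l h * l k * (\dim (gen_weight l))%:R.
Proof.
have := trv_square l (h + k); rewrite (_ : vsval (h + k) = vsval h + vsval k) //.
rewrite adD !comp_lfunDl !comp_lfunDr !trvD !trv_square.
have := trv_commutator (@ad_gen_weight h l) (@ad_gen_weight k l).
rewrite -scaleN1r trvD trvZ mulN1r => /eqP; rewrite subr_eq0 => /eqP <-.
set T := trv _ _; set n := _%:R; rewrite linearD /= => e.
have two : (2%:R : F) != 0 by rewrite pnatr_eq0.
apply: (mulfI two); apply: (addrI (l h ^+ 2 * n + l k ^+ 2 * n)).
transitivity (l h ^+ 2 * n + T + (T + l k ^+ 2 * n)); first by ring.
by rewrite e; ring.
Qed.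

Lemma killing_torus h k : killing (vsval h) (vsval k) =
  \sum_(l <- weights) l h * l k * (\dim (gen_weight l))%:R.
Proof.
rewrite killingE; set A := (_ \o _)%VF.
have -> : lftr A = trv fullv A.
  by congr lftr; apply/lfunP => v; rewrite comp_lfunE projv_id ?memvf.
rewrite -gen_weight_sum trv_sum_gen_weight ?weights_uniq //.
  by apply: eq_bigr => l _; exact: trv_ad_comp.
by move=> l v vl; rewrite comp_lfunE !ad_gen_weight.
Qed.

(** By invariance, [ad h - l h] and [- (ad h + l h)] are adjoint. The first is
    nilpotent at [x], the second invertible on the weight space of [y] as soon
    as [(l + m) h != 0]. *)
Lemma killing_orth l m x y : l + m != 0 ->
  x \in gen_weight l -> y \in gen_weight m -> killing x y = 0.
Proof.
move=> lm xl; have [h lmh] : exists h, (l + m) h != 0.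
  apply: contrapT => nex; move/eqP: lm; apply; apply/lfunP => h.
  by apply: contrapT => /eqP; rewrite zero_lfunE => lmh; apply: nex; exists h.
have [n nx] : nil_at (shift (ad (vsval h)) (l h)) x by move/gen_weightP: xl => /(_ h).
elim: n x xl nx y => [|n IH] x xl nx y ym; first by rewrite (nx : x = 0) killing0l.
have ne : - l h != m h by rewrite eq_sym -addr_eq0 addrC -add_lfunE.
have yn : nil_at (shift (ad (vsval h)) (m h)) y by move/gen_weightP: ym => /(_ h).
have [w [wm _ <-]] := nil_shift_preimg (@ad_gen_weight h m) ne ym yn.
have -> : killing x (shift (ad (vsval h)) (- l h) w) =
    - killing (shift (ad (vsval h)) (l h) x) w.
  rewrite !shiftE !adE scaleNr opprK killingDr killingZr killingDl killingNl killingZl.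
  by rewrite (lieC _ x) killingNl killing_lie opprD !opprK.
rewrite IH ?oppr0 //; last by rewrite -iterSr.
by apply: stable_shift => //; exact: stable_gen_weight.
Qed.

Lemma weight_in_torus l x y : x \in gen_weight l -> y \in gen_weight (- l) ->
  exists k, vsval k = lie x y.
Proof.
move=> xl yl; have := gen_weightD xl yl; rewrite subrr gen_weight0 => xyt.
by exists (Subvs xyt).
Qed.

End CartanCriterion.

(** * Cartan's criterion *)

Section Semisimple.
Implicit Types (l m : tdual) (V W : {vspace g}) (h k : subvs_of t) (x y : g).

Lemma simple_perfect : lie_vs (fullv : {vspace g}) fullv = fullv.
Proof.
have [n0 ideals] := g_simple; have [|//|//] := ideals (lie_vs fullv fullv).
by rewrite /lie_ideal lie_vsS ?subvf.
Qed.

(** Cartan's criterion: if the Killing form vanishes, each bracket [k] of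
    opposite weight vectors has [killing k k], a positive multiple of [l k ^+ 2],
    equal to zero, so all weights vanish on [k] by [string_ratio]. Such brackets
    span [t] because the algebra is perfect; hence all weights vanish and [t] is
    the whole algebra, which is perfect and would be nilpotent. *)
Lemma killing_neq0 : exists x y : g, killing x y != 0.
Proof.
apply: contrapT => K0; have {}K0 (x y : g) : killing x y = 0.
  by apply: contrapT => /eqP xy; apply: K0; exists x, y.
have w0 l x y k m : x \in gen_weight l -> y \in gen_weight (- l) ->
    vsval k = lie x y -> m \in weights -> m k = 0.
  move=> xl yl ek mw; have [lw|lw] := boolP (l \in weights); last first.
    have -> : k = 0 by apply: val_inj; rewrite /= ek (notin_weights lw xl) lie0l.
    by rewrite linear0.
  have [r rP] := string_ratio xl yl ek.
  suff lk : l k = 0 by have [_ ->] := rP m mw; rewrite lk mulr0.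
  have := killing_torus k k; rewrite K0 => /esym.
  have -> : \sum_(l <- weights) l k * l k * (\dim (gen_weight l))%:R =
      (\sum_(l <- weights) r l ^+ 2 * (\dim (gen_weight l))%:R) * l k ^+ 2.
    rewrite mulr_suml; apply: eq_big_seq => nu /rP[_ ->]; ring.
  move/eqP; rewrite mulf_eq0 expf_eq0 /= => /orP[|/eqP//].
  have pos nu : nu \in weights -> 0 <= r nu ^+ 2 * (\dim (gen_weight nu))%:R.
    by move=> /rP[re _]; rewrite mulr_ge0 ?ler0n // real_exprn_even_ge0.
  rewrite big_seq psumr_eq0 // => /allP/(_ l lw); rewrite lw /= mulf_eq0 expf_eq0 /=.
  rewrite pnatr_eq0 dimv_eq0 -[_ == 0%VS]negbK -mem_weights lw orbF => /eqP rl.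
  by have [_ ->] := rP l lw; rewrite rl mul0r.
(* [M] contains the component in [t] of every bracket. *)
have [M MP] : exists M : {vspace g}, forall v, v \in M <-> v \in t /\
    forall m k, m \in weights -> vsval k = v -> m k = 0.
  apply: vspace_of_pred; first (split=> [|m k _ k0]; first exact: mem0v).
    by have -> : k = 0 by [apply: val_inj]; rewrite linear0.
  move=> a u v [ut u0] [vt v0]; split=> [|m k mw ek]; first by rewrite memvD ?memvZ.
  have -> : k = a *: Subvs ut + Subvs vt by apply: val_inj.
  by rewrite linearP /= (u0 m (Subvs ut)) ?(v0 m (Subvs vt)) // scaler0 addr0.
pose s := [seq l : tdual <- weights | l != 0].
have us : uniq (0 :: s) by rewrite /= mem_filter eqxx filter_uniq ?weights_uniq.
set X := (M + \sum_(l <- s) gen_weight l)%VS.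
have Xfull : X = fullv.
  apply/eqP; rewrite eqEsubv subvf /= -simple_perfect; apply: lie_vs_subP => u v _ _.
  have [f [fl ->]] := gen_weight_decomp u.
  have [f' [fl' ->]] := gen_weight_decomp v.
  rewrite lie_suml memv_suml // => l _; rewrite linear_sum memv_suml // => m _ /=.
  have lm := gen_weightD (fl l) (fl' m).
  have [lm0|lm0] := eqVneq (l + m) 0.
    have em : m = - l by apply/eqP; rewrite -addr_eq0 addrC lm0.
    have xm : f' m \in gen_weight (- l) by rewrite -em.
    apply: (subvP (addvSl _ _)); apply/MP.
    have [k ek] := weight_in_torus (fl l) xm.
    split=> [|m' k' mw' ek']; first by rewrite -ek subvsP.
    exact: w0 (fl l) xm ek' mw'.
  have [lw|lw] := boolP (l + m \in weights); last by rewrite (notin_weights lw lm) mem0v.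
  apply: (subvP (addvSr _ _)); apply: (subvP (sum_gen_weightS (l := l + m) _)) lm.
  by rewrite mem_filter lm0.
have tM : (t <= M)%VS.
  apply/subvP => h ht; have : h \in X by rewrite Xfull memvf.
  move=> /memv_addP[u uM [v vs eh]].
  have vt : v \in t.
    have -> : v = h - u by rewrite eh addrC addKr.
    by rewrite memvB //; move/MP: uM => [].
  have : v \in (gen_weight (0%R : tdual) :&: \sum_(l <- s) gen_weight l)%VS.
    by rewrite memv_cap vs gen_weight0 vt.
  by rewrite (gen_weight_cap us) memv0 eh => /eqP->; rewrite addr0.
have wts0 m : m \in weights -> m = 0.
  move=> mw; apply/lfunP => h; rewrite zero_lfunE.
  by have /MP[_ /(_ m h mw erefl)] := subvP tM _ (subvsP h).
have tfull : t = fullv.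
  apply/eqP; rewrite eqEsubv subvf /= -gen_weight_sum big_seq.
  elim/big_rec: _ => [|l V /wts0-> IH]; first exact: sub0v.
  by rewrite subv_add IH gen_weight0 subvv.
have [n] := t_nil; have [g0 _] := g_simple; rewrite tfull.
have -> : iter n (lie_vs (fullv : {vspace g})) fullv = fullv.
  by elim: n => //= n ->; exact: simple_perfect.
by move=> f0; apply: g0; rewrite simple_perfect.
Qed.

(** The radical of the Killing form is an ideal, proper by Cartan's criterion. *)
Lemma killing_nondegenerate x : (forall y, killing x y = 0) -> x = 0.
Proof.
move=> xK; have [I IP] : exists I : {vspace g}, forall x, x \in I <-> forall y, killing x y = 0.
  apply: vspace_of_pred => [y|a u v u0 v0 y]; first exact: killing0l.
  by rewrite killingDl killingZl u0 v0 mulr0 addr0.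
have [_ ideals] := g_simple; have [||I0] := ideals I.
- apply: lie_vs_subP => z y _ /IP yK; apply/IP => w.
  by rewrite lieC killingNl killing_lie yK oppr0.
- by move=> I0; apply/eqP; rewrite -memv0 -I0; apply/IP.
have [u [v /eqP[]]] := killing_neq0; suff : u \in I by move/IP.
by rewrite I0 memvf.
Qed.

Lemma killing_weight_pairing l x : x \in gen_weight l ->
  (forall y, y \in gen_weight (- l) -> killing x y = 0) -> x = 0.
Proof.
move=> xl xK; apply: killing_nondegenerate => y.
have [f [fl ->]] := gen_weight_decomp y.
rewrite killingC killing_suml big1 // => m _; rewrite killingC.
have [lm|lm] := eqVneq (l + m) 0; last exact: killing_orth xl (fl m).
by apply: xK; have -> : - l = m by apply/eqP; rewrite eq_sym -addr_eq0 addrC lm.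
Qed.

Lemma killing_torus_nondegenerate k :
  (forall h, killing (vsval k) (vsval h) = 0) -> k = 0.
Proof.
move=> kK; apply: val_inj => /=; apply: (@killing_weight_pairing 0).
  by rewrite gen_weight0 subvsP.
by rewrite oppr0 gen_weight0 => y yt; exact: kK (Subvs yt).
Qed.

Lemma weights_torus0 k : (forall m, m \in weights -> m k = 0) -> k = 0.
Proof.
move=> k0; apply: killing_torus_nondegenerate => h.
rewrite killing_torus big_seq big1 // => m mw.
by rewrite k0 // !mul0r.
Qed.

(** Weights vanish on brackets of elements of [t], and they separate the
    elements of [t]. *)
Lemma torus_abelian h k : lie (vsval h) (vsval k) = 0.
Proof.
have hkt : lie (vsval h) (vsval k) \in t.
  by move/lie_subalgP: t_subalg; apply; exact: subvsP.
suff : (Subvs hkt : subvs_of t) = 0 by move/(congr1 vsval).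
apply: weights_torus0 => m mw; apply: (weight_lie t_nil _ (erefl (vsval (Subvs hkt)))).
by rewrite -mem_weights.
Qed.

End Semisimple.

(** * Dual vectors and opposite weights *)

Section Roots.
Implicit Types (l m : tdual) (h k : subvs_of t) (x y : g).

(** The element of [t] that represents [l] through the Killing form. *)
Definition dual_vec l : subvs_of t := (killing_lfun t)^-1%VF l.

Lemma formE l m : form l m = l (dual_vec m). Proof. by []. Qed.

Lemma killing_dual_vec l h : killing (vsval (dual_vec l)) (vsval h) = l h.
Proof.
rewrite -killing_lfunE limg_lfunVK //.
have /eqP-> : limg (killing_lfun t) == fullv; last exact: memvf.
have ker0 : (fullv :&: lker (killing_lfun t) = 0)%VS.
  apply/eqP; rewrite -subv0; apply/subvP => k; rewrite memv_cap memvf memv_ker /=.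
  move=> /eqP k0; rewrite memv0; apply/eqP/killing_torus_nondegenerate.
  by move=> k1; rewrite -killing_lfunE k0 zero_lfunE.
rewrite eqEdim subvf /= (limg_dim_eq ker0) !dimvf.
have -> : dim 'Hom(subvs_of t, F^o) = (dim (subvs_of t) * 1)%N by [].
by rewrite muln1.
Qed.

Lemma form_sym l m : form l m = form m l.
Proof. by rewrite !formE -!killing_dual_vec killingC. Qed.

Lemma dual_vec_inj0 l : dual_vec l = 0 -> l = 0.
Proof.
by move=> l0; apply/lfunP => h; rewrite -killing_dual_vec l0 killing0l zero_lfunE.
Qed.

(** Invariance of the Killing form determines the bracket; only [x] has to be a
    genuine eigenvector. *)
Lemma lie_dual_vec l x y : x \in root_space l -> y \in gen_weight (- l) ->
  lie x y = killing x y *: vsval (dual_vec l).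
Proof.
move=> /root_spaceP xl yl.
have xg : x \in gen_weight l.
  by apply/gen_weightP => h; exists 1%N; rewrite /= shiftE adE xl subrr.
have [k ek] := weight_in_torus xg yl.
rewrite -ek; suff -> : k = killing x y *: dual_vec l by [].
apply/eqP; rewrite -subr_eq0; apply/eqP/killing_torus_nondegenerate => h.
rewrite (_ : vsval (k - _) = vsval k - killing x y *: vsval (dual_vec l)) //.
rewrite killingDl killingNl killingZl killing_dual_vec ek.
by rewrite lieC killingNl killing_lie lieC xl -scaleNr killingZr mulNr opprK killingC mulrC subrr.
Qed.

Lemma root_space_sub l : (root_space l <= gen_weight l)%VS.
Proof.
apply/subvP => x /root_spaceP xl; apply/gen_weightP => h; exists 1%N.
by rewrite /= shiftE adE xl subrr.
Qed.

Lemma root_space_neq0 l : l \in weights -> exists2 x, x \in root_space l & x != 0.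
Proof.
rewrite mem_weights -subv0 => l0.
have s0 : stable t (0%VS : {vspace g}) by move=> h x; rewrite !memv0 => /eqP->; rewrite lie0r.
have [x [_ x0 xl]] := engel t_subalg t_nil s0 l0; exists x; last by rewrite -memv0.
by apply/root_spaceP => h; move: (xl h); rewrite shiftE adE memv0 subr_eq0 => /eqP.
Qed.

(** The vector [f] comes from the pairing of opposite weight spaces, scaled by
    [killing e f]. *)
Lemma sl2_ex l : l \in weights -> exists e f,
  [/\ e \in root_space l, f \in gen_weight (- l), e != 0, - l \in weights &
    lie e f = vsval (dual_vec l)].
Proof.
move=> lw; have [e el e0] := root_space_neq0 lw.
have [f fl ef] : exists2 f, f \in gen_weight (- l) & killing e f != 0.
  apply: contrapT => nex; case/eqP: e0.
  apply: (killing_weight_pairing (subvP (root_space_sub l) e el)) => f fl.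
  by apply: contrapT => /eqP ef; apply: nex; exists f.
exists e, ((killing e f)^-1 *: f); split=> //; first by rewrite memvZ.
  rewrite (mem_weights); apply: contraNneq ef => l0; move: fl.
  by rewrite l0 memv0 => /eqP->; rewrite killing0r.
by rewrite lieZr (lie_dual_vec el fl) scalerA mulVf ?scale1r.
Qed.

(** If [form l l] were zero, [string_ratio] would make all weights vanish on
    the dual vector of [l]. *)
Lemma form_self_neq0 l : l \in weights -> l != 0 -> form l l != 0.
Proof.
move=> lw l0; apply: contraNneq l0 => ll0; have [e [f [el fl _ _ ef]]] := sl2_ex lw.
have [r rP] := string_ratio (subvP (root_space_sub l) e el) fl (esym ef).
apply/eqP/dual_vec_inj0; apply: weights_torus0 => m /rP[_ ->].
by rewrite -formE ll0 mulr0.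
Qed.

End Roots.

(** * Multiples of a root *)

Section RootStrings.
Implicit Types (l m : tdual) (h k : subvs_of t) (x y : g).

Lemma dim_weight_gt0 l : l \in weights -> (0 < \dim (gen_weight l))%N.
Proof. by rewrite mem_weights lt0n dimv_eq0. Qed.

(** The span of [e] and of the weight spaces of the [- (l *+ n)] is stable
    under [ad e] and [ad f], so the trace of [ad k] on it, for [k] dual to [l],
    is zero. This trace is [l k] times one minus the sum of the [n] weighted by
    the dimensions, which leaves only [n = 1], with dimension one. *)
Lemma weight_multiples l : l \in weights -> l != 0 ->
  \dim (gen_weight (- l)) = 1%N /\ forall n, (1 < n)%N -> - (l *+ n) \notin weights.
Proof.
move=> lw l0; have [e [f [el fl e0 Nlw ef]]] := sl2_ex lw.
have eg := subvP (root_space_sub l) e el.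
(* The coefficient [n] of a weight [- (l *+ n)]. *)
pose N m := xget (0 : nat) [set n : nat | m = - (l *+ n)].
have Ninj n n' : - (l *+ n) = - (l *+ n') -> n = n'.
  move/oppr_inj; rewrite !pmulrn => /(mulrz_inj l0) [].
  by [].
have NE n : N (- (l *+ n)) = n.
  have := @xgetPex _ (0 : nat) [set k : nat | - (l *+ n) = - (l *+ k)] (ex_intro _ n erefl).
  by move/Ninj.
pose s := [seq m : tdual <- weights | `[< exists n : nat, m = - (l *+ n) >]].
have sP m : (m \in s) = (m \in weights) && `[< exists n : nat, m = - (l *+ n) >].
  by rewrite mem_filter andbC.
have us : uniq s by rewrite filter_uniq ?weights_uniq.
have sN m : m \in s -> m = - (l *+ N m).
  by rewrite sP => /andP[_ /asboolP[n ->]]; rewrite NE.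
have ls : l \notin s.
  apply/negP => /sN => e1; have : l *+ (N l).+1 = l *+ 0 by rewrite mulrS {1}e1 addNr.
  by rewrite !pmulrn => /(mulrz_inj l0).
have cap : (<[e]> :&: \sum_(m <- s) gen_weight m = 0)%VS.
  apply/eqP; rewrite -subv0; have := @gen_weight_cap l s.
  rewrite /= ls us => /(_ isT) {2}<-.
  by apply: capvS; [exact: eg|exact: subvv].
set k := dual_vec l; have ek : vsval k = lie e f by [].
have lk0 : l k != 0 by exact: form_self_neq0.
set S := (\sum_(m <- s) gen_weight m)%VS.
have S_sub m x : m \in weights -> (exists n : nat, m = - (l *+ n)) -> x \in gen_weight m -> x \in S.
  by move=> mw mn; apply: (subvP (sum_gen_weightS _)); rewrite sP mw; apply/asboolP.
have S_sub' m x : (exists n : nat, m = - (l *+ n)) -> x \in gen_weight m -> x \in S.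
  have [mw|mw] := boolP (m \in weights); first exact: S_sub.
  by move=> _ /(notin_weights mw)->; exact: mem0v.
have fS : {in S, forall v, ad f v \in S}.
  apply: (ad_sum_gen_weight us fl) => m v; rewrite sP => /andP[_ /asboolP[n ->]] vm.
  have [w|w] := boolP (- l + - (l *+ n) \in weights); last by right; exact: lie_notin_weights w fl vm.
  by left; rewrite sP w; apply/asboolP; exists n.+1; rewrite mulrS opprD.
have tE h : lie (vsval h) e = l h *: e by move/root_spaceP: el.
have eS : {in (<[e]> + S)%VS, forall v, ad e v \in (<[e]> + S)%VS}.
  move=> _ /memv_addP[_ /vlineP[a ->] [v /(big_seq_memv us)[c [cm ->]] ->]].
  rewrite linearD linearZ /= adE liexx scaler0 add0r linear_sum big_seq memv_suml // => m ms.
  have := cm m; move: (c m) => {}v; rewrite (sN m ms); case: (N m) => [|n] vm /=.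
    move: vm; rewrite mulr0n oppr0 gen_weight0 => vt.
    apply: (subvP (addvSl _ _)); rewrite adE lieC memvN.
    by have := tE (Subvs vt); rewrite /= => ->; rewrite memvZ ?memv_line.
  apply: (subvP (addvSr _ _)); rewrite adE; apply: (S_sub' (- (l *+ n))); first by exists n.
  by have := gen_weightD eg vm; rewrite mulrS opprD addrA subrr add0r.
have fS' : {in (<[e]> + S)%VS, forall v, ad f v \in (<[e]> + S)%VS}.
  move=> _ /memv_addP[_ /vlineP[a ->] [v vS ->]]; apply: (subvP (addvSr _ _)).
  rewrite linearD linearZ /= memvD ?fS // memvZ // adE lieC memvN -ek.
  apply: (S_sub' 0); first by exists 0%N; rewrite mulr0n oppr0.
  by rewrite gen_weight0 subvsP.
(* The trace of the commutator is split along [<[e]>] and [S]. *)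
have := trv_commutator eS fS'; rewrite -ad_lie -ek trv_add //; last 2 first.
- by move=> _ /vlineP[a ->]; rewrite linearZ /= adE tE !memvZ ?memv_line.
- apply: (@ad_sum_gen_weight s 0) => //; first by rewrite gen_weight0 subvsP.
  by move=> m v ms _; left; rewrite add0r.
rewrite (trv_eigen (a := l k)); last 2 first.
- by move=> _ /vlineP[a ->]; rewrite linearZ /= adE tE !memvZ ?memv_line.
- by move=> _ /vlineP[a ->]; exists 1%N; rewrite /= linearZ /= shiftE adE tE subrr scaler0.
rewrite dim_vline e0 trv_ad_sum //.
have -> : \sum_(m <- s) m k * (\dim (gen_weight m))%:R =
    - l k * (\sum_(m <- s) N m * \dim (gen_weight m))%N%:R.
  rewrite natr_sum mulr_sumr; apply: eq_big_seq => m /sN {1}->.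
  by rewrite natrM opp_lfunE -scaler_nat scale_lfunE -[_ *: _]/((N m)%:R * l k : F); ring.
rewrite mulr1 mulNr => /eqP; rewrite subr_eq0 -{1}[l k]mulr1 => /eqP/(mulfI lk0)/eqP.
have Nls : - l \in s by rewrite sP Nlw; apply/asboolP; exists 1%N.
rewrite eq_sym -[1]/(1%:R) eqr_nat (bigD1_seq (- l)) //= -{1}[l]mulr1n NE mul1n.
have aux a b : (0 < a)%N -> (a + b = 1)%N -> a = 1%N /\ b = 0%N by case: a b => [|[|a]] [|b].
move=> /eqP/(aux _ _ (dim_weight_gt0 Nlw))[d1 rest].
split=> // n n1; apply/negP => nw; move/eqP: rest.
rewrite sum_nat_seq_eq0 => /allP/(_ (- (l *+ n))).
rewrite sP nw NE muln_eq0 => /(_ _)/implyP; rewrite (gtn_eqF (dim_weight_gt0 nw)).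
have -> /= : `[< exists n0 : nat, - (l *+ n) = - (l *+ n0) >] by apply/asboolP; exists n.
rewrite orbF; have -> : - (l *+ n) != - l.
  by apply/eqP; rewrite -{2}[l]mulr1n => /Ninj nn; rewrite nn in n1.
by move=> /(_ isT isT)/eqP nn; rewrite nn in n1.
Qed.

End RootStrings.

(** * Root strings *)

Section RootStrings.
Implicit Types (b l m : tdual) (h k : subvs_of t) (x y : g).

Lemma weightN l : l \in weights -> - l \in weights.
Proof. by move=> /sl2_ex[e [f []]]. Qed.

Lemma dim_gen_weight l : l \in weights -> l != 0 -> \dim (gen_weight l) = 1%N.
Proof.
move=> lw l0; have [] := weight_multiples (weightN lw) _; rewrite ?oppr_eq0 //.
by rewrite opprK.
Qed.

Lemma weight_mulrn l n : l \in weights -> l != 0 -> l *+ n \in weights -> (n <= 1)%N.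
Proof.
move=> lw l0 nw; rewrite leqNgt; apply/negP => n1.
have Nl0 : - l != 0 by rewrite oppr_eq0.
have [_ H] := weight_multiples (weightN lw) Nl0.
by have := H _ n1; rewrite mulNrn opprK nw.
Qed.

Lemma root_spaceE l : l \in weights -> l != 0 -> root_space l = gen_weight l.
Proof.
move=> lw l0; apply/eqP; rewrite eqEdim root_space_sub (dim_gen_weight lw l0) lt0n dimv_eq0.
have [x xl x0] := root_space_neq0 lw.
by apply: contraNneq x0 => r0; rewrite -memv0 -r0.
Qed.

Lemma lie_rootP l : lie_root l <-> l != 0 /\ l \in weights.
Proof.
split=> [[l0 rl]|[l0 lw]]; split=> //; last first.
  have [x xl x0] := root_space_neq0 lw.
  by apply: contraNneq x0 => r0; rewrite -memv0 -r0.
rewrite (mem_weights); apply: contraNneq rl => g0.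
by rewrite -subv0 -g0 root_space_sub.
Qed.

(** The weight [b + l *+ i] contributes [form b l + i%:R * form l l] to the
    trace of [ad (lie e f)], which is the trace of a commutator. *)
Lemma string_trace b l n e f : l != 0 ->
  e \in gen_weight l -> f \in gen_weight (- l) -> lie e f = vsval (dual_vec l) ->
  (forall i, (i <= n)%N -> b + l *+ i \in weights /\ b + l *+ i != 0) ->
  (forall v, v \in gen_weight (b + l *+ n) -> lie e v = 0) ->
  (forall v, v \in gen_weight b -> lie f v = 0) ->
  2 * form b l = - n%:R * form l l.
Proof.
move=> l0 el fl ef bw top bot; pose c (i : nat) : tdual := b + l *+ i; pose s := map c (iota 0 n.+1).
have inj : injective c.
  by move=> i j /addrI; rewrite !pmulrn => /(mulrz_inj l0)[].
have us : uniq s by rewrite map_inj_uniq ?iota_uniq.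
have sP i : (i <= n)%N -> b + l *+ i \in s by move=> ni; apply/mapP; exists i => //; rewrite mem_iota.
have sE m : m \in s -> exists2 i, (i <= n)%N & m = b + l *+ i.
  by move=> ms; have [i iP ->] := mapP ms; exists i; move: iP; rewrite ?mem_iota.
have := trv_string us _ _ el fl (esym ef).
rewrite big_map (eq_big_seq (fun i : nat => form b l + i%:R * form l l)); last first.
  move=> i; rewrite mem_iota add0n ltnS /= => /bw[iw i0].
  by rewrite (dim_gen_weight iw i0) mulr1 add_lfunE -scaler_nat scale_lfunE.
have -> : \sum_(i <- iota 0 n.+1) (form b l + i%:R * form l l) =
  n.+1%:R * (form b l + n%:R / 2 * form l l).
  rewrite -[iota 0 n.+1]/(index_iota 0 n.+1); elim: (n) => [|n' IH].
    by rewrite big_nat1 mul0r !mul0r addr0 mul1r.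
  by rewrite big_nat_recr //= IH -addn2 -[n'.+1]addn1 !natrD; field.
move=> H; have {H} : n.+1%:R * (form b l + n%:R / 2 * form l l) = 0.
  apply: H => m v /sE[i ni ->] vm.
    have [lt|ge] := ltnP i n; first by left; rewrite addrCA -mulrS sP.
    right; apply: top; suff <- : i = n by [].
    by apply/eqP; rewrite eqn_leq ni.
  case: i ni vm => [|i] ni vm; first by right; apply: bot; rewrite mulr0n addr0 in vm.
  by left; rewrite mulrSr addrA addrK sP // ltnW.
move/eqP; rewrite mulf_eq0 pnatr_eq0 /= addr_eq0 => /eqP->.
by field.
Qed.

Lemma string_top l m : l != 0 -> m \in weights ->
  exists q : nat, (forall i, (i <= q)%N -> m + l *+ i \in weights) /\ m + l *+ q.+1 \notin weights.
Proof.
move=> l0 mw; have ex : exists q : nat, m + l *+ q.+1 \notin weights.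
  apply: contrapT => nex; have all i : m + l *+ i.+1 \in weights.
    by apply: contraT => iw; case: nex; exists i.
  pose c (i : nat) : tdual := m + l *+ i.+1; pose s := map c (iota 0 (size weights).+1).
  have us : uniq s.
    rewrite map_inj_uniq ?iota_uniq // => i j /addrI; rewrite !pmulrn.
    by move=> /(mulrz_inj l0)[->].
  have sub : {subset s <= weights} by move=> u us'; have [i _ ->] := mapP us'; exact: all.
  by have := uniq_leq_size us sub; rewrite size_map size_iota ltnn.
case: (ex_minnP ex) => q qw min; exists q; split=> // -[|i]; first by rewrite mulr0n addr0.
by move=> iq; apply: contraT => /min; rewrite leqNgt iq.
Qed.

(** Here [p] and [q] count the steps on either side of [m]. If the root spaces
    of [l] and [m] commuted, the string could be cut at [m], and [string_trace]
    would give another value of [form m l]. *)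
Lemma root_string l m : lie_root l -> lie_root m -> m != l -> m != - l ->
  exists p q : nat,
  [/\ forall i, (i <= q)%N -> lie_root (m + l *+ i),
      forall i, (i <= p)%N -> lie_root (m - l *+ i),
      2 * form m l = (p%:R - q%:R) * form l l
    & lie_root (m + l) -> exists x y, [/\ x \in root_space l, y \in root_space m & lie x y != 0]].
Proof.
move=> /lie_rootP[l0 lw] /lie_rootP[m0 mw] ml mNl.
have Nl0 : - l != 0 by rewrite oppr_eq0.
have nmul (n : int) : m + l *~ n != 0.
  apply: contraNneq ml => /eqP; rewrite addr_eq0 -mulrNz => /eqP em.
  move: mw m0 mNl; rewrite em; case: (- n) => n' /=.
    by move/(weight_mulrn lw l0); case: n' => [|[|//]] _; rewrite ?eqxx.
  rewrite NegzE mulrNz => /weightN; rewrite opprK => /(weight_mulrn lw l0).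
  by case: n' => // _; rewrite eqxx.
have [q [qw qtop]] := string_top l0 mw; have [p [pw pbot]] := string_top Nl0 mw.
have [e [f [er fl _ _ ef]]] := sl2_ex lw; have el := subvP (root_space_sub l) e er.
have pw' i : (i <= p)%N -> m - l *+ i \in weights by move/pw; rewrite mulNrn.
have nz i j : m - l *+ i + l *+ j != 0.
  by have := nmul (j%:Z - i%:Z); rewrite mulrzBr -!pmulrn addrA addrAC.
have strw i n : (n <= q)%N -> (i <= p + n)%N -> m - l *+ p + l *+ i \in weights.
  move=> nq ip; have [lt|ge] := leqP i p.
    by rewrite addrAC -addrA -opprB -mulrnBr // pw' // leq_subr.
  by rewrite -addrA [- _ + _]addrC -mulrnBr 1?ltnW // qw // (leq_trans _ nq) // leq_subLR.
have bot v : v \in gen_weight (m - l *+ p) -> lie f v = 0.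
  by apply: lie_notin_weights fl; move: pbot; rewrite mulrS mulNrn addrCA.
have tr n : (n <= q)%N -> (forall v, v \in gen_weight (m + l *+ n) -> lie e v = 0) ->
    2 * form m l = (p%:R - n%:R) * form l l.
  move=> nq top; have := @string_trace (m - l *+ p) l (p + n) e f l0 el fl ef _ _ bot.
  have -> : form (m - l *+ p) l = form m l - p%:R * form l l.
    by rewrite !formE add_lfunE opp_lfunE -scaler_nat scale_lfunE.
  rewrite mulrBr natrD => H; apply/eqP; rewrite -subr_eq0; apply/eqP.
  transitivity (2 * form m l - 2 * (p%:R * form l l) - - (p%:R + n%:R) * form l l); first by ring.
  rewrite H ?subrr // => [i ip|v]; first by rewrite (strw i n) ?nz.
  by rewrite mulrnDr addrA subrK; exact: top.
exists p, q; split=> [i iq|i ip||/lie_rootP[_ mlw]].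
- by apply/lie_rootP; split; [have := nz 0%N i; rewrite mulr0n subr0|exact: qw].
- by apply/lie_rootP; split; [have := nz i 0%N; rewrite mulr0n addr0|exact: pw'].
- apply: tr => // v; apply: lie_notin_weights el; move: qtop; by rewrite mulrS addrCA.
have q0 : (0 < q)%N.
  by rewrite lt0n; apply: contraTneq mlw => q0; move: qtop; rewrite q0 mulr1n.
apply: contrapT => nex; have := tr 0%N isT; rewrite (tr q) //; first last.
  by move=> v; apply: lie_notin_weights el; move: qtop; rewrite mulrS addrCA.
have kill v : v \in gen_weight (m + l *+ 0) -> lie e v = 0.
  rewrite mulr0n addr0 -(root_spaceE mw m0) => vm; apply: contrapT => /eqP ev.
  by apply: nex; exists e, v.
move=> /(_ kill)/(mulIf (form_self_neq0 lw l0)); rewrite subr0 => /eqP.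
rewrite -subr_eq0 addrC addKr oppr_eq0 pnatr_eq0 => /eqP q0'.
by rewrite q0' in q0.
Qed.

End RootStrings.

(** * The root system *)

Section RootSystem.
Implicit Types (b l m : tdual) (h k : subvs_of t) (x y : g).

Lemma formDl l m b : form (l + m) b = form l b + form m b.
Proof. by rewrite !formE add_lfunE. Qed.

Lemma formNl l b : form (- l) b = - form l b.
Proof. by rewrite !formE opp_lfunE. Qed.

Lemma form0l b : form (0 : tdual) b = 0.
Proof. by rewrite formE zero_lfunE. Qed.

Lemma formDr l m b : form b (l + m) = form b l + form b m.
Proof. by rewrite !(form_sym b) formDl. Qed.

Lemma formNr l b : form b (- l) = - form b l.
Proof. by rewrite !(form_sym b) formNl. Qed.

Lemma form_suml (I : Type) (r : seq I) (P : pred I) (f : I -> tdual) b :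
  form (\sum_(i <- r | P i) f i) b = \sum_(i <- r | P i) form (f i) b.
Proof.
by elim: r => [|i r IH]; rewrite ?big_nil ?form0l // !big_cons; case: ifP => _; rewrite ?formDl IH.
Qed.

Lemma form_torus l : form l l =
  \sum_(m <- weights) form m l ^+ 2 * (\dim (gen_weight m))%:R.
Proof.
rewrite formE -killing_dual_vec killing_torus.
by apply: eq_bigr => m _; rewrite -formE expr2.
Qed.

Lemma rootN l : lie_root l -> lie_root (- l).
Proof.
move=> /lie_rootP[l0 lw]; apply/lie_rootP; rewrite oppr_eq0; split=> //.
exact: weightN.
Qed.

Lemma root_neq0 l : lie_root l -> l != 0. Proof. by case. Qed.

(** The sum of squares that computes [form l l] is a nonnegative multiple of
    [form l l ^+ 2], because all weights are real multiples of [l] on the dual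
    vector of [l]. *)
Lemma form_self_gt0 l : lie_root l -> 0 < form l l.
Proof.
move=> /lie_rootP[l0 lw]; have ll0 := form_self_neq0 lw l0.
have [e [f [el fl _ _ ef]]] := sl2_ex lw.
have [r rP] := string_ratio (subvP (root_space_sub l) e el) fl (esym ef).
have := form_torus l; set c := \sum_(m <- weights) r m ^+ 2 * (\dim (gen_weight m))%:R.
have -> : \sum_(m <- weights) form m l ^+ 2 * (\dim (gen_weight m))%:R = c * form l l ^+ 2.
  rewrite mulr_suml; apply: eq_big_seq => m /rP[_ e1]; rewrite formE e1 -formE; ring.
have c0 : 0 <= c.
  rewrite /c big_seq; apply: sumr_ge0 => m /rP[rm _].
  by rewrite mulr_ge0 ?ler0n // real_exprn_even_ge0.
move=> e1; have cl : c * form l l = 1.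
  by apply: (mulIf ll0); rewrite mul1r -mulrA -expr2 -e1.
have cn : c != 0 by apply: contraTneq isT => cz; move: cl; rewrite cz mul0r => /eqP; rewrite eq_sym oner_eq0.
have -> : form l l = c^-1 by apply: (mulfI cn); rewrite cl divff.
by rewrite invr_gt0 lt_def cn.
Qed.

(** With [n = p - q] in the notation of [root_string], the root [m - l *~ n] is
    still on the string through [m]. *)
Lemma root_reflection l m : lie_root l -> lie_root m ->
  exists n : int, 2 * form m l = n%:~R * form l l /\ lie_root (m - l *~ n).
Proof.
move=> lr mr; have [->|ml] := eqVneq m l.
  by exists 2; split=> //; rewrite -[2]/(1 + 1) mulrzDr mulr1z opprD addrA subrr add0r; exact: rootN.
have [->|mNl] := eqVneq m (- l).
  exists (- 2); rewrite formNl !mulrNz opprK mulrN mulNr; split=> //.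
  by rewrite -[2]/(1 + 1) mulrzDr mulr1z addrA addNr add0r.
have [p [q [qr pr e _]]] := root_string lr mr ml mNl.
exists (p%:Z - q%:Z); split; first by rewrite e intrB.
have [qp|/ltnW pq] := leqP q p.
  by rewrite subzn // -pmulrn; apply: pr; exact: leq_subr.
by rewrite -[p%:Z - _]opprB subzn // mulrNz opprK -pmulrn; apply: qr; exact: leq_subr.
Qed.

Lemma form_real l m : lie_root l -> lie_root m -> form m l \is Num.real.
Proof.
move=> lr mr; have [n [e _]] := root_reflection lr mr.
have -> : form m l = n%:~R * form l l / 2 by rewrite -e mulrC mulKf // pnatr_eq0.
by rewrite rpredM ?rpredV ?realn // rpredM ?realz // gtr0_real // form_self_gt0.
Qed.

Lemma root_add l m : lie_root l -> lie_root m -> form m l < 0 ->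
  m + l = 0 \/ lie_root (m + l).
Proof.
move=> lr mr lt0; have [ml|ml] := eqVneq m l.
  by move: lt0; rewrite ml => /(lt_trans (form_self_gt0 lr)); rewrite ltxx.
have [->|mNl] := eqVneq m (- l); first by left; rewrite addNr.
have [p [q [qr pr e _]]] := root_string lr mr ml mNl.
right; case: q qr e => [|q] qr e; last by have := qr 1%N isT; rewrite mulr1n.
have : 0 <= 2 * form m l by rewrite e subr0 mulr_ge0 ?ler0n // ltW // form_self_gt0.
by rewrite pmulr_rge0 // => /(lt_le_trans lt0); rewrite ltxx.
Qed.

Lemma root_sub l m : lie_root l -> lie_root m -> 0 < form m l ->
  m = l \/ lie_root (m - l).
Proof.
move=> lr mr gt0; have lt0 : form m (- l) < 0 by rewrite formNr oppr_lt0.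
have [e|] := root_add (rootN lr) mr lt0; last by right.
by left; apply/eqP; rewrite -subr_eq0 e.
Qed.

(** Over all weights [m], the squares of the real numbers [form m b] add up to
    [form b b]. *)
Lemma form_ge0 b : (forall l, lie_root l -> form l b \is Num.real) -> 0 <= form b b.
Proof.
move=> br; rewrite form_torus big_seq; apply: sumr_ge0 => m mw.
rewrite mulr_ge0 ?ler0n // real_exprn_even_ge0 //.
have [->|m0] := eqVneq m 0; first by rewrite form0l.
by apply: br; apply/lie_rootP.
Qed.

Lemma form_eq0 b : (forall l, lie_root l -> form l b \is Num.real) ->
  form b b = 0 -> b = 0.
Proof.
move=> br; rewrite form_torus => /eqP; rewrite big_seq psumr_eq0; last first.
  move=> m mw; rewrite mulr_ge0 ?ler0n // real_exprn_even_ge0 //.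
  have [->|m0] := eqVneq m 0; first by rewrite form0l.
  by apply: br; apply/lie_rootP.
move=> /allP H; apply: dual_vec_inj0.
apply: weights_torus0 => m mw; rewrite -formE.
have := H m mw; rewrite mw /= mulf_eq0 expf_eq0 /= pnatr_eq0.
by rewrite (gtn_eqF (dim_weight_gt0 mw)) orbF => /eqP.
Qed.

Lemma dim_root_space l : lie_root l -> \dim (root_space l) = 1%N.
Proof.
move=> /lie_rootP[l0 lw].
by rewrite (root_spaceE lw l0) (dim_gen_weight lw l0).
Qed.

Lemma root_vector l : lie_root l -> exists2 x, x != 0 & root_space l = <[x]>%VS.
Proof.
move=> lr; have d1 := dim_root_space lr; exists (vpick (root_space l)).
  by rewrite vpick0 -dimv_eq0 d1.
apply/eqP; rewrite eq_sym eqEdim -memvE memv_pick d1 dim_vline vpick0 -dimv_eq0 d1.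
by [].
Qed.

Lemma lie_root_space l m x y : x \in root_space l -> y \in root_space m ->
  lie x y \in root_space (l + m).
Proof.
move=> /root_spaceP xl /root_spaceP ym; apply/root_spaceP => h.
by rewrite lie_derivation xl ym lieZl lieZr add_lfunE scalerDl.
Qed.

Lemma lie_root_space_notin l m x y : x \in root_space l -> y \in root_space m ->
  l + m != 0 -> ~ lie_root (l + m) -> lie x y = 0.
Proof.
move=> xl ym lm0 nr; apply/eqP; rewrite -memv0; apply: contraT => xy; case: nr; split=> //.
apply: contraNneq xy => e; rewrite -e; exact: lie_root_space.
Qed.

Lemma lie_root_space_neq0 l m x y : lie_root l -> lie_root m -> lie_root (l + m) ->
  x \in root_space l -> y \in root_space m -> x != 0 -> y != 0 -> lie x y != 0.
Proof.
move=> lr mr lmr xl ym x0 y0.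
have ml : m != l.
  apply: contraTneq isT => ml; move/lie_rootP: lmr; rewrite ml -mulr2n => -[_].
  by move/lie_rootP: lr => [l0 lw] /(weight_mulrn lw l0).
have mNl : m != - l by apply: contraTneq (root_neq0 lmr) => ->; rewrite subrr eqxx.
have [p [q [_ _ _ H]]] := root_string lr mr ml mNl.
have [|e [f [el fm ef]]] := H; first by rewrite addrC.
have [u u0 lE] := root_vector lr; have [v v0 mE] := root_vector mr.
move: xl ym el fm; rewrite lE mE => /vlineP[a xa] /vlineP[c yc] /vlineP[a' ea] /vlineP[c' fc].
have uv : lie u v != 0.
  by apply: contraNneq ef => uv; rewrite ea fc lieZl lieZr uv !scaler0.
rewrite xa yc lieZl lieZr !scaler_eq0 !negb_or uv !andbT.
move: x0 y0; rewrite xa yc !scaler_eq0 !negb_or => /andP[-> _] /andP[-> _].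
by [].
Qed.

(** A sum of roots from two orthogonal pieces is not a root, so the centralizer
    of the root vectors of one piece is an ideal; it contains the root vectors
    of the other piece, and not everything. *)
Lemma lie_root_irreducible : irreducible_set rootset.
Proof.
split.
  apply: contrapT => /set0P/negP; rewrite negbK => /eqP no.
  have tf : t = fullv.
    apply/eqP; rewrite eqEsubv subvf /= -gen_weight_sum big_seq.
    elim/big_rec: _ => [|l V lw IH]; first exact: sub0v.
    rewrite subv_add IH andbT; have [->|l0] := eqVneq l 0.
      by rewrite gen_weight0 subvv.
    have : (rootset) l by apply/lie_rootP.
    by rewrite no.
  have [g0 _] := g_simple; apply: g0; apply/eqP; rewrite -subv0; apply: lie_vs_subP => u v.
  rewrite -tf => ut vt; rewrite memv0; apply/eqP.
  exact: (torus_abelian (Subvs ut) (Subvs vt)).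
move=> A B AB orth.
have [->|/set0P[a Aa]] := eqVneq A set0; first by left.
have [->|/set0P[b Bb]] := eqVneq B set0; first by right.
exfalso.
have Ar l : A l -> lie_root l by move=> Al; rewrite AB; left.
have Br l : B l -> lie_root l by move=> Bl; rewrite AB; right.
have sum_root l m : A l -> B m -> ~ lie_root (l + m).
  move=> Al Bm; rewrite AB => -[lmA|lmB].
    have := orth _ _ lmA Bm; rewrite formDl (orth _ _ Al Bm) add0r => /eqP.
    by rewrite gt_eqF // form_self_gt0 //; exact: Br.
  have := orth _ _ Al lmB; rewrite formDr (orth _ _ Al Bm) addr0 => /eqP.
  by rewrite gt_eqF // form_self_gt0 //; exact: Ar.
have sum_neq0 l m : A l -> B m -> l + m != 0.
  move=> Al Bm; apply/eqP => /eqP; rewrite addr_eq0 => /eqP lm; have := orth _ _ Al Bm.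
  rewrite lm formNl => /eqP; rewrite oppr_eq0 gt_eqF // form_self_gt0 //; exact: Br.
have [C CP] : exists C : {vspace g}, forall x, x \in C <->
    forall m y, B m -> y \in root_space m -> lie x y = 0.
  apply: vspace_of_pred => [m y _ _|c u v uC vC m y Bm ym]; first exact: lie0l.
  by rewrite lieDl lieZl (uC m) // (vC m) // scaler0 addr0.
have AC l x : A l -> x \in root_space l -> x \in C.
  move=> Al xl; apply/CP => m y Bm ym.
  exact: lie_root_space_notin xl ym (sum_neq0 _ _ Al Bm) (sum_root _ _ Al Bm).
have Cideal : lie_ideal C.
  apply: lie_vs_subP => x v _ vC; have [f [fl ->]] := gen_weight_decomp x.
  rewrite lie_suml big_seq memv_suml // => l lw; apply/CP => m y Bm ym.
  move/CP: (vC) => vC0; have jac z : lie (lie z v) y = lie z (lie v y) - lie v (lie z y).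
    by rewrite lie_derivation addrK.
  have [l0|l0] := eqVneq l 0.
    have ft : f l \in t by rewrite -gen_weight0 -l0.
    have e : lie (f l) y = m (Subvs ft) *: y by move/root_spaceP: ym => /(_ (Subvs ft)).
    by rewrite jac e lieZr (vC0 m y Bm ym) scaler0 lie0r subrr.
  have flr : f l \in root_space l by rewrite (root_spaceE lw l0).
  have : (rootset) l by apply/lie_rootP.
  rewrite AB => -[Al|Bl]; last by rewrite (lieC (f l)) (vC0 l _ Bl flr) oppr0 lie0l.
  have /CP flC := AC _ _ Al flr.
  by rewrite jac (vC0 m y Bm ym) (flC m y Bm ym) !lie0r subrr.
have [_ ideals] := g_simple; have [C0|Cf] := ideals C Cideal.
  have [x x0 ax] := root_vector (Ar _ Aa); case/eqP: x0; apply/eqP; rewrite -memv0 -C0.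
  by apply: AC Aa _; rewrite ax memv_line.
have [x x0 bx] := root_vector (Br _ Bb); have xb : x \in root_space b by rewrite bx memv_line.
have /CP H : vsval (dual_vec b) \in C by rewrite Cf memvf.
have := H b x Bb xb.
move/root_spaceP: xb => -> /eqP; rewrite scaler_eq0 (negPf x0) orbF -formE.
by rewrite gt_eqF // form_self_gt0 //; exact: Br.
Qed.

End RootSystem.

(** * Positive sets of roots *)

Section PositiveSets.
Implicit Types (b l m : tdual) (h k : subvs_of t) (x y : g) (S : set tdual) (U W : {vspace g}).

(** The roots of a Borel subalgebra form such a set, and so do the larger sets
    that are compared with it to prove that it is maximal. *)
Definition positive_set S := [/\ S `<=` rootset,
  forall l m, S l -> S m -> lie_root (l + m) -> S (l + m)
  & forall l, S l -> ~ S (- l)].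

(** In a vanishing sum, the first term has a negative product with another one,
    and the two can be merged into a single root of the set. *)
Lemma positive_sum_neq0 S (s : seq tdual) : positive_set S -> {in s, forall m, S m} ->
  \sum_(m <- s) m = 0 -> s = [::].
Proof.
move=> [Sr Sadd Sopp]; have [n] := ubnP (size s); elim: n s => // n IH [//|l s].
rewrite ltnS /= => sn sS; rewrite big_cons => sum0.
have Sl : S l by apply: sS; rewrite mem_head.
have {}sS m : m \in s -> S m by move=> ms; apply: sS; rewrite inE ms orbT.
have [m ms lt0] : exists2 m, m \in s & form m l < 0.
  apply: contrapT => nex; have ge0 : 0 <= form (\sum_(m <- s) m) l.
    rewrite form_suml big_seq; apply: sumr_ge0 => m ms.
    have /real_ltP/(_ (real0 _)) := form_real (Sr _ Sl) (Sr _ (sS m ms)).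
    by case=> // lt0; case: nex; exists m.
  have := congr1 (fun v : tdual => form v l) sum0; rewrite formDl form0l => /eqP.
  by rewrite gt_eqF // ltr_pwDl //; exact: (form_self_gt0 (Sr _ Sl)).
have [e|mlr] := root_add (Sr _ Sl) (Sr _ (sS m ms)) lt0.
  case: (Sopp _ Sl); suff <- : m = - l by exact: sS.
  by apply/eqP; rewrite -addr_eq0 e.
have : (m + l) :: rem m s = [::]; last by [].
apply: IH => [|x|]; first by rewrite /= size_rem //; case: (s) ms sn.
  rewrite inE => /predU1P[->|/mem_rem/sS//]; apply: Sadd => //; exact: sS.
by rewrite big_cons -[RHS]sum0 (big_rem m ms) /= addrA [m + l]addrC.
Qed.

Lemma positive_cone0 S l m : positive_set S -> cone S l -> cone S m -> l + m = 0 -> l = 0.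
Proof.
move=> Sp [s sS ->] [r rS ->]; rewrite -big_cat => e.
have : s ++ r = [::].
  by apply: positive_sum_neq0 Sp _ e => z; rewrite mem_cat => /orP[/sS|/rS].
by case: s {sS e} => // _; rewrite big_nil.
Qed.

Definition roots : seq tdual := [seq l <- weights | l != 0].

Lemma mem_roots l : (l \in roots) <-> lie_root l.
Proof. by rewrite mem_filter; split=> [/andP[? ?]|/lie_rootP[-> ->]]; first exact/lie_rootP. Qed.

Lemma roots_uniq : uniq roots. Proof. by rewrite filter_uniq ?weights_uniq. Qed.

Definition root_list S : seq tdual := [seq l <- roots | `[< S l >]].

Lemma mem_root_list S l : S `<=` rootset -> (l \in root_list S) <-> S l.
Proof.
move=> Sr; rewrite mem_filter; split=> [/andP[/asboolP]//|Sl].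
by apply/andP; split; [exact/asboolP|apply/mem_roots/Sr].
Qed.

Lemma root_list_uniq S : uniq (root_list S).
Proof. by rewrite filter_uniq ?roots_uniq. Qed.

Lemma big_root_list (R : Type) (idx : R) (op : Monoid.com_law idx) S (f : tdual -> R) :
  S `<=` rootset ->
  \big[op/idx]_(a \in S) f a = \big[op/idx]_(a <- root_list S) f a.
Proof.
move=> Sr; have e : S = [set` root_list S].
  by apply/predeqP => l; split=> /mem_root_list; apply.
by rewrite {1}e -fsbig_seq ?root_list_uniq.
Qed.

(** Only the size of this list matters: it is a measure for inductions. *)
Definition below S l : seq tdual :=
  root_list [set m | S m /\ exists2 c, cone S c & l = m + c].

(** What is below [l] is below [l + m], whereas [l + m] is not below [l]
    because nonempty sums of elements of [S] do not vanish. *)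
Lemma below_lt S l m : positive_set S -> S l -> S m -> S (l + m) ->
  (size (below S l) < size (below S (l + m)%R))%N.
Proof.
move=> Sp Sl Sm Slm; have [Sr _ Sopp] := Sp.
have br (a : tdual) : [set m | S m /\ exists2 c, cone S c & a = m + c] `<=` rootset.
  by move=> ? [/Sr].
have lm_in : l + m \in below S (l + m).
  by apply/mem_root_list => //; split=> //; exists 0; rewrite ?addr0 //; exact: cone0.
have lm_notin : l + m \notin below S l.
  apply/negP => /mem_root_list[] // _ [c cS]; rewrite -addrA -{1}[l]addr0 => /addrI e.
  have m0 := positive_cone0 Sp (cone_mem Sm) cS (esym e).
  by have := root_neq0 (Sr _ Sm); rewrite m0 eqxx.
rewrite (perm_size (perm_to_rem lm_in)) /= ltnS.
apply: uniq_leq_size (root_list_uniq _) _ => x xl; rewrite mem_rem_uniq ?root_list_uniq // inE.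
have -> /= : x != l + m by apply: contraNneq lm_notin => <-.
move/mem_root_list: xl => [] // Sx [c cS e]; apply/mem_root_list => //; split=> //.
by exists (c + m); [apply: coneD cS (cone_mem Sm)|rewrite e addrA].
Qed.

Lemma positive_indecomposable S : positive_set S -> S !=set0 ->
  exists2 l, S l & forall a b, S a -> S b -> l <> a + b.
Proof.
move=> Sp [l Sl]; have [n] := ubnP (size (below S l)); elim: n l Sl => // n IH l Sl ln.
have [[a [b [Sa Sb e]]]|nex] := EM (exists a b, [/\ S a, S b & l = a + b]).
  apply: (IH a Sa); rewrite -ltnS; apply: leq_trans ln; rewrite ltnS.
  by rewrite e; apply: below_lt; rewrite -?e.
by exists l => // a b Sa Sb e; apply: nex; exists a, b.
Qed.

Definition indecomposable S : set tdual :=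
  [set l | S l /\ ~ exists l1 l2, [/\ S l1, S l2 & l = l1 + l2]].

Lemma positive_cone_indecomposable S l : positive_set S -> S l -> cone (indecomposable S) l.
Proof.
move=> Sp Sl; have [n] := ubnP (size (below S l)); elim: n l Sl => // n IH l Sl ln.
have [[a [b [Sa Sb e]]]|nex] := EM (exists a b, [/\ S a, S b & l = a + b]); last first.
  exact: cone_mem.
rewrite e; apply: coneD; apply: IH => //; rewrite -ltnS; apply: leq_trans ln; rewrite ltnS e.
  by apply: below_lt; rewrite -?e.
by rewrite addrC; apply: below_lt; rewrite // addrC -?e.
Qed.

Definition root_sum S : {vspace g} := (\sum_(l <- root_list S) root_space l)%VS.

Lemma root_sum_sup S l : S `<=` rootset -> S l -> (root_space l <= root_sum S)%VS.
Proof.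
by move=> Sr Sl; have ls : l \in root_list S by [apply/mem_root_list]; rewrite /root_sum (big_rem l ls) addvSl.
Qed.

Lemma root_sum_decomp S x : x \in root_sum S ->
  exists f : tdual -> g, (forall l, f l \in root_space l) /\ x = \sum_(l <- root_list S) f l.
Proof. exact: big_seq_memv (root_list_uniq S). Qed.

Lemma root_sum_sub S W : S `<=` rootset ->
  (forall l, S l -> (root_space l <= W)%VS) -> (root_sum S <= W)%VS.
Proof.
move=> Sr SW; rewrite /root_sum big_seq; elim/big_rec: _ => [|l V ls IH]; first exact: sub0v.
by rewrite subv_add IH andbT; apply: SW; apply/mem_root_list.
Qed.

Lemma lie_root_sum S S' W : S `<=` rootset -> S' `<=` rootset ->
  (forall l m x y, S l -> S' m -> x \in root_space l -> y \in root_space m -> lie x y \in W) ->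
  (lie_vs (root_sum S) (root_sum S') <= W)%VS.
Proof.
move=> Sr Sr' SW; apply: lie_vs_subP => u v /root_sum_decomp[f [fl ->]].
move=> /root_sum_decomp[f' [fl' ->]]; rewrite lie_suml big_seq memv_suml // => l ls.
rewrite linear_sum big_seq memv_suml // => m ms.
by apply: SW (fl l) (fl' m); apply/mem_root_list.
Qed.

Lemma lie_torus_root_sum S h v : v \in root_sum S -> lie (vsval h) v \in root_sum S.
Proof.
move=> /root_sum_decomp[f [fl ->]]; rewrite linear_sum big_seq.
rewrite memv_suml // => l ls; rewrite /root_sum (big_rem l ls) /=.
apply: (subvP (addvSl _ _)); have /root_spaceP -> := fl l; rewrite memvZ //.
Qed.

Lemma lie_root_sum_torus S h v : v \in root_sum S -> lie v (vsval h) \in root_sum S.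
Proof. by move=> vS; rewrite lieC memvN lie_torus_root_sum. Qed.

Lemma derived_iterS U V n : (U <= V)%VS ->
  (iter n (fun W => lie_vs W W) U <= iter n (fun W => lie_vs W W) V)%VS.
Proof. by move=> UV; elim: n => //= n IH; exact: lie_vsS. Qed.

Lemma lie_positive S l m x y : positive_set S -> S l -> S m ->
  x \in root_space l -> y \in root_space m -> lie x y != 0 -> S (l + m).
Proof.
move=> [Sr Sadd Sopp] Sl Sm xl ym xy; have lm0 : l + m != 0.
  apply/eqP => /eqP; rewrite addrC addr_eq0 => /eqP e; apply: (Sopp l Sl); by rewrite -e.
have [lmr|nr] := EM (lie_root (l + m)); first exact: Sadd.
by move: xy; rewrite (lie_root_space_notin xl ym lm0 nr) eqxx.
Qed.

(** Removing an indecomposable root leaves a smaller positive set, whose root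
    spaces contain the derived algebra. *)
Lemma root_sum_solvable S : positive_set S -> lie_solvable (root_sum S).
Proof.
have [n] := ubnP (size (root_list S)); elim: n S => // n IH S; rewrite ltnS => Sn Sp.
have [Sr Sadd Sopp] := Sp; have [S0|/set0P Sne] := eqVneq S set0.
  exists 0%N => /=; apply/eqP; rewrite -subv0; apply: root_sum_sub => //.
  by move=> l; rewrite S0.
have [g0 Sg0 ind] := positive_indecomposable Sp Sne.
pose S' := S `\ g0.
have Sp' : positive_set S'.
  split=> [l [/Sr]//|l m [Sl _] [Sm _] lmr|l [Sl _] [/(Sopp l Sl)]//].
  by split; [exact: Sadd|move=> e; exact: (ind l m Sl Sm (esym e))].
have [Sr' _ _] := Sp'.
have [|k kS'] := IH S' _ Sp'.
  apply: leq_trans Sn; have gs : g0 \in root_list S by apply/mem_root_list.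
  rewrite (perm_size (perm_to_rem gs)) /= ltnS.
  apply: uniq_leq_size (root_list_uniq _) _ => x /mem_root_list[] // Sx xg.
  rewrite mem_rem_uniq ?root_list_uniq // inE; apply/andP; split; first exact/eqP.
  by apply/mem_root_list.
exists k.+1; rewrite iterSr; apply/eqP; rewrite -subv0 -kS'; apply: derived_iterS.
apply: lie_root_sum => // l m x y Sl Sm xl ym.
have [->|xy] := eqVneq (lie x y) 0; first exact: mem0v.
have Slm := lie_positive Sp Sl Sm xl ym xy.
apply: (subvP (root_sum_sup Sr' (_ : S' (l + m)))); last exact: lie_root_space.
by split=> // e; exact: (ind l m Sl Sm (esym e)).
Qed.

Lemma lie_torus_root_sum_sub S : positive_set S ->
  (lie_vs (t + root_sum S) (t + root_sum S) <= root_sum S)%VS.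
Proof.
move=> Sp; have [Sr _ _] := Sp.
apply: lie_vs_subP => _ _ /memv_addP[u ut [v vS ->]] /memv_addP[u' ut' [v' vS' ->]].
rewrite lieDl !lieDr (torus_abelian (Subvs ut) (Subvs ut')) add0r.
rewrite memvD ?memvD ?(lie_torus_root_sum (Subvs ut)) ?(lie_root_sum_torus (Subvs ut')) //.
have : (lie_vs (root_sum S) (root_sum S) <= root_sum S)%VS.
  apply: lie_root_sum => // l m x y Sl Sm xl ym.
  have [->|xy] := eqVneq (lie x y) 0; first exact: mem0v.
  apply: (subvP (root_sum_sup Sr (lie_positive Sp Sl Sm xl ym xy))).
  exact: lie_root_space.
by move/subvP; apply; exact: memv_lie.
Qed.

Lemma torus_root_sum_subalg S : positive_set S ->
  lie_subalg (t + root_sum S)%VS /\ lie_solvable (t + root_sum S)%VS.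
Proof.
move=> Sp; have der := lie_torus_root_sum_sub Sp; split.
  exact: subv_trans der (addvSr _ _).
have [n n0] := root_sum_solvable Sp; exists n.+1; rewrite iterSr; apply/eqP.
by rewrite -subv0 -n0; exact: derived_iterS.
Qed.

End PositiveSets.

Section Borel.
Context {b : {vspace g}} (b_borel : borel b) (t_sub_b : (t <= b)%VS).
Local Notation simple := (simple_root t b).

(** * Borel subalgebras *)

Section PositiveRoots.
Implicit Types (l m : tdual) (h k : subvs_of t) (x y : g) (S : set tdual).

Lemma borel_lie x y : x \in b -> y \in b -> lie x y \in b.
Proof. by move=> xb yb; have [/lie_subalgP + _ _] := b_borel; apply. Qed.

Lemma pos_root_mem l x : lie_root l -> x \in root_space l -> x != 0 -> x \in b -> pos_root b l.
Proof.
move=> lr xl x0 xb; split=> //; have [v v0 lE] := root_vector lr.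
move: xl x0; rewrite lE => /vlineP[a xa]; rewrite xa scaler_eq0 negb_or => /andP[a0 _].
by rewrite -memvE -[v]scale1r -(mulVf a0) -scalerA -xa memvZ.
Qed.

Lemma borel_component x (f : tdual -> g) : x \in b -> (forall l, f l \in gen_weight l) ->
  x = \sum_(l <- weights) f l -> forall l, l \in weights -> f l \in b.
Proof.
move=> xb fl ex; apply: gen_weight_component => //.
- by move=> h v vb; apply: borel_lie => //; exact: subvP t_sub_b _ (subvsP h).
- exact: weights_uniq.
- by rewrite -ex.
Qed.

Lemma pos_root_add l m : pos_root b l -> pos_root b m -> lie_root (l + m) -> pos_root b (l + m).
Proof.
move=> [lr lb] [mr mb] lmr; have [x x0 lE] := root_vector lr.
have [y y0 mE] := root_vector mr.
have xl : x \in root_space l by rewrite lE memv_line.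
have ym : y \in root_space m by rewrite mE memv_line.
apply: (pos_root_mem lmr (lie_root_space xl ym)).
  exact: (lie_root_space_neq0 lr mr lmr).
by apply: borel_lie; [exact: subvP lb x xl|exact: subvP mb y ym].
Qed.

(** Opposite root spaces generate a copy of [sl2], which is perfect. *)
Lemma pos_root_opp l : pos_root b l -> ~ pos_root b (- l).
Proof.
move=> [lr lb] [_ Nlb]; have [_ [n n0] _] := b_borel.
have /lie_rootP[l0 lw] := lr; have [e [f [el fl e0 _ ef]]] := sl2_ex lw.
have ll0 := form_self_neq0 lw l0.
have Nlw : - l \in weights by exact: weightN.
have fr : f \in root_space (- l) by rewrite (root_spaceE Nlw) ?oppr_eq0.
pose h := vsval (dual_vec l).
have inV (k : nat) : [/\ e \in iter k (fun V => lie_vs V V) b, f \in iter k (fun V => lie_vs V V) b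
    & h \in iter k (fun V => lie_vs V V) b].
  elim: k => [|k [eV fV hV]] /=.
    by split; [exact: subvP lb e el|exact: subvP Nlb f fr|exact: subvP t_sub_b _ (subvsP _)].
  have he : lie h e = form l l *: e by move/root_spaceP: el => ->.
  have hf : lie h f = - form l l *: f by move/root_spaceP: fr => ->; rewrite opp_lfunE.
  have [He Hf] := (memv_lie hV eV, memv_lie hV fV); split.
  - by rewrite -[e]scale1r -(mulVf ll0) -scalerA -he memvZ.
  - have Nll : - form l l != 0 by rewrite oppr_eq0.
    by rewrite -[f]scale1r -(mulVf Nll) -scalerA -hf memvZ.
  - by rewrite /h -ef; exact: memv_lie.
by have [+ _ _] := inV n; rewrite n0 memv0 (negPf e0).
Qed.

Lemma pos_root_positive : positive_set (pos_root b : set tdual).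
Proof.
split=> [l []//|l m lp mp lmr|l]; first exact: pos_root_add.
exact: pos_root_opp.
Qed.

Lemma borel_sub S : pos_root b `<=` S -> S `<=` rootset ->
  (b <= t + root_sum S)%VS.
Proof.
move=> bS Sr; apply/subvP => x xb; have [f [fl ex]] := gen_weight_decomp x.
rewrite ex big_seq memv_suml // => l lw; have fb := borel_component xb fl ex lw.
have [l0|l0] := eqVneq l 0.
  by apply: (subvP (addvSl _ _)); rewrite -gen_weight0 -l0.
apply: (subvP (addvSr _ _)); have [->|fl0] := eqVneq (f l) 0; first exact: mem0v.
have lr : lie_root l by apply/lie_rootP.
have flr : f l \in root_space l by rewrite (root_spaceE lw l0).
exact: subvP (root_sum_sup Sr (bS _ (pos_root_mem lr flr fl0 fb))) _ flr.
Qed.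

(** The solvable subalgebra [t + root_sum S] contains [b], hence equals it. *)
Lemma borel_maximal S l : positive_set S -> pos_root b `<=` S -> S l -> pos_root b l.
Proof.
move=> Sp bS Sl; have [Sr _ _] := Sp; have [sub sol] := torus_root_sum_subalg Sp.
have [_ _ max] := b_borel; have e := max _ sub sol (borel_sub bS Sr).
split; first exact: Sr.
rewrite -e; exact: subv_trans (root_sum_sup Sr Sl) (addvSr _ _).
Qed.

(** If neither [l] nor [- l] were positive, one of them could be added to the
    cone of positive roots without creating opposite elements, contradicting
    [borel_maximal]. Should both additions fail, multiples of [l] and of [- l]
    would be sums of positive roots, and these sums would cancel. *)
Lemma pos_root_total l : lie_root l -> pos_root b l \/ pos_root b (- l).
Proof.
move=> lr; apply: contrapT => nl; pose P := pos_root b : set tdual.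
have Pp : positive_set P := pos_root_positive.
have [Pr _ _] := Pp.
(* [S a] is the closure of [P] with [a] added. If it contains two opposite
   roots, their sum expresses a multiple of [- a] in the cone of [P]. *)
pose S a := [set m | lie_root m /\ exists c n, cone P c /\ m = c + a *+ n].
have key a : lie_root a -> ~ pos_root b a ->
    exists c n, [/\ cone P c, (0 < n)%N & c = - (a *+ n)].
  move=> ar na; apply: contrapT => nex; apply: na.
  apply: (@borel_maximal (S a)); last first.
  - by split=> //; exists 0, 1%N; rewrite add0r mulr1n; split=> //; exact: cone0.
  - move=> m mp; split; first exact: Pr.
    by exists m, 0%N; rewrite mulr0n addr0; split=> //; exact: cone_mem.
  split=> [m []//|m m' [_ [c [n [cc e]]]] [_ [c' [n' [cc' e']]]] mr|m].
    split=> //; exists (c + c'), (n + n')%N; split; first exact: coneD.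
    by rewrite e e' mulrnDr addrACA.
  move=> [mr [c [n [cc e]]]] [_ [c' [n' [cc' e']]]].
  have sum0 : c + c' + a *+ (n + n') = 0.
    by rewrite mulrnDr addrACA -e -e' subrr.
  have [nn|nn] := posnP (n + n').
    move/eqP: nn; rewrite addn_eq0 => /andP[/eqP n0 /eqP n'0].
    move: sum0 e; rewrite n0 n'0 !mulr0n !addr0 => cc0 e.
    by have := root_neq0 mr; rewrite e (positive_cone0 Pp cc cc' cc0) eqxx.
  apply: nex; exists (c + c'), (n + n')%N; split=> //; first exact: coneD.
  by apply/eqP; rewrite -addr_eq0 sum0.
have [c [n [cc n0 ec]]] := key l lr (fun lp => nl (or_introl lp)).
have [c' [n' [cc' n0' ec']]] := key (- l) (rootN lr) (fun lp => nl (or_intror lp)).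
have cn0 : c *+ n' = 0.
  apply: (positive_cone0 Pp (coneMn n' cc) (coneMn n cc')).
  by rewrite ec ec' !mulNrn opprK -!mulrnA [(n' * n)%N]mulnC addNr.
have : l *+ (n * n') = l *+ 0.
  by apply: oppr_inj; rewrite mulr0n oppr0 -cn0 ec mulNrn mulrnA.
rewrite !pmulrn => /(mulrz_inj (root_neq0 lr)) [] /eqP.
by rewrite muln_eq0 !gtn_eqF.
Qed.

End PositiveRoots.

(** * Simple roots *)

Section SimpleRoots.
Implicit Types (a l m : tdual) (S T D : set tdual).

Let pos_b : positive_set (pos_root b : set tdual).
Proof. exact pos_root_positive. Qed.

Lemma simple_pos a : simple a -> pos_root b a. Proof. by case. Qed.

Lemma pos_is_root l : pos_root b l -> lie_root l. Proof. by case. Qed.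

Lemma simple_is_root a : simple a -> lie_root a. Proof. by move/simple_pos/pos_is_root. Qed.

Lemma cone_simple_pos l : cone simple l -> lie_root l -> pos_root b l.
Proof.
move=> lS lr; have [//|lN] := pos_root_total lr.
have lP : cone (pos_root b : set tdual) l by apply: cone_trans lS => a /simple_pos; exact: cone_mem.
have := positive_cone0 pos_b lP (cone_mem lN) (subrr l).
by move=> l0; have := root_neq0 lr; rewrite l0 eqxx.
Qed.

Lemma pos_cone_simple l : pos_root b l -> cone simple l.
Proof. exact: (positive_cone_indecomposable pos_b). Qed.

Lemma cone_simple0 l m : cone simple l -> cone simple m -> l + m = 0 -> l = 0.
Proof.
have SP x : cone simple x -> cone (pos_root b : set tdual) x.
  by apply: cone_trans => a /simple_pos; exact: cone_mem.
move=> /SP lP /SP mP; exact: (positive_cone0 pos_b lP mP).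
Qed.

Lemma cone_real S l m : S `<=` rootset -> cone S l -> lie_root m ->
  form l m \is Num.real.
Proof.
move=> Sr [s sS ->] mr; rewrite form_suml big_seq; apply: rpred_sum => a /sS/Sr ar.
exact: (form_real mr ar).
Qed.

(** Otherwise [a - l] or [l - a] would be a positive root, and [a] or [l] would
    decompose. *)
Lemma simple_obtuse a l : simple a -> simple l -> a != l -> form a l <= 0.
Proof.
move=> aS lS al; have [ar lr] := (simple_is_root aS, simple_is_root lS).
have /real_leP/(_ (real0 _)) := form_real lr ar.
case=> // gt0; have [e|alr] := root_sub lr ar gt0.
  by rewrite e eqxx in al.
have [p|p] := pos_root_total alr.
  by case: aS => _; case; exists (a - l), l; rewrite subrK; split=> //; exact: simple_pos.
case: lS => lp; case; exists (- (a - l)), a; rewrite opprB subrK in p *; split=> //.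
exact: simple_pos.
Qed.

(** Cancelling common terms leaves two equal sums without common terms, whose
    product is nonpositive by [simple_obtuse] and is also a square. *)
Lemma simple_independent (s r : seq tdual) : {in s, forall a, simple a} -> {in r, forall a, simple a} ->
  \sum_(a <- s) a = \sum_(a <- r) a -> perm_eq s r.
Proof.
have [n] := ubnP (size s); elim: n s r => // n IH s r; rewrite ltnS => sn sS rS e.
have [/hasP[a ar aS]|/hasPn disj] := boolP (has (mem s) r).
  have ps := perm_to_rem aS; have pr := perm_to_rem ar.
  rewrite (perm_trans ps) // perm_sym (perm_trans pr) // perm_cons perm_sym.
  apply: IH => [|x /mem_rem/sS//|x /mem_rem/rS//|].
    by rewrite size_rem //; case: (s) aS sn.
  by apply: (addrI a); move: e; rewrite (big_rem a aS) (big_rem a ar).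
have sPos : {in s, forall a, pos_root b a} by move=> a /sS/simple_pos.
have rPos : {in r, forall a, pos_root b a} by move=> a /rS/simple_pos.
have s0 : \sum_(a <- s) a = 0.
  have sC : cone simple (\sum_(a <- s) a) by exists s.
  have sreal l : lie_root l -> form l (\sum_(a <- s) a) \is Num.real.
    move=> lr; rewrite (form_sym); apply: cone_real sC lr.
    exact: simple_is_root.
  apply: (form_eq0 sreal); apply: le_anti.
  rewrite (form_ge0 sreal) andbT {2}e form_suml big_seq.
  apply: sumr_le0 => a aS; rewrite form_sym form_suml big_seq.
  apply: sumr_le0 => l lr; apply: simple_obtuse; [exact: rS|exact: sS|].
  by apply: contraTneq aS => <-; exact: disj.
have -> := positive_sum_neq0 pos_b sPos s0.
have r0 : \sum_(a <- r) a = 0 by rewrite -e.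
by have -> := positive_sum_neq0 pos_b rPos r0.
Qed.

(** Any two expressions of [l] as a sum of simple roots have the same terms. *)
Lemma cone_support S l a : S `<=` simple -> cone S l -> simple a -> cone simple (l - a) -> S a.
Proof.
move=> SS [s sS el] aS [r rS e]; have pe : perm_eq s (a :: r).
  apply: simple_independent => [x /sS/SS//|x|]; first by rewrite inE => /predU1P[->|/rS].
  by rewrite big_cons -el -e addrC subrK.
by apply: sS; rewrite (perm_mem pe) mem_head.
Qed.

Lemma cone_combP S l : S `<=` rootset ->
  cone S l <-> exists c : tdual -> nat, l = \sum_(a \in S) a *+ c a.
Proof.
move=> Sr; split=> [[s sS ->]|[c ->]]; last first.
  rewrite big_root_list // big_seq; elim/big_rec: _ => [|a x aS IH]; first exact: cone0.
  by apply: coneD IH; apply/coneMn/cone_mem/mem_root_list.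
exists (fun a => count_mem a s); rewrite big_root_list //.
elim: s sS => [|m s IH] sS; first by rewrite big_nil big1.
rewrite big_cons IH => [|x xs]; last by apply: sS; rewrite inE xs orbT.
under [RHS]eq_bigr do rewrite /= mulrnDr.
rewrite big_split /=; congr (_ + _).
have mS : m \in root_list S by apply/mem_root_list => //; apply: sS; rewrite mem_head.
rewrite (bigD1_seq m) ?root_list_uniq //= eqxx mulr1n big1 ?addr0 // => i im.
by rewrite eq_sym (negPf im) mulr0n.
Qed.

Lemma root_coefE l : cone simple l -> l = \sum_(a \in simple) a *+ root_coef b l a.
Proof.
move=> /cone_combP[a /simple_is_root//|c e].
by have := @xgetPex _ (fun=> 0%N) [set c : tdual -> nat | l = \sum_(a \in simple) a *+ c a] (ex_intro _ c e).
Qed.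

(** Coefficients are only ever compared with zero; this turns such comparisons
    into statements about sums of simple roots. *)
Lemma root_coef_gt0 l a : cone simple l -> simple a ->
  (0 < root_coef b l a)%N <-> cone simple (l - a).
Proof.
move=> lS aS; have := root_coefE lS; set c := root_coef b l => el.
have Sr : simple `<=` rootset by exact: simple_is_root.
have aL : a \in root_list simple by apply/mem_root_list.
have lE : l = \sum_(a <- root_list simple) a *+ c a.
  by rewrite {1}el big_root_list.
split=> [c0|[r rS e]].
  rewrite lE (bigD1_seq a) ?root_list_uniq //= -(prednK c0) mulrS -addrA [X in cone _ X]addrC addKr.
  apply: coneD; first exact/coneMn/cone_mem.
  rewrite big_seq_cond; elim/big_rec: _ => [|m x /andP[mS _] IH]; first exact: cone0.
  by apply: coneD IH; apply/coneMn/cone_mem/mem_root_list.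
pose s := flatten [seq nseq (c m) m | m <- root_list simple].
have sE : l = \sum_(m <- s) m.
  rewrite lE /s; elim: (root_list _) => [|m q IH]; first by rewrite !big_nil.
  rewrite /= big_cat big_cons IH big_nseq; congr (_ + _).
  by elim: (c m) => [|k IHk]; rewrite ?mulr0n // mulrS IHk.
have pe : perm_eq s (a :: r).
  apply: simple_independent => [x /flattenP[q qL]|x|].
  - have [m mL ->] := mapP qL; rewrite mem_nseq => /andP[_ /eqP->].
    exact/mem_root_list.
  - by rewrite inE => /predU1P[->|/rS].
  - by rewrite big_cons -sE -e addrC subrK.
have : a \in s by rewrite (perm_mem pe) mem_head.
move=> /flattenP[q qL]; have [m mL ->] := mapP qL.
by rewrite mem_nseq => /andP[? /eqP->].
Qed.

End SimpleRoots.

(** * Subsystems and maximal roots *)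

Section Cascade.
Implicit Types (a l m x y : tdual) (S T D E : set tdual).

(** The invariant carried along the cascade. The last clause says that the simple
    roots contained in [D] form a basis of it, so that its highest root can be
    found by going up along simple roots. *)
Definition subsystem D := [/\ D `<=` rootset, forall l, D l -> D (- l),
  forall l m, D l -> D m -> lie_root (l + m) -> D (l + m)
  & forall l, D l -> pos_root b l -> cone (simple `&` D) l].

Lemma cone_subset S S' x : S `<=` S' -> cone S x -> cone S' x.
Proof. by move=> SS'; apply: cone_trans => y /SS'; exact: cone_mem. Qed.

Lemma cone_simpleI D x : cone (simple `&` D) x -> cone simple x.
Proof. by apply: cone_subset => y []. Qed.

Lemma highestP D l : highest b D l <->
  D l /\ forall m, D m -> cone (simple `&` D) (l - m).
Proof.
have Sr : simple `&` D `<=` rootset by move=> a [aS _]; exact: simple_is_root aS.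
split=> -[Dl H]; split=> // m /H.
  by move=> [c ->]; apply/cone_combP => //; exists c.
by move/cone_combP => /(_ Sr)[c e]; exists c.
Qed.

Lemma root_set_subsystem : subsystem rootset.
Proof.
split=> [l//|l|//|l _ /pos_cone_simple]; first exact: rootN.
by apply: cone_subset => a aS; split; [|exact: (simple_is_root aS)].
Qed.

Lemma form_root_real l m : lie_root l -> lie_root m -> form l m \is Num.real.
Proof. by move=> lr mr; exact: (form_real mr lr). Qed.

(** Maximal roots exist in every subsystem by finiteness, and have the
    properties of highest roots that do not require irreducibility. *)
Definition maximal D l := D l /\ forall m, D m -> cone simple (m - l) -> m = l.

Lemma maximal_pos D l : subsystem D -> maximal D l -> pos_root b l.
Proof.
move=> [Dr Dopp _ _] [Dl max]; have [//|lN] := pos_root_total (Dr _ Dl).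
have e : - l = l by apply: max; [exact: Dopp|apply: coneD; exact: pos_cone_simple].
by rewrite -e.
Qed.

Lemma maximal_add D l m : subsystem D -> maximal D l -> D m -> pos_root b m ->
  ~ lie_root (m + l).
Proof.
move=> [Dr _ Dadd _] [Dl max] Dm mp mlr; have Dml := Dadd _ _ Dm Dl mlr.
have : m + l = l by apply: max => //; rewrite addrK; exact: pos_cone_simple.
rewrite -[RHS]add0r => /addIr m0; have := root_neq0 (Dr _ Dm); by rewrite m0 eqxx.
Qed.

(** A negative product would make [m + l] a root above [l]. *)
Lemma maximal_dominant D l m : subsystem D -> maximal D l -> D m -> pos_root b m ->
  0 <= form m l.
Proof.
move=> Ds lM Dm mp; have [Dr _ _ _] := Ds; have [Dl _] := lM.
have /real_leP/(_ (form_root_real (Dr _ Dm) (Dr _ Dl))) := real0 F; case=> // lt0.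
have [e|mlr] := root_add (Dr _ Dl) (Dr _ Dm) lt0; last first.
  by case: (maximal_add Ds lM Dm mp mlr).
case: (pos_root_opp mp); suff -> : - m = l by exact: maximal_pos Ds lM.
by apply/eqP; rewrite eq_sym -addr_eq0 addrC e.
Qed.

(** If [x] were orthogonal to [l], reflecting [y] in [x] would give the root [x
    + l] above [l]. *)
Lemma maximal_summand D l x y : subsystem D -> maximal D l -> D x -> D y ->
  pos_root b x -> pos_root b y -> x + y = l -> 0 < form x l.
Proof.
move=> Ds lM Dx Dy xp yp e; have [Dr _ Dadd _] := Ds.
rewrite lt_def (maximal_dominant Ds lM Dx xp) andbT; apply/eqP => xl0.
apply: (maximal_add Ds lM Dx xp).
have [n [en nr]] := root_reflection (Dr _ Dx) (Dr _ Dy).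
have yx : form y x = - form x x.
  by apply/eqP; rewrite -addr_eq0 -formDl addrC e form_sym xl0.
have xx := form_self_gt0 (Dr _ Dx).
have n2 : n = - 2.
  move/eqP: en; rewrite yx -subr_eq0 mulrN -mulNr -mulrBl mulf_eq0 (gt_eqF xx) orbF.
  by rewrite -[2]/(2%:~R) -mulrNz -mulrzBr intr_eq0 subr_eq0 => /eqP<-.
by move: nr; rewrite n2 mulrNz opprK -[2]/(1 + 1) mulrzDr mulr1z addrA [y + x]addrC e addrC.
Qed.

Lemma highest_maximal D l : subsystem D -> highest b D l -> maximal D l.
Proof.
move=> [Dr _ _ _] /highestP[Dl H]; split=> // m Dm ml.
have lm := cone_simpleI (H m Dm); apply/eqP; rewrite -subr_eq0; apply/eqP.
by apply: (cone_simple0 ml lm); rewrite addrC subrKA subrr.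
Qed.

Lemma highest_unique D l l' : subsystem D -> highest b D l -> highest b D l' -> l = l'.
Proof.
move=> Ds lH /highestP[Dl' l'H]; have [_ max] := highest_maximal Ds lH.
by have /highestP[Dl _] := lH; rewrite (max l') //; exact: cone_simpleI (l'H l Dl).
Qed.

Lemma highest_ge D l m : highest b D l -> D m -> cone simple (l - m).
Proof. by move=> /highestP[_ H] /H/cone_simpleI. Qed.

(** Since simple roots of [D] have nonnegative products with [l], those
    occurring in a root orthogonal to [l] are orthogonal to [l] too. *)
Lemma orthogonal_subsystem D l : subsystem D -> maximal D l ->
  subsystem [set m | D m /\ form m l = 0].
Proof.
move=> Ds lM; have [Dr Dopp Dadd Dbase] := Ds; split.
- by move=> m [/Dr].
- by move=> m [Dm ml]; split; [exact: Dopp|rewrite formNl ml oppr0].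
- by move=> m m' [Dm ml] [Dm' ml'] mr; split; [exact: Dadd|rewrite formDl ml ml' addr0].
move=> m [Dm ml] mp; have [s sS em] := Dbase m Dm mp; exists s => // a aS.
have [aSimple Da] := sS a aS; split=> //; split=> //.
have ge0 x : x \in s -> 0 <= form x l.
  by move=> /sS[xS Dx]; exact: maximal_dominant Ds lM Dx (simple_pos xS).
move/eqP: ml; rewrite em form_suml big_seq psumr_eq0 // => /allP/(_ a aS).
by rewrite aS => /eqP.
Qed.

(** In a positive root of the component, the simple terms outside the component
    add up to a vector orthogonal to itself. *)
Lemma component_subsystem D E : subsystem E -> irreducible_component E D -> subsystem D.
Proof.
move=> [Er Eopp Eadd Ebase] [DE _ orth].
have inD m x : D m -> E x -> form m x != 0 -> D x.
  by move=> Dm Ex mx; apply: contrapT => nD; move/eqP: mx; apply; apply: orth.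
have Dr : D `<=` rootset by move=> x /DE/Er.
split=> // [l Dl|l m Dl Dm lmr|l Dl lp].
- apply: (inD l) => //; first exact/Eopp/DE.
  by rewrite formNr oppr_eq0 gt_eqF // form_self_gt0 //; exact: Dr.
- have Elm := Eadd _ _ (DE _ Dl) (DE _ Dm) lmr.
  apply: contrapT => nD; have no : (E `\` D) (l + m) by [].
  have := form_self_gt0 (Er _ Elm); rewrite {1}formDl (orth _ _ Dl no) (orth _ _ Dm no).
  by rewrite addr0 ltxx.
have [s sS el] := Ebase l (DE _ Dl) lp.
pose r := [seq a <- s | ~~ `[< D a >]].
have rS : {in r, forall a, simple a /\ (E `\` D) a}.
  by move=> a; rewrite mem_filter => /andP[/asboolPn nD /sS[aS Ea]].
pose x := \sum_(a <- r) a.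
have xS : cone simple x by exists r => // a /rS[].
have el' : l = \sum_(a <- s | `[< D a >]) a + x.
  by rewrite el (bigID (fun a => `[< D a >])) /= /x big_filter.
have xl : form l x = 0.
  by rewrite form_sym form_suml big_seq big1 // => a /rS[_ aE]; rewrite form_sym; exact: orth.
have x1 : form (\sum_(a <- s | `[< D a >]) a) x = 0.
  rewrite form_suml big1 // => a /asboolP Da; rewrite form_sym form_suml big_seq big1 //.
  by move=> m /rS[_ mE]; rewrite form_sym; exact: orth.
have xx : form x x = 0 by move: xl; rewrite {1}el' formDl x1 add0r.
have x0 : x = 0.
  apply: (form_eq0 _ xx) => m mr; rewrite form_sym.
  by apply: (cone_real _ xS mr) => a aS; exact: (simple_is_root aS).
have rp : {in r, forall a, pos_root b a} by move=> a /rS[aS _]; exact: simple_pos.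
have r0 := positive_sum_neq0 pos_root_positive rp x0.
exists s => // a aS; have [aSimple _] := sS a aS; split=> //.
apply: contrapT => /asboolPn nD; have : a \in r by rewrite mem_filter nD.
by rewrite r0.
Qed.

End Cascade.

(** * Highest roots and irreducible components *)

Section Highest.
Implicit Types (a l m x y : tdual) (S T D E : set tdual).

Lemma above_maximal D m : subsystem D -> D m ->
  exists2 l, maximal D l & cone simple (l - m).
Proof.
move=> Ds; have [Dr _ _ _] := Ds; pose up x := root_list [set y | D y /\ cone simple (y - x)].
have upP x y : (y \in up x) <-> D y /\ cone simple (y - x).
  by apply: mem_root_list => z [/Dr].
have [n] := ubnP (size (up m)); elim: n m => // n IH m; rewrite ltnS => un Dm.
have [mM|] := EM (maximal D m).
  by exists m; rewrite ?subrr //; exact: cone0.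
move=> nM; have [m' [Dm' mm' ne]] : exists m', [/\ D m', cone simple (m' - m) & m' <> m].
  apply: contrapT => nex; apply: nM; split=> // m' Dm' mm'.
  by apply: contrapT => ne; apply: nex; exists m'.
have [||l lM lm'] := IH m' => //; last first.
  by exists l => //; rewrite -(subrKA m'); exact: coneD.
apply: leq_trans un; have mu : m \in up m by apply/upP; rewrite subrr; split=> //; exact: cone0.
rewrite (perm_size (perm_to_rem mu)) /= ltnS; apply: uniq_leq_size (root_list_uniq _) _ => x.
move=> /upP[Dx xm']; rewrite mem_rem_uniq ?root_list_uniq // inE; apply/andP; split; last first.
  by apply/upP; split=> //; rewrite -(subrKA m'); exact: coneD.
apply/eqP => xm; apply: ne; apply/eqP; rewrite -subr_eq0; apply/eqP.
by apply: (cone_simple0 mm' (_ : cone simple (m - m'))); rewrite -?xm // addrC subrKA subrr.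
Qed.

(** Writing [x = y + a] with [a] simple, it suffices that [a] belongs to the
    same part as [y]; otherwise [a] is orthogonal to [y], and the reflection [y
    - a] of [x] in [a] would have coefficients of both signs. *)
Lemma cone_split S S' D : subsystem D ->
  simple `&` D `<=` S `|` S' -> S `<=` simple -> S' `<=` simple -> S `&` S' = set0 ->
  orthogonal_sets S S' ->
  forall x, D x -> pos_root b x -> cone S x \/ cone S' x.
Proof.
move=> Ds SD SS SS' disj orth x Dx xp; have [Dr Dopp Dadd Dbase] := Ds.
have nin S1 S2 y a : S1 `<=` simple -> S2 `<=` simple -> S1 `&` S2 = set0 ->
    orthogonal_sets S1 S2 -> cone S1 y -> S2 a -> D y -> lie_root (y + a) -> False.
  move=> S1s S2s dj o yS aS Dy yar; have ya : form y a = 0.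
    by have [q qS ->] := yS; rewrite form_suml big_seq big1 // => z /qS zS; exact: o.
  have ar : lie_root a := simple_is_root (S2s _ aS).
  have [n [en nr]] := root_reflection ar yar.
  have n2 : n = 2.
    move/eqP: en; rewrite formDl ya add0r -subr_eq0 -mulrBl mulf_eq0 (gt_eqF (form_self_gt0 ar)) orbF.
    by rewrite -[2]/(2%:~R) -mulrzBr intr_eq0 subr_eq0 => /eqP<-.
  move: nr; rewrite n2 -[2]/(1 + 1) mulrzDr mulr1z opprD addrA addrK => nr.
  have S12 : S1 a -> False by move=> aS1; have : (S1 `&` S2) a by []; rewrite dj.
  have [p|p] := pos_root_total nr.
    by apply/S12/(cone_support S1s yS (S2s _ aS) (pos_cone_simple p)).
  have [[|z q] qS ey] := yS.
    by have := root_neq0 (Dr _ Dy); rewrite ey big_nil eqxx.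
  have zS : S1 z by apply: qS; rewrite mem_head.
  apply: S12; suff -> : a = z by [].
  have : [set a] z; last by move=> ->.
  apply: (cone_support (S := [set a]) (l := a)); last 2 first.
  - exact: S1s.
  - rewrite (_ : a - z = (a - y) + (y - z)); last by rewrite subrKA.
    apply: coneD; first by rewrite -opprB; exact: pos_cone_simple.
    rewrite ey big_cons addrC addKr; exists q => // w wq; apply/S1s/qS.
    by rewrite inE wq orbT.
  - by move=> _ ->; exact: S2s.
  - exact: cone_mem.
have [s sS ex] := Dbase x Dx xp.
have [n] := ubnP (size s); elim: n s x Dx xp sS ex => // n IH s x Dx xp sS ex sn.
have [a aS ax] : exists2 a, a \in s & 0 < form a x.
  apply: contrapT => nex; have := form_self_gt0 (Dr _ Dx); rewrite {1}ex form_suml big_seq.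
  suff H : \sum_(i <- s | i \in s) form i x <= 0 by move/lt_le_trans/(_ H); rewrite ltxx.
  apply: sumr_le0 => a aS; have [aSimple _] := sS a aS.
  have /real_leP/(_ (real0 _)) := form_root_real (simple_is_root aSimple) (Dr _ Dx).
  by case=> // gt0; case: nex; exists a.
have [aSimple Da] := sS a aS.
have aSS : S a \/ S' a by exact: SD.
have xa : 0 < form x a by rewrite form_sym.
have [e|axr] := root_sub (simple_is_root aSimple) (Dr _ Dx) xa.
  by case: aSS => aS'; [left|right]; rewrite e; exact: cone_mem.
have Dxa : D (x - a) by apply: Dadd => //; exact: Dopp.
have exa : x - a = \sum_(m <- rem a s) m by rewrite ex (big_rem a aS) /= addrAC subrr add0r.
have rS : {in rem a s, forall m, (simple `&` D) m} by move=> m /mem_rem/sS.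
have xap : pos_root b (x - a).
  by apply: cone_simple_pos axr; exists (rem a s) => // m /rS[].
have xE : x = (x - a) + a by rewrite subrK.
have disj' : S' `&` S = set0 by rewrite setIC.
have orth' : orthogonal_sets S' S by move=> y z S'y Sz; rewrite form_sym; exact: orth.
have xr : lie_root (x - a + a) by rewrite subrK; exact: Dr.
have [|xaS|xaS] := IH (rem a s) (x - a) Dxa xap rS exa.
- by rewrite size_rem //; move: sn aS; case: (s) => //= z q; rewrite ltnS.
- case: aSS => aS'; first by left; rewrite xE; apply: coneD xaS _; exact: cone_mem.
  by case: (nin S S' (x - a) a SS SS' disj orth xaS aS' Dxa xr).
- case: aSS => aS'; last by right; rewrite xE; apply: coneD xaS _; exact: cone_mem.
  by case: (nin S' S (x - a) a SS' SS disj' orth' xaS aS' Dxa xr).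
Qed.

Lemma form_root_list_gt0 (s : seq tdual) l : {in s, forall a, 0 <= form a l} ->
  0 < form (\sum_(a <- s) a) l -> exists2 a, a \in s & 0 < form a l.
Proof.
move=> ge0; rewrite form_suml => gt0; apply: contrapT => nex; move: gt0; rewrite big_seq big1 ?ltxx //.
move=> a aS; apply/eqP; apply: contraT => a0; case: nex; exists a => //.
by rewrite lt_def a0 ge0.
Qed.

(** The simple roots that do not occur in [l] are orthogonal to those that do,
    so that [cone_split] would decompose [D]. *)
Lemma maximal_support D l a : subsystem D -> irreducible_set D ->
  maximal D l -> (simple `&` D) a -> cone simple (l - a).
Proof.
move=> Ds [_ irr] lM [aS Da]; have [Dr Dopp Dadd Dbase] := Ds; have [Dl _] := lM.
have lp := maximal_pos Ds lM.
have [s sS el] := Dbase l Dl lp.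
pose S := [set m | (simple `&` D) m /\ m \in s].
pose S' := [set m | (simple `&` D) m /\ m \notin s].
have ls m : m \in s -> cone simple (l - m).
  move=> ms; exists (rem m s); first by move=> y /mem_rem/sS[].
  by rewrite el (big_rem m ms) /= addrAC subrr add0r.
have [aIn|aNs] := boolP (a \in s); first exact: ls.
have ge0 m : (simple `&` D) m -> 0 <= form m l.
  by move=> [mS Dm]; exact: maximal_dominant Ds lM Dm (simple_pos mS).
have orth : orthogonal_sets S' S.
  move=> y z [yD ys] [zD zs]; have [[yS _] [zS _]] := (yD, zD).
  have le0 m : m \in s -> form m y <= 0.
    move=> ms; have [mS _] := sS m ms.
    apply: simple_obtuse => //.
    by apply: contraNneq ys => <-.
  have : form l y = 0.
    apply: le_anti; rewrite {2}form_sym ge0 // andbT el form_suml big_seq.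
    exact: sumr_le0.
  rewrite el form_suml (big_rem z zs) /= => /eqP.
  rewrite naddr_eq0 ?le0 //; first by move=> /andP[/eqP zy _]; rewrite form_sym.
  by rewrite big_seq; apply: sumr_le0 => m /mem_rem/le0.
have split x : D x -> pos_root b x -> cone S x \/ cone S' x.
  apply: cone_split => //.
  - by move=> m mD; have [ms|ms] := boolP (m \in s); [left|right].
  - by move=> m [[]].
  - by move=> m [[]].
  - by apply/seteqP; split=> // m [[_ ms] [_ /negP]].
  - by move=> y z Sy S'z; rewrite form_sym; exact: orth.
pose A := [set x | D x /\ (cone S x \/ cone S (- x))].
pose B := [set x | D x /\ (cone S' x \/ cone S' (- x))].
have coneo x y : cone S x -> cone S' y -> form x y = 0.
  move=> [q qS ->] [r rS ->]; rewrite form_suml big_seq big1 // => m /qS mS.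
  rewrite form_sym form_suml big_seq big1 // => m' /rS m'S; exact: orth.
have [|||//] := irr A B.
- apply/seteqP; split=> [x Dx|x [[]|[]]//].
  have [/(split x Dx)[]|xN] := pos_root_total (Dr _ Dx); [by left; split=> //; left|by right; split=> //; left|].
  by have [] := split (- x) (Dopp _ Dx) xN; [left|right]; split=> //; right.
- move=> x y [_ [xS|xS]] [_ [yS|yS]].
  + exact: coneo.
  + by apply: oppr_inj; rewrite -formNr oppr0 coneo.
  + by apply: oppr_inj; rewrite -formNl oppr0 coneo.
  + by have := coneo _ _ xS yS; rewrite formNl formNr opprK.
- move=> A0; have : A l; last by rewrite A0.
  by split=> //; left; exists s => // m ms; split=> //; exact: sS.
- move=> B0; have : B a; last by rewrite B0.
  by split=> //; left; apply: cone_mem.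
Qed.

(** By [maximal_support] two maximal roots have a positive product, so their
    difference would be a root if they were distinct. The only maximal root
    dominates all others by [above_maximal]. *)
Lemma highest_exists D : subsystem D -> irreducible_set D ->
  exists l, highest b D l.
Proof.
move=> Ds irr; have [Dr Dopp Dadd Dbase] := Ds; have [[x0 Dx0] _] := irr.
have [l lM _] := above_maximal Ds Dx0; have [Dl _] := lM; have lp := maximal_pos Ds lM.
have unique l' : maximal D l' -> l' = l.
  move=> l'M; have [Dl' max'] := l'M; have [_ max] := lM.
  have [s sS el'] := Dbase l' Dl' (maximal_pos Ds l'M).
  have ge0 m : (simple `&` D) m -> 0 <= form m l'.
    by move=> [mS Dm]; exact: maximal_dominant Ds l'M Dm (simple_pos mS).
  have [m ms mgt0] : exists2 m, m \in s & 0 < form m l'.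
    by apply: form_root_list_gt0 => [m /sS/ge0//|]; rewrite -el' form_self_gt0 //; exact: Dr.
  have [r rS er] := Dbase l Dl lp.
  have mr : m \in r.
    have : [set` r] m; last by [].
    apply: (cone_support (S := [set` r]) (l := l)).
    - by move=> y /rS[].
    - by exists r.
    - by have [] := sS m ms.
    - exact: maximal_support (sS m ms).
  have gt0 : 0 < form l l'.
    rewrite er form_suml (big_rem m mr) /= ltr_pwDl // big_seq sumr_ge0 // => y /mem_rem/rS.
    exact: ge0.
  have [//|ll'] := root_sub (Dr _ Dl') (Dr _ Dl) gt0.
  have [/pos_cone_simple p|/pos_cone_simple] := pos_root_total ll'; first by rewrite (max' l).
  by rewrite opprB => p; rewrite -(max l').
exists l; apply/highestP => //; split=> // m Dm.
have [mp|mN] := pos_root_total (Dr _ Dm); last by apply: coneD; apply: Dbase => //; exact: Dopp.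
have [l' /unique -> [r rS e]] := above_maximal Ds Dm.
exists r => // y yr; have yS := rS y yr; split=> //.
suff [] : (simple `&` D) y by [].
apply: (cone_support (S := simple `&` D) (l := l)) => //.
- exact: Dbase.
- rewrite (_ : l - y = (l - m - y) + m); last by rewrite addrAC addrNK.
  apply: coneD; last exact: pos_cone_simple.
  exists (rem y r); first by move=> z /mem_rem/rS.
  by rewrite e (big_rem y yr) /= addrAC subrr add0r.
Qed.

(** The component is a smallest part of [E] containing [m] and orthogonal to
    the rest of [E]. *)
Lemma component_exists E m : E `<=` rootset -> E m ->
  exists2 D, irreducible_component E D & D m.
Proof.
move=> Er Em; pose Q n := `[< exists D, [/\ D `<=` E, D m, orthogonal_sets D (E `\` D)
  & size (root_list D) = n] >].
have Q0 : exists n, Q n.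
  by exists (size (root_list E)); apply/asboolP; exists E; split=> // l l' _ [].
case: (ex_minnP Q0) => n /asboolP[D [DE Dm orth Dn]] min; exists D => //; split=> //.
have Dr : D `<=` rootset by move=> x /DE/Er.
have half A B : D = A `|` B -> orthogonal_sets A B -> A m -> B = set0.
  move=> DAB AB Am; have AD : A `<=` D by rewrite DAB; left.
  have BD : B `<=` D by rewrite DAB; right.
  have le : (n <= size (root_list A))%N.
    apply: min; apply/asboolP; exists A; split=> //; first by move=> x /AD/DE.
    move=> x y Ax [Ey nAy]; have [Dy|nDy] := EM (D y); last exact: orth (AD _ Ax) _.
    by apply: AB => //; move: Dy; rewrite DAB => -[].
  have sub : {subset root_list A <= root_list D}.
    move=> x /mem_root_list xA; apply/mem_root_list => //; apply/AD/xA.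
    by move=> y /AD/Dr.
  have DA x : D x -> A x.
    have [|_ e] := uniq_min_size (root_list_uniq A) sub; first by rewrite Dn.
    move=> Dx; have : x \in root_list A by rewrite e; apply/mem_root_list.
    by move/mem_root_list; apply=> y /AD/Dr.
  apply/seteqP; split=> // x Bx; have Ax := DA x (BD _ Bx).
  by have := form_self_gt0 (Dr _ (BD _ Bx)); rewrite (AB x x Ax Bx) ltxx.
split; first by exists m.
move=> A B DAB AB; have : (A `|` B) m by rewrite -DAB.
case=> [Am|Bm]; first by right; exact: half DAB AB Am.
left; apply: (half B A) => //; first by rewrite setUC.
by move=> x y Bx Ay; rewrite form_sym; exact: AB.
Qed.

End Highest.

(** * The Kostant cascade *)

Section KostantCascade.
Implicit Types (a l m x y : tdual) (S T D E : set tdual).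

Local Notation cascade_at := (cascade_at b).

Lemma cascade_at_props D l : cascade_at D l ->
  [/\ subsystem D, highest b D l, irreducible_set D & D l].
Proof.
elim=> [th thH|{}D {}l D' l' Dl [Ds lH _ _] comp l'H].
  split=> //; first exact: root_set_subsystem.
    exact: lie_root_irreducible.
  by case: thH.
have Es := orthogonal_subsystem Ds (highest_maximal Ds lH).
split=> //; last by case: l'H.
- exact: (component_subsystem Es comp).
- by case: comp.
Qed.

Lemma cascade_root_pos D l : cascade_at D l -> pos_root b l.
Proof.
by move=> /cascade_at_props[Ds lH _ _]; exact: maximal_pos Ds (highest_maximal Ds lH).
Qed.

Definition perp D l : set tdual := [set m | D m /\ form m l = 0].

(** The part of [D'] inside [D] is orthogonal to the part outside. *)
Lemma component_sub_or_disjoint E D D' : irreducible_component E D -> D' `<=` E ->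
  irreducible_set D' -> D' `<=` D \/ D `&` D' = set0.
Proof.
move=> [DE _ orth] D'E [_ irr].
have [|||] := irr (D' `&` D) (D' `\` D).
- apply/seteqP; split=> [x D'x|x [[]|[]]//]; have [Dx|nDx] := EM (D x); [by left|by right].
- by move=> x y [_ Dx] [/D'E Ey nDy]; exact: orth.
- by move=> e; right; rewrite setIC.
- by move=> e; left=> x D'x; apply: contrapT => nDx; have : (D' `\` D) x by []; rewrite e.
Qed.

Lemma cascade_root D l m : cascade_at D l -> D m -> lie_root m.
Proof. by move=> /cascade_at_props[[Dr _ _ _] _ _ _] /Dr. Qed.

Lemma cascade_trichotomy_top th D l : highest b rootset th -> cascade_at D l ->
  (D = rootset /\ l = th) \/ D `<=` perp rootset th.
Proof.
move=> thH; elim=> [th' th'H|{}D {}l D1 l1 Dl IH [D1E _ _] _].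
  left; split=> //; exact: (highest_unique root_set_subsystem th'H thH).
by right; case: IH => [[<- <-] x /D1E//|sub x /D1E[/sub]].
Qed.

(** Induction on both derivations, with [component_sub_or_disjoint] when one of
    the two subsystems lies in the orthogonal from which the other is taken. *)
Lemma cascade_trichotomy D l D' l' : cascade_at D l -> cascade_at D' l' ->
  [\/ D = D' /\ l = l', D' `<=` perp D l, D `<=` perp D' l' | D `&` D' = set0].
Proof.
move=> Dl; elim: Dl D' l' => [th thH|{}D {}l D1 l1 Dl IH comp l1H] D' l' D'l'.
  by have [[-> ->]|sub] := cascade_trichotomy_top thH D'l'; [constructor 1|constructor 2].
have D1l1 := cascade_descendant Dl comp l1H; have [D1E _ _] := comp.
elim: D'l' => [th thH|{}D' {}l' D2 l2 D'l' IH' comp' l2H].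
  have [[e1 e2]|sub] := cascade_trichotomy_top thH D1l1; last by constructor 3.
  by constructor 1.
have D2l2 := cascade_descendant D'l' comp' l2H; have [D2E _ _] := comp'.
have [[e1 e2]|sub|sub|dj] := IH _ _ D2l2.
- by constructor 3; rewrite -e1 -e2.
- have [_ _ irr2 D2l] := cascade_at_props D2l2.
  have [D21|dj] := component_sub_or_disjoint comp sub irr2; last by constructor 4.
  case: IH' => [[e1 e2]|sub'|sub'|dj].
  + by constructor 2; rewrite e1 e2.
  + by constructor 2 => x /D2E[/sub'].
  + have [s1 _ irr1 _] := cascade_at_props D1l1.
    have [D12|dj] := component_sub_or_disjoint comp' sub' irr1; last first.
      by have : (D2 `&` D1) l2 by [split=> //; exact: D21]; rewrite dj.
    have e : D1 = D2 by apply/seteqP.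
    constructor 1; split=> //.
    by apply: (highest_unique s1 l1H); rewrite e.
  + constructor 4; apply/seteqP; split=> // x [D1x /D2E[D'x _]].
    by rewrite -dj.
- by constructor 3 => x /D1E[/sub].
- constructor 4; apply/seteqP; split=> // x [/D1E[Dx _] D2x].
  by rewrite -dj.
Qed.

Lemma cascade_unique D l D' l' m : cascade_at D l -> cascade_at D' l' ->
  D m -> D' m -> form m l != 0 -> form m l' != 0 -> D = D' /\ l = l'.
Proof.
move=> Dl D'l' Dm D'm ml ml'; case: (cascade_trichotomy Dl D'l') => // [sub|sub|dj].
- by have [_ e] := sub m D'm; rewrite e eqxx in ml.
- by have [_ e] := sub m Dm; rewrite e eqxx in ml'.
- by have : (D `&` D') m by []; rewrite dj.
Qed.

(** Starting from all roots, pass to the component of [m] as long as [m] is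
    orthogonal to the current cascade root. *)
Lemma cascade_cover m : pos_root b m -> exists l, heisenberg_set b l m.
Proof.
move=> mp; have mr := pos_is_root mp.
have [th thH] := highest_exists
  root_set_subsystem lie_root_irreducible.
have : rootset m := mr.
move: (rootset) {thH}(cascade_top thH) => D; have [n] := ubnP (size (root_list D)).
elim: n D th => // n IH D l; rewrite ltnS => Dn Dl Dm.
have [Ds lH _ lD] := cascade_at_props Dl; have [Dr _ _ _] := Ds.
have [ml|ml] := eqVneq (form m l) 0; last first.
  exists l, D; split=> //; rewrite lt_def ml; exact: maximal_dominant Ds (highest_maximal Ds lH) Dm mp.
have Es := orthogonal_subsystem Ds (highest_maximal Ds lH).
have [Er _ _ _] := Es.
have [D' comp D'm] := component_exists Er (conj Dm ml).
have Ds' := component_subsystem Es comp.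
have [D'E irr _] := comp.
have [l' l'H] := highest_exists Ds' irr.
apply: (IH D' l') => //; last exact: cascade_descendant Dl comp l'H.
apply: leq_trans Dn; have lD' : l \in root_list D by apply/mem_root_list.
rewrite (perm_size (perm_to_rem lD')) /= ltnS; apply: uniq_leq_size (root_list_uniq _) _ => x.
move=> /mem_root_list D'x; have {}D'x : D' x by apply: D'x => y /D'E[/Dr].
have [Dx xl] := D'E _ D'x; rewrite mem_rem_uniq ?root_list_uniq // inE; apply/andP; split.
  by apply/eqP => xE; have := form_self_gt0 (Dr _ lD); rewrite -{1}xE xl ltxx.
by apply/mem_root_list.
Qed.

(** Dominance makes both summands of a root orthogonal to a cascade root
    orthogonal to it as well. They then stay in the component of their sum,
    because a root outside is orthogonal to that component. *)
Lemma cascade_summand D l m x y : cascade_at D l -> D m ->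
  pos_root b x -> pos_root b y -> x + y = m -> D x /\ D y.
Proof.
move=> Dl Dm xp yp e; elim: Dl Dm => [th thH _|{}D {}l D' l' Dl IH comp l'H D'm].
  by split; [exact: (pos_is_root xp)|exact: (pos_is_root yp)].
have [D'E _ orth] := comp; have [Dm ml] := D'E _ D'm; have [Dx Dy] := IH Dm.
have [Ds lH _ _] := cascade_at_props Dl; have lM := highest_maximal Ds lH.
have xl0 := maximal_dominant Ds lM Dx xp; have yl0 := maximal_dominant Ds lM Dy yp.
have /andP[/eqP xl /eqP yl] : (form x l == 0) && (form y l == 0).
  by rewrite -paddr_eq0 // -formDl e ml.
have mm := form_self_gt0 (cascade_root Dl Dm).
have ortho z : D z -> form z l = 0 -> ~ D' z -> form m z = 0.
  by move=> Dz zl nz; apply: orth => //; split.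
have aux z w : D z -> D w -> form z l = 0 -> form w l = 0 -> z + w = m -> D' z -> D' w.
  move=> Dz Dw zl wl zw D'z; apply: contrapT => nw.
  have := form_self_gt0 (cascade_root Dl Dw); rewrite -{1}(addKr z w) zw formDl formNl.
  have nE : ([set u | D u /\ form u l = 0] `\` D') w by split.
  by rewrite (orth _ _ D'z nE) (orth _ _ D'm nE) oppr0 addr0 ltxx.
have [D'x|nx] := EM (D' x); first by split=> //; exact: aux e D'x.
have [D'y|ny] := EM (D' y); first by case: nx; apply: (aux y x) => //; rewrite addrC.
by move: mm; rewrite -{2}e formDr (ortho x) // (ortho y) // addr0 ltxx.
Qed.

(** This is why the skew form of the main argument pairs roots only inside a
    single Heisenberg set. *)
Lemma cascade_sum_heisenberg l x y : cascade b l -> pos_root b x -> pos_root b y ->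
  x + y = l -> heisenberg_set b l x.
Proof.
move=> [D Dl] xp yp e; have [Ds lH _ Dll] := cascade_at_props Dl.
have [Dx Dy] := cascade_summand Dl Dll xp yp e.
exists D; split=> //; exact: maximal_summand Ds (highest_maximal Ds lH) Dx Dy xp yp e.
Qed.

Lemma heisenberg_unique l l' m : heisenberg_set b l m -> heisenberg_set b l' m -> l = l'.
Proof.
move=> [D [Dl Dm mp ml]] [D' [D'l' D'm _ ml']].
by have [] := cascade_unique Dl D'l' Dm D'm; rewrite ?gt_eqF.
Qed.

Lemma cascade_heisenberg l : cascade b l -> heisenberg_set b l l.
Proof.
move=> [D Dl]; have [_ _ _ lD] := cascade_at_props Dl; exists D; split=> //.
  exact: cascade_root_pos Dl.
exact/form_self_gt0/(cascade_root Dl).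
Qed.

Lemma heisenberg_partner l m : heisenberg_set b l m -> m <> l -> heisenberg_set b l (l - m).
Proof.
move=> [D [Dl Dm mp ml]] ne; have [Ds lH _ lD] := cascade_at_props Dl.
have [Dr Dopp Dadd _] := Ds.
have lm : 0 < form l m by rewrite form_sym.
have [e|lmr] := root_sub (Dr _ Dm) (Dr _ lD) lm; first by case: ne.
have lmp := cone_simple_pos (highest_ge lH Dm) lmr.
apply: (cascade_sum_heisenberg (y := m)) => //; [by exists D|by rewrite subrK].
Qed.

Lemma heisenberg_pos l m : heisenberg_set b l m -> pos_root b m.
Proof. by case=> D []. Qed.

Lemma cascade_pos l : cascade b l -> pos_root b l.
Proof. by move=> [D]; exact: cascade_root_pos. Qed.

(** If the difference of the two roots were a root, one of them would belong to
    the Heisenberg set of the other. If their sum were a root, it would pair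
    positively with one of the two and lie above it in its own subsystem. *)
Lemma cascade_orthogonal l l' : cascade b l -> cascade b l' -> l != l' -> form l l' = 0.
Proof.
move=> lK l'K ne; have [lp l'p] := (cascade_pos lK, cascade_pos l'K).
have [lr l'r] := (pos_is_root lp, pos_is_root l'p).
have above x y z : cascade b x -> cascade b y -> pos_root b z -> x = y + z -> x = y.
  move=> xK yK zp e; apply: (heisenberg_unique (m := y)); last exact: cascade_heisenberg.
  by apply: (cascade_sum_heisenberg (y := z)) => //; exact: cascade_pos.
have noadd x y : cascade b x -> cascade b y -> lie_root (x + y) ->
    heisenberg_set b x (x + y) -> False.
  move=> xK yK xyr [D [Dx Dxy _ _]]; have [Ds lH _ xD] := cascade_at_props Dx.
  have yp := cascade_pos yK; have := highest_ge lH Dxy; rewrite opprD addrA subrr add0r => Ny.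
  by have := root_neq0 (pos_is_root yp); rewrite (cone_simple0 (pos_cone_simple yp) Ny (subrr y)) eqxx.
have /real_ltgtP/(_ (real0 _)) := form_root_real l'r lr; rewrite form_sym; case=> // [lt0|gt0].
  have [e|sr] := root_add l'r lr lt0.
    have Nl : - l = l' by apply/eqP; rewrite eq_sym -addr_eq0 addrC e.
    by case: (pos_root_opp lp); rewrite Nl.
  have sp : pos_root b (l + l') by apply: cone_simple_pos sr; apply: coneD; exact: pos_cone_simple.
  have [x xs] := cascade_cover sp; have [D [Dx Ds _ sx]] := xs.
  have [Dl Dl'] := cascade_summand Dx Ds lp l'p erefl.
  have [sD xH _ _] := cascade_at_props Dx; have xM := highest_maximal sD xH.
  have l0 := maximal_dominant sD xM Dl lp; have l'0 := maximal_dominant sD xM Dl' l'p.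
  move: sx; rewrite formDl; have [lx0|lx0] := eqVneq (form l x) 0.
    rewrite lx0 add0r => sx; have e : x = l'.
      by apply: (heisenberg_unique (m := l')); [exists D|exact: cascade_heisenberg].
    by case: (noadd l' l l'K lK); rewrite addrC // -{1}e.
  move=> _; have e : x = l.
    apply: (heisenberg_unique (m := l)); last exact: cascade_heisenberg.
    by exists D; split=> //; rewrite lt_def lx0.
  by case: (noadd l l' lK l'K sr); rewrite -{1}e.
have [e|dr] := root_sub l'r lr gt0; first by rewrite e eqxx in ne.
have [dp|dp] := pos_root_total dr.
  by move: ne; rewrite (above l l' (l - l') lK l'K dp) ?eqxx // addrC subrK.
by move: ne; rewrite (above l' l (- (l - l')) l'K lK dp) ?eqxx // opprB addrC subrK.
Qed.

End KostantCascade.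

(** * The Frobenius envelope *)

Section Envelope.
Implicit Types (a l m x y : tdual) (S T D E : set tdual).

Local Notation cascade_at := (cascade_at b).

Lemma nil_rootsP T l : T `<=` simple -> nil_roots b T l <->
  pos_root b l /\ exists2 a, T a & cone simple (l - a).
Proof.
move=> TS; split=> -[lp [a Ta al]]; split=> //; exists a => //.
  by apply/(root_coef_gt0 (pos_cone_simple lp) (TS _ Ta)).
by apply/(root_coef_gt0 (pos_cone_simple lp) (TS _ Ta)).
Qed.

Lemma nil_roots_positive T : T `<=` simple -> positive_set (nil_roots b T).
Proof.
move=> TS; split=> [l [/pos_is_root//]|l m /(nil_rootsP _ TS)[lp [a Ta al]] [mp _] lmr|l [lp _] [/(pos_root_opp lp)//]].
apply/(nil_rootsP _ TS); split; first exact: (pos_root_add lp mp lmr).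
by exists a => //; rewrite addrAC; apply: coneD al _; exact: pos_cone_simple.
Qed.

Section Optimal.
Context (T : set tdual) (TS : T `<=` simple).
Local Notation K := (nil_cascade b T).
Local Notation N := (nil_roots b (optimal_set b T)).

Lemma optimal_simple : optimal_set b T `<=` simple.
Proof. by move=> a [l _ []]. Qed.

(** The positive product of [m] with [l] comes from a simple root occurring in
    [m], and this simple root belongs to the optimal set. *)
Lemma heisenberg_optimal l m : K l -> heisenberg_set b l m -> N m.
Proof.
move=> lK lm; have [D [Dl Dm mp ml]] := lm; have [Ds lH _ _] := cascade_at_props Dl.
apply/(nil_rootsP _ optimal_simple); split=> //.
have [_ _ _ base] := Ds; have [s sS em] := base m Dm mp.
have [a aS al] : exists2 a, a \in s & 0 < form a l.
  apply: form_root_list_gt0; last by rewrite -em.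
  by move=> a /sS[aS Da]; exact: maximal_dominant Ds (highest_maximal Ds lH) Da (simple_pos aS).
have [aSimple Da] := sS a aS.
exists a.
  by exists l => //; split=> //; exists D; split=> //; exact: simple_pos.
exists (rem a s); first by move=> y /mem_rem/sS[].
by rewrite em (big_rem a aS) /= addrAC subrr add0r.
Qed.

(** Let [a] be a simple root of the Heisenberg set of [l] that occurs in [m].
    The subsystem in which [m] pairs with its cascade root [l'] contains [a],
    hence the whole subsystem of [l], so that [l'] lies above [l]. *)
Lemma optimal_heisenberg m : N m -> exists2 l, K l & heisenberg_set b l m.
Proof.
move=> /(nil_rootsP _ optimal_simple)[mp [a [l lK [aSimple [D [Dl Da ap al]]]] ma]].
have [l' ml'] := cascade_cover mp.
have [D' [D'l' D'm _ _]] := ml'; exists l' => //; split; first by exists D'.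
have [Ds' l'H _ _] := cascade_at_props D'l'; have [_ _ _ base] := Ds'.
have [_ D'a] : (simple `&` D') a.
  apply: (cone_support (S := simple `&` D') (l := m)) => //.
  - exact: base.
have [_ /(nil_rootsP _ TS)[lp [c Tc lc]]] := lK.
have l'l : cone simple (l' - l) -> nil_roots b T l'.
  move=> ll'; apply/(nil_rootsP _ TS); split.
    exact: (cascade_root_pos D'l').
  by exists c => //; rewrite -(subrKA l); exact: coneD.
apply: l'l; have [_ _ _ lD] := cascade_at_props Dl.
case: (cascade_trichotomy Dl D'l') => [[_ ->]|sub|sub|dj].
- by rewrite subrr; exact: cone0.
- by have [_ e] := sub a D'a; rewrite e ltxx in al.
- by have [D'l _] := sub l lD; exact: (highest_ge l'H D'l).
- by have : (D `&` D') a by []; rewrite dj.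
Qed.

Lemma nil_cascade_root : K `<=` rootset.
Proof. by move=> l [_ [/pos_is_root]]. Qed.

Lemma nil_roots_root : N `<=` rootset.
Proof. by move=> l [/pos_is_root]. Qed.

Lemma nil_cascade_optimal l : K l -> N l.
Proof. by move=> lK; apply: heisenberg_optimal (lK) _; apply: cascade_heisenberg; case: lK. Qed.

Local Notation hd l := (vsval (dual_vec l)).

Lemma lie_opposite_root_spaces l : lie_root l ->
  lie_vs (root_space l) (root_space (- l)) = <[hd l]>%VS.
Proof.
move=> lr; have /lie_rootP[l0 lw] := lr.
have [e [f [el fl _ Nlw ef]]] := sl2_ex lw.
apply/eqP; rewrite eqEsubv; apply/andP; split.
  apply: lie_vs_subP => x y xl yl.
  by rewrite (lie_dual_vec xl (subvP (root_space_sub _) _ yl)) memvZ ?memv_line.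
rewrite -memvE -ef; apply: memv_lie => //.
by rewrite (root_spaceE Nlw) ?oppr_eq0.
Qed.

Lemma envelopeE : frobenius_envelope b T =
  (root_sum N + \sum_(l <- root_list K) <[hd l]>)%VS.
Proof.
rewrite /frobenius_envelope /nilradical /nil_torus.
rewrite (big_root_list _ _ nil_roots_root) (big_root_list _ _ nil_cascade_root).
congr (_ + _)%VS; apply: eq_big_seq => l /(mem_root_list _ nil_cascade_root) lK.
exact: lie_opposite_root_spaces (nil_cascade_root lK).
Qed.

Lemma envelope_subalg : lie_subalg (frobenius_envelope b T).
Proof.
have sub : (frobenius_envelope b T <= t + root_sum N)%VS.
  rewrite envelopeE subv_add addvSr /=; elim/big_rec: _ => [|l V _ IH]; first exact: sub0v.
  rewrite subv_add IH andbT; apply: subv_trans (addvSl _ _).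
  by rewrite -memvE subvsP.
apply: subv_trans (lie_vsS sub sub) _; apply: subv_trans.
  apply: (lie_torus_root_sum_sub); exact: nil_roots_positive optimal_simple.
by rewrite envelopeE addvSl.
Qed.

Lemma opposite_vectors : exists f : tdual -> g, forall l, lie_root l ->
  f l \in root_space (- l) /\ forall x : g, x \in root_space l -> x != 0 -> killing x (f l) != 0.
Proof.
suff H (l : tdual) : exists f : g, lie_root l -> f \in root_space (- l) /\
    forall x : g, x \in root_space l -> x != 0 -> killing x f != 0.
  by exists (fun l => sval (cid (H l))) => l; case: cid.
have [lr|nr] := EM (lie_root l); last by exists 0.
have /lie_rootP[l0 lw] := lr.
have [e [f [el fl e0 Nlw ef]]] := sl2_ex lw; exists f => _; split.
  by rewrite (root_spaceE Nlw) ?oppr_eq0.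
move=> x xl x0; have ef0 : killing e f != 0.
  apply: contraNneq l0 => ef0; apply/eqP/(dual_vec_inj0)/val_inj => /=.
  by rewrite -ef (lie_dual_vec el fl) ef0 scale0r.
have [v v0 lE] := root_vector lr.
move: xl el x0 ef0; rewrite lE => /vlineP[c ->] /vlineP[c' ->].
rewrite scaler_eq0 negb_or !killingZl !mulf_eq0 !negb_or => /andP[-> _] /andP[_ ->].
by [].
Qed.

(** The vector [z] is a sum of root vectors for the opposites of the roots of
    [K], so that [killing _ z] detects exactly the root spaces of [K]. A root
    [l] in the Heisenberg set of [m] pairs with [m - l] and with no other root;
    the root [m] itself pairs with its dual vector, and the torus with the root
    spaces of [K]. *)
Lemma nondegenerate_functional : exists z : g, forall x : g, x \in frobenius_envelope b T ->
  (forall y : g, y \in frobenius_envelope b T -> killing (lie x y) z = 0) -> x = 0.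
Proof.
have [f fP] := opposite_vectors; pose KL := root_list K; pose NL := root_list N.
have KLP l : (l \in KL) <-> K l by exact: mem_root_list nil_cascade_root.
have NLP l : (l \in NL) <-> N l by exact: mem_root_list nil_roots_root.
have uKL : uniq KL by exact: root_list_uniq.
have uNL : uniq NL by exact: root_list_uniq.
pose z := \sum_(l <- KL) f l.
have fw l : K l -> f l \in gen_weight (- l).
  by move=> /nil_cascade_root/fP[fl _]; exact: (subvP (root_space_sub _)) fl.
have Kz m v : v \in gen_weight m -> killing v z = \sum_(l <- KL | l == m) killing v (f l).
  move=> vm; rewrite killingC killing_suml [RHS]big_mkcond; apply: eq_big_seq => l /KLP lK.
  rewrite killingC; case: eqP => // lm; apply: (killing_orth _ vm (fw l lK)).
  by rewrite subr_eq0; apply/eqP => e; apply: lm.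
have Kz0 m v : v \in gen_weight m -> ~ K m -> killing v z = 0.
  move=> vm nm; rewrite (Kz m v vm) big_seq_cond big1 // => l /andP[/KLP lK /eqP lm].
  by case: nm; rewrite -lm.
have Kz1 m v : v \in gen_weight m -> K m -> killing v z = killing v (f m).
  by move=> vm mK; rewrite (Kz m v vm) -big_filter filter_pred1_uniq ?big_seq1 //; exact/KLP.
have rs m v : v \in root_space m -> v \in gen_weight m by move/(subvP (root_space_sub m)).
have NE m v : N m -> v \in root_space m -> v \in frobenius_envelope b T.
  move=> mN vm; rewrite envelopeE; apply: (subvP (addvSl _ _)).
  exact: (subvP (root_sum_sup nil_roots_root mN)).
exists z => x; rewrite {1}envelopeE => /memv_addP[v].
move=> /root_sum_decomp[p [pm ->]] [_ /(big_seq_memv uKL)[q [qK ->]] ->] stab.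
have [k ek] : exists k : subvs_of t, vsval k = \sum_(l <- KL) q l.
  have qt : \sum_(l <- KL) q l \in t.
    by rewrite memv_suml // => l _; have /vlineP[c ->] := qK l; rewrite memvZ ?subvsP.
  by exists (Subvs qt).
rewrite -ek in stab *; rewrite -/NL in stab *.
have bracket (y : g) : lie (\sum_(l <- NL) p l + vsval k) y =
    \sum_(l <- NL) lie (p l) y + lie (vsval k) y.
  by rewrite lieDl lie_suml.
have p0 l : N l -> p l = 0.
  move=> lN; have [m mK ml] := optimal_heisenberg lN.
  have mr := nil_cascade_root mK; have lr := nil_roots_root lN.
  have [mKc _] := mK.
  have lL : l \in NL by apply/NLP.
  apply/eqP; apply: contraT => pl0; have [lm|/eqP lm] := eqVneq l m.
    (* For [l] in the cascade, bracket with the dual vector of [l]: the other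
       cascade roots do not contribute because they are orthogonal to [l]. *)
    have hf : hd l \in frobenius_envelope b T.
      rewrite envelopeE; apply: (subvP (addvSr _ _)); rewrite lm.
      have mL : m \in root_list K by apply/KLP.
      by rewrite (big_rem m mL) /=; apply: (subvP (addvSl _ _)); exact: memv_line.
    have := stab _ hf; rewrite bracket torus_abelian addr0.
    have ev (n : tdual) : lie (p n) (hd l) = - form n l *: p n.
      by rewrite lieC; have /root_spaceP -> := pm n; rewrite scaleNr.
    rewrite killing_suml (bigD1_seq l) //= big1_seq ?addr0 => [|n /andP[nl nL]]; last first.
      rewrite ev killingZl; have [nK|nK] := EM (K n); last by rewrite (Kz0 n) ?mulr0 //; exact: rs.
      have [nKc _] := nK; rewrite (cascade_orthogonal nKc _ nl).
        by rewrite oppr0 mul0r.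
      by rewrite lm.
    have lK : K l by rewrite lm.
    rewrite ev killingZl (Kz1 l) //; last exact: rs.
    have [_ /(_ _ (pm l) pl0) nz] := fP l lr.
    by move/eqP; rewrite mulf_eq0 oppr_eq0 gt_eqF ?form_self_gt0 // (negPf nz).
  (* Otherwise bracket with a root vector [y] for [m - l]: the component [p l] is
     the only one that [y] sends to a cascade root space, namely that of [m]. *)
  have dH := heisenberg_partner ml lm; have dN := heisenberg_optimal mK dH.
  have dp := nil_roots_root dN; have [y y0 dE] := root_vector dp.
  have yd : y \in root_space (m - l) by rewrite dE memv_line.
  have := stab y (NE _ _ dN yd); rewrite bracket killingDl killing_suml.
  rewrite (bigD1_seq l) //= big1_seq ?addr0 => [|n /andP[nl nL]]; last first.
    apply: (Kz0 (n + (m - l))); first exact/rs/lie_root_space.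
    move=> sK; have [sKc _] := sK.
    have [np _] := iffLR (NLP n) nL.
    have dpos := heisenberg_pos dH.
    have e : n + (m - l) = m.
      apply: (heisenberg_unique (m := m - l)) dH; apply: (cascade_sum_heisenberg (y := n)) => //.
      by rewrite addrC.
    by move/eqP: nl; apply; apply: (addIr (m - l)); rewrite e addrC subrK.
  rewrite (_ : killing (lie (vsval k) y) z = 0) ?addr0; last first.
    have /root_spaceP -> := yd; rewrite killingZl (Kz0 (m - l)) ?mulr0 //; first exact: rs.
    move=> [dKc _]; have e := heisenberg_unique (cascade_heisenberg dKc) dH.
    by have := root_neq0 lr; rewrite -(subKr m l) e subrr eqxx.
  have ply : lie (p l) y \in root_space m.
    by have := lie_root_space (pm l) yd; rewrite addrC subrK.
  have nz : lie (p l) y != 0.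
    apply: (lie_root_space_neq0 lr dp _ (pm l) yd pl0 y0).
    by rewrite addrC subrK.
  rewrite (Kz1 m) //; last exact: rs.
  by have [_ /(_ _ ply nz)/eqP] := fP m mr.
(* What is left is the component [k] in [t], on which each cascade root vanishes
   by bracketing with its root vectors. Since [k] is a combination of the dual
   vectors of the roots of [K], which are orthogonal, its coefficients vanish. *)
have k0 m : K m -> m k = 0.
  move=> mK; have mr := nil_cascade_root mK; have [y y0 mE] := root_vector mr.
  have ym : y \in root_space m by rewrite mE memv_line.
  have := stab y (NE _ _ (nil_cascade_optimal mK) ym); rewrite bracket big1_seq ?add0r; last first.
    by move=> n /andP[_ /NLP nN]; rewrite p0 // lie0l.
  have /root_spaceP -> := ym; rewrite killingZl (Kz1 m) //; last exact: rs.
  by have [_ /(_ _ ym y0) nz] := fP m mr; move/eqP; rewrite mulf_eq0 (negPf nz) orbF => /eqP.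
rewrite [X in X + _]big1_seq ?add0r => [|n /andP[_ /NLP/p0//]].
rewrite ek big1_seq // => l /andP[_ lL]; have /KLP lK := lL.
have /vlineP[c ec] := qK l; rewrite ec.
suff -> : c = 0 by rewrite scale0r.
have [d dE] : exists d : tdual -> F, forall n, q n = d n *: hd n.
  have H n : exists d, q n = d *: hd n by have /vlineP[d ->] := qK n; exists d.
  by exists (fun n => sval (cid (H n))) => n; case: cid.
have ekd : k = \sum_(n <- KL) d n *: dual_vec n.
  by apply: val_inj; rewrite /= ek raddf_sum; apply: eq_bigr => n _; rewrite dE.
have := k0 l lK; rewrite ekd linear_sum (bigD1_seq l) //= big1_seq ?addr0.
  rewrite linearZ /= -formE => /eqP; rewrite mulf_eq0 (gt_eqF (form_self_gt0 (nil_cascade_root lK))) orbF.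
  move/eqP => d0; have := dE l; rewrite d0 scale0r ec => /eqP; rewrite scaler_eq0 => /orP[/eqP//|/eqP h0].
  have : dual_vec l = 0 by apply: val_inj.
  move/dual_vec_inj0 => l0.
  by have := root_neq0 (nil_cascade_root lK); rewrite l0 eqxx.
move=> n /andP[nl /KLP nK]; rewrite linearZ /= -formE.
have [[lKc _] [nKc _]] := (lK, nK).
by rewrite (cascade_orthogonal lKc nKc) ?scaler0 // eq_sym.
Qed.

End Optimal.
End Envelope.

End Borel.

End SimpleLieAlgebra.

(** * Index zero *)

(** The index is a minimum, so one functional with trivial stabilizer suffices. *)
Lemma frobenius_of_functional (F : numClosedFieldType) (g : lieAlgType F)
    (U : {vspace g}) (hU : lie_subalg U) (z : g) :
  (forall x, x \in U -> (forall y, y \in U -> killing (lie x y) z = 0) -> x = 0) ->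
  frobenius (lie_sub hU).
Proof.
move=> nondeg; pose xi (x : lie_sub hU) : F^o := killing (vsval x) z.
have xi_lin : linear xi by move=> a u v; rewrite /xi /= killingDl killingZl.
have stab0 : lie_stab (linfun xi) = 0%VS.
  apply/eqP; rewrite -subv0; apply/subvP => x /mem_lie_stab xs; rewrite memv0; apply/eqP.
  apply: val_inj; apply: nondeg (subvsP _) _ => y yU.
  by have := xs (Subvs yU); rewrite (linfunE_linear xi_lin).
rewrite /frobenius /lie_index; case: ex_minnP => n _ min; apply/eqP; rewrite -leqn0.
by apply: min; apply/asboolP; exists (linfun xi); rewrite stab0 dimv0.
Qed.

Theorem proposition5p1 (R : realType) (g : lieAlgType R[i])
    (t b : {vspace g})
    (g_simple : lie_simple g)
    (b_borel : borel b)
    (t_cartan : cartan t)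
    (t_sub_b : (t <= b)%VS)
    (T : set 'Hom(subvs_of t, R[i]^o))
    (T_simple : T `<=` simple_root t b) :
  exists f_subalg : lie_subalg (frobenius_envelope b T),
    frobenius (lie_sub f_subalg).
Proof.
exists (envelope_subalg g_simple t_cartan b_borel t_sub_b T).
have [z zP] := nondegenerate_functional g_simple t_cartan b_borel t_sub_b T_simple.
exact: frobenius_of_functional zP.
Qed.
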